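(* Let $R$ be a Noetherian integral domain, let $G \subseteq GL_n(R)$ be a finite group, and let $S := R[x_1, \ldots, x_n]$. If the ring of invariants $S^G$ is a Cohen-Macaulay ring, then $\beta_R(G) \leq \max(|G|,\, n(|G|-1))$.
   Context: All rings are commutative. The polynomial ring $R[x_1,\ldots,x_n]$ is $\mathbb{N}$-graded with $\deg(x_i)=1$ and degree-zero part $R$. A subgroup $G \subseteq GL_n(R)$ acts on $R[x_1,\ldots,x_n]$ by $R$-algebra automorphisms via $\sigma(f) = f(\sigma^{-1}(x_1,\ldots,x_n))$ for $\sigma \in G$, and $S^G=R[x_1,\ldots,x_n]^G$ denotes the graded subring of invariants. For a Noetherian ring $R$ and a finite group $G \subseteq GL_n(R)$, $\beta_R(G)$ denotes the smallest integer $k$ such that $R[x_1,\ldots,x_n]^G$ is generated as an $R$-algebra by elements of degree at most $k$. *)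

(* Defs.v *)
From HB Require Import structures.
From mathcomp Require Import all_boot all_algebra finmap.
From mathcomp.multinomials Require Export mpoly.

Set Implicit Arguments.
Unset Strict Implicit.
Unset Printing Implicit Defensive.

Import GRing.Theory.
Local Open Scope ring_scope.

(* Ideals are Prop-valued: the boolean ones of [ring_quotient] are the
   decidable ideals only. *)
Section Ideals.
Variable A : comNzRingType.
Implicit Types (I P M : A -> Prop) (s : seq A).

Definition is_ideal I :=
  [/\ I 0, forall a b, I a -> I b -> I (a + b) & forall c a, I a -> I (c * a)].

Definition prime_ideal P :=
  [/\ is_ideal P, ~ P 1 & forall a b, P (a * b) -> P a \/ P b].

Definition maximal_ideal M :=
  [/\ is_ideal M, ~ M 1
    & forall I, is_ideal I -> ~ I 1 -> (forall a, M a -> I a) ->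
      forall a, I a -> M a].

Definition ideal_span s : A -> Prop :=
  fun a => exists c : nat -> A, a = \sum_(i < size s) c i * s`_i.

Definition noetherian :=
  forall I, is_ideal I -> exists s, forall a, I a <-> ideal_span s a.

Definition prime_chain d (P : 'I_d.+1 -> A -> Prop) :=
  (forall i, prime_ideal (P i)) /\
  (forall i j : 'I_d.+1, (i < j)%N ->
     (forall a, P i a -> P j a) /\ exists2 a, P j a & ~ P i a).

Definition krull_dim d :=
  (exists P : 'I_d.+1 -> A -> Prop, prime_chain P) /\
  (forall e (P : 'I_e.+1 -> A -> Prop), prime_chain P -> (e <= d)%N).

Definition regular_seq s :=
  ~ ideal_span s 1 /\
  (forall i, (i < size s)%N ->
     forall b, ideal_span (take i s) (s`_i * b) -> ideal_span (take i s) b).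

Definition depth I d :=
  (exists2 s, regular_seq s /\ (forall a, a \in s -> I a) & size s = d) /\
  (forall s, regular_seq s -> (forall a, a \in s -> I a) -> (size s <= d)%N).

Definition local_ring M :=
  maximal_ideal M /\
  forall N, maximal_ideal N -> forall a, N a <-> M a.

Definition cohen_macaulay_local :=
  noetherian /\ exists M d, [/\ local_ring M, krull_dim d & depth M d].

End Ideals.

(* L, with the structure map phi, is the localization of A at the prime P.
   As such an L is unique up to isomorphism, a property of "the" localization
   is stated below as holding for some L. *)
Definition is_localization (A L : comNzRingType) (P : A -> Prop)
    (phi : {rmorphism A -> L}) :=
  [/\ forall s, ~ P s -> exists y, phi s * y = 1,
      forall y, exists a s, ~ P s /\ y * phi s = phi a
    & forall a b, phi a = phi b -> exists2 s, ~ P s & s * a = s * b].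

Definition cohen_macaulay (A : comNzRingType) :=
  noetherian A /\
  forall M : A -> Prop, maximal_ideal M ->
    exists (L : comNzRingType) (phi : {rmorphism A -> L}),
      is_localization M phi /\ cohen_macaulay_local L.

Section Invariants.
Variables (R : idomainType) (n : nat).
Implicit Types (s : 'M[R]_n) (f : {mpoly R[n]}) (G : {fset 'M[R]_n}).

Definition subgroup_GL G :=
  [/\ forall s, s \in G -> s \in unitmx,
      1%:M \in G,
      forall s t, s \in G -> t \in G -> s *m t \in G
    & forall s, s \in G -> invmx s \in G].

(* f(s^-1 x), with x = (x_1, ..., x_n) read as a column vector. *)
Definition mpoly_act s f : {mpoly R[n]} :=
  f \mPo [tuple \sum_(j < n) invmx s i j *: 'X_j | i < n].

Definition invariants G : {pred {mpoly R[n]}} :=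
  [pred f | all (fun s => mpoly_act s f == f) G].

Lemma invariants_subring G : subring_closed (invariants G).
Proof.
split=> [|f g|f g].
- by apply/allP=> s _; rewrite /mpoly_act comp_mpoly1.
- move=> /allP Hf /allP Hg; apply/allP=> s sG; rewrite /mpoly_act rmorphB /=.
  by rewrite -!/(mpoly_act _ _) (eqP (Hf s sG)) (eqP (Hg s sG)).
- move=> /allP Hf /allP Hg; apply/allP=> s sG; rewrite /mpoly_act rmorphM /=.
  by rewrite -!/(mpoly_act _ _) (eqP (Hf s sG)) (eqP (Hg s sG)).
Qed.

HB.instance Definition _ G :=
  GRing.isSubringClosed.Build _ (invariants G) (invariants_subring G).

Record invariant_ring G :=
  InvariantRing { invariant_val :> {mpoly R[n]}; _ : invariant_val \in invariants G }.

HB.instance Definition _ G := [isSub for @invariant_val G].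
HB.instance Definition _ G := [Choice of invariant_ring G by <:].
HB.instance Definition _ G :=
  [SubChoice_isSubComNzRing of invariant_ring G by <:].

(* msize f = 1 + deg f for f != 0, and msize 0 = 0. *)
Definition generated_in_degree G k :=
  forall f, f \in invariants G ->
    exists m (g : m.-tuple {mpoly R[n]}) (p : {mpoly R[m]}),
      (forall i, tnth g i \in invariants G /\ (msize (tnth g i) <= k.+1)%N) /\
      f = p \mPo g.

(* The relation "beta_R(G) = k". *)
Definition is_beta G k :=
  generated_in_degree G k /\
  forall j, generated_in_degree G j -> (k <= j)%N.

End Invariants.

(* Main.v *)
Require Import Defs.
From mathcomp Require Import all_boot all_algebra finmap.
From HB Require Import structures.
From mathcomp Require Import ring zify qpoly.
From Stdlib Require List.
From mathcomp Require boolp classical_sets.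

(** Let [g] be the order of [G], [S] the polynomial ring and [B] its ring of
    invariants.  It suffices to show that a homogeneous invariant [b] of degree
    [t > max(g, n(g-1))] lies in the ideal of [B] generated by its elements of
    degree [g]: its cofactors have degree [t - g], and an induction on the
    degree applies.  This may be checked one maximal ideal [m] of [R] at a time,
    up to a scalar outside [m].

    Over a large residue field, [n] linear forms can be chosen such that any
    choice of one conjugate of each is a basis (Dade).  The products [f_1, ..,
    f_n] of their conjugates are invariants of degree [g], and [S] is finite
    over [R[f_1, .., f_n]].  The proof shows that [b] lies in [(f_1, .., f_n)]
    and has two halves.

    The first half is a statement about fraction fields: some nonzero scalar
    multiple of [b (f_1 .. f_n)^k] lies in [(f_1^(k+1), .., f_n^(k+1))]
    ([top_degree]).  In other words, the class of [b / (f_1 .. f_n)] in the top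
    local cohomology of [B] is torsion.  Indeed this class is the transfer of a
    class of [S]: the transfer does not vanish ([exists_transfer_neq0]), and top
    local cohomology is divisible by every nonzero invariant, because this
    invariant divides a polynomial in the [f_j] ([algebraic_dependence],
    [socle_multiple]).  The class of [S] has degree above [- n], where the top
    local cohomology of [S] vanishes ([lprod_generate]).

    The second half removes the factors [f_j] and the scalar, and this is where
    the invariants have to be Cohen-Macaulay.  In a local ring with a regular
    sequence as long as its dimension [d], a sequence is regular as soon as a
    prime that contains [i] of its entries starts no chain of more than [d - i]
    steps ([regular_of_dimension]).  This is checked for powers of the [f_j],
    followed by a nonzero scalar, without any dimension theory for noetherian
    rings ([dimension_bound]): a prime over [f_j] contracts from a prime of [S]
    that contains a conjugate of the [j]-th linear form, and the elements of
    this prime that stay in it under translation along the dual basis vector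
    form a smaller prime, which contains everything else that matters
    ([descend]).  Each [f_j] thus pays for one step down, and the scalar for
    another step, down to the zero ideal.

    Residue fields can be finite.  So the linear forms are taken over [R[X]]
    ([generic_det]), which is enough for the first half, and [X] is then
    specialized to a root of a monic polynomial [h] that is irreducible modulo
    [m], avoids the finitely many determinants and is prime to the scalar of
    the first half ([exists_good_modulus]).  The extension [L[X]/(h)] of the
    local ring [L] of [B] is module-finite and free, so it inherits noetherianity,
    locality, the regular sequence and the bound on the dimension. *)

Set Implicit Arguments.
Unset Strict Implicit.
Unset Printing Implicit Defensive.

Import GRing.Theory.
Local Open Scope ring_scope.

(** * Ideals and chains of primes *)

Section IdealTheory.
Variable A : comNzRingType.
Implicit Types (I J P Q : A -> Prop) (s : seq A).

Lemma ideal_zero I : is_ideal I -> I 0. Proof. by case. Qed.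
Lemma ideal_add I a b : is_ideal I -> I a -> I b -> I (a + b).
Proof. by case=> _ h _; apply: h. Qed.
Lemma ideal_mull I c a : is_ideal I -> I a -> I (c * a).
Proof. by case=> _ _; apply. Qed.
Lemma ideal_mulr I c a : is_ideal I -> I a -> I (a * c).
Proof. by rewrite mulrC; apply: ideal_mull. Qed.
Lemma ideal_opp I a : is_ideal I -> I a -> I (- a).
Proof. by rewrite -mulN1r; apply: ideal_mull. Qed.
Lemma ideal_sub I a b : is_ideal I -> I a -> I b -> I (a - b).
Proof. by move=> iI Ia Ib; apply: ideal_add => //; apply: ideal_opp. Qed.
Lemma ideal_sum I (T : Type) (r : seq T) (Pr : pred T) (F : T -> A) :
  is_ideal I -> (forall i, Pr i -> I (F i)) -> I (\sum_(i <- r | Pr i) F i).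
Proof.
by move=> iI IF; apply: big_ind => //; [apply: ideal_zero|move=> *; apply: ideal_add].
Qed.
Lemma ideal_exp I a k : is_ideal I -> I a -> (0 < k)%N -> I (a ^+ k).
Proof. by move=> iI Ia; case: k => // k _; rewrite exprS; apply: ideal_mulr. Qed.
Lemma ideal_eqr I a b : is_ideal I -> I (a - b) -> I b -> I a.
Proof. by move=> iI Iab Ib; rewrite -(subrK b a); apply: ideal_add. Qed.
Lemma ideal_subC I a b : is_ideal I -> I (a - b) -> I (b - a).
Proof. by move=> iI /(ideal_opp iI); rewrite opprB. Qed.

Lemma prime_is_ideal P : prime_ideal P -> is_ideal P. Proof. by case. Qed.
Lemma prime_mul P a b : prime_ideal P -> P (a * b) -> P a \/ P b.
Proof. by case=> _ _; apply. Qed.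
Lemma prime_not1 P : prime_ideal P -> ~ P 1. Proof. by case. Qed.
Lemma prime_exp P a k : prime_ideal P -> P (a ^+ k) -> P a.
Proof.
move=> pP; elim: k => [|k IH]; first by move/(prime_not1 pP).
by rewrite exprS => /(prime_mul pP) [].
Qed.
Lemma prime_prod P (T : eqType) (r : seq T) (F : T -> A) :
  prime_ideal P -> P (\prod_(i <- r) F i) -> exists2 i, i \in r & P (F i).
Proof.
move=> pP; elim: r => [|i r IH]; first by rewrite big_nil => /(prime_not1 pP).
rewrite big_cons => /(prime_mul pP) [Pi|/IH [j jr Pj]].
  by exists i; rewrite ?inE ?eqxx.
by exists j; rewrite // inE jr orbT.
Qed.

Definition add_gen I (y : A) : A -> Prop := fun a => exists c, I (a - c * y).

Lemma add_gen_ideal I y : is_ideal I -> is_ideal (add_gen I y).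
Proof.
move=> iI; split.
- by exists 0; rewrite mul0r subr0; apply: ideal_zero.
- move=> a b [c Ia] [d Ib]; exists (c + d).
  by rewrite mulrDl opprD addrACA; apply: ideal_add.
- by move=> c a [d Ia]; exists (c * d); rewrite -mulrA -mulrBr; apply: ideal_mull.
Qed.
Lemma add_gen_sub I y a : I a -> add_gen I y a.
Proof. by move=> Ia; exists 0; rewrite mul0r subr0. Qed.
Lemma add_gen_mem I y : is_ideal I -> add_gen I y y.
Proof. by move=> iI; exists 1; rewrite mul1r subrr; apply: ideal_zero. Qed.
Lemma add_gen_min I J y : is_ideal J -> (forall a, I a -> J a) -> J y ->
  forall a, add_gen I y a -> J a.
Proof.
move=> iJ IJ Jy a [c Ia]; apply: (@ideal_eqr J a (c * y)) => //; first exact: IJ.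
exact: ideal_mull.
Qed.
Lemma add_genC I x y : add_gen (add_gen I x) y = add_gen (add_gen I y) x.
Proof.
apply/boolp.predeqP => a; split=> [] [c [d Id]]; exists d, c.
  by rewrite addrAC.
by rewrite addrAC.
Qed.

Lemma ideal_spanP s : is_ideal (ideal_span s).
Proof.
split.
- by exists (fun=> 0); rewrite big1 // => i _; rewrite mul0r.
- move=> a b [c ->] [d ->]; exists (fun i => c i + d i).
  by rewrite -big_split /=; apply: eq_bigr => i _; rewrite mulrDl.
- move=> x a [c ->]; exists (fun i => x * c i).
  by rewrite mulr_sumr; apply: eq_bigr => i _; rewrite mulrA.
Qed.
Lemma ideal_span_cons x s a :
  ideal_span (x :: s) a <-> exists c, ideal_span s (a - c * x).
Proof.
split=> [[c ->]|[c [d ed]]].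
  exists (c 0%N), (fun i => c i.+1); rewrite /= big_ord_recl /= addrC addKr.
  exact: eq_bigr.
exists (fun i => if i is j.+1 then d j else c).
by rewrite /= big_ord_recl /= -(subrK (c * x) a) ed addrC.
Qed.
Lemma ideal_span_nil a : ideal_span ([::] : seq A) a <-> a = 0.
Proof. by split=> [[c ->]|->]; [rewrite big_ord0|exists (fun=> 0); rewrite big_ord0]. Qed.
Lemma ideal_span_mem s a : a \in s -> ideal_span s a.
Proof.
elim: s => // x s IH; rewrite inE => /orP [/eqP ->|/IH sa].
  by apply/ideal_span_cons; exists 1; rewrite mul1r subrr; apply: ideal_zero; apply: ideal_spanP.
by apply/ideal_span_cons; exists 0; rewrite mul0r subr0.
Qed.
Lemma ideal_span_min J s a : is_ideal J -> (forall x, x \in s -> J x) ->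
  ideal_span s a -> J a.
Proof.
move=> iJ sJ [c ->]; apply: ideal_sum => // i _; apply: ideal_mull => //.
by apply: sJ; apply: mem_nth.
Qed.
Lemma ideal_span_rcons s y : ideal_span (rcons s y) = add_gen (ideal_span s) y.
Proof.
apply/boolp.predeqP => a; split.
  apply: ideal_span_min; first by apply: add_gen_ideal; apply: ideal_spanP.
  move=> x; rewrite mem_rcons inE => /orP [/eqP ->|xs].
    by apply: add_gen_mem; apply: ideal_spanP.
  by apply: add_gen_sub; apply: ideal_span_mem.
apply: add_gen_min; first exact: ideal_spanP.
  move=> b; apply: ideal_span_min; first exact: ideal_spanP.
  by move=> x xs; apply: ideal_span_mem; rewrite mem_rcons inE xs orbT.
by apply: ideal_span_mem; rewrite mem_rcons inE eqxx.
Qed.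

(** Zorn's lemma.  Only nonempty chains need a union in the family, which is
    what families of ideals with a prescribed element satisfy. *)
Lemma exists_maximal_above (T : Type) (Phi : (T -> Prop) -> Prop) (I0 : T -> Prop) :
  Phi I0 ->
  (forall F : (T -> Prop) -> Prop, (exists X, F X) -> (forall X, F X -> Phi X) ->
     (forall X Y, F X -> F Y ->
        (forall a, X a -> Y a) \/ (forall a, Y a -> X a)) ->
     Phi (fun a => exists2 X, F X & X a)) ->
  exists M, [/\ Phi M, forall a, I0 a -> M a
    & forall K, Phi K -> (forall a, M a -> K a) -> forall a, K a -> M a].
Proof.
move=> Phi0 chain.
pose Psi (X : T -> Prop) := Phi (fun a => I0 a \/ X a).
have [|M [PM maxM]] := @classical_sets.Zorn_bigcup T Psi.
  move=> F FP totF; rewrite /Psi.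
  have [[X0 FX0]|noF] := boolp.EM (exists X, F X); last first.
    have -> : (fun a => I0 a \/ classical_sets.bigcup F id a) = I0.
      apply/boolp.predeqP => a; split=> [[//|[X FX _]]|]; last by left.
      by case: noF; exists X.
    exact: Phi0.
  have -> : (fun a => I0 a \/ classical_sets.bigcup F id a) =
     (fun a => exists2 X, (exists2 Y, F Y & X = (fun b => I0 b \/ Y b)) & X a).
    apply/boolp.predeqP => a; split=> [[Ia|[X FX Xa]]|[X [Y FY ->]] [Ia|Ya]].
    - by exists (fun b => I0 b \/ X0 b); [exists X0|left].
    - by exists (fun b => I0 b \/ X b); [exists X|right].
    - by left.
    - by right; exists Y.
  apply: chain; first by exists (fun b => I0 b \/ X0 b), X0.
    by move=> _ [Y FY ->]; apply: FP.
  move=> _ _ [Y FY ->] [Z FZ ->].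
  case: (totF Y Z FY FZ) => YZ; [left|right] => a [Ia|Xa]; first by left.
  - by right; apply: YZ.
  - by left.
  - by right; apply: YZ.
exists (fun a => I0 a \/ M a); split => //; first by left.
move=> J PJ MJ a Ja; right.
apply: boolp.contrapT => nMa; apply: (maxM J).
  split; last by move/(_ a Ja)/nMa.
  by move=> b Mb; apply: MJ; right.
rewrite /Psi.
suff -> : (fun b => I0 b \/ J b) = J by [].
apply/boolp.predeqP => b; split; last by right.
by case=> // Ib; apply: MJ; left.
Qed.

Lemma chain_union_ideal (F : (A -> Prop) -> Prop) : (exists X, F X) ->
  (forall X, F X -> is_ideal X) ->
  (forall X Y, F X -> F Y -> (forall a, X a -> Y a) \/ (forall a, Y a -> X a)) ->
  is_ideal (fun a => exists2 X, F X & X a).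
Proof.
move=> [X0 FX0] Fi tot; split.
- by exists X0 => //; exact: ideal_zero (Fi _ FX0).
- move=> a b [X FX Xa] [Y FY Yb]; case: (tot X Y FX FY) => XY.
    by exists Y => //; apply: ideal_add (Fi _ FY) _ _ => //; apply: XY.
  by exists X => //; apply: ideal_add (Fi _ FX) _ _ => //; apply: XY.
- by move=> c a [X FX Xa]; exists X => //; apply: ideal_mull => //; apply: Fi.
Qed.

(** A finite set of generators of the union of a chain lies in one member. *)
Lemma noetherian_maximal (Phi : (A -> Prop) -> Prop) I0 : noetherian A ->
  (forall I, Phi I -> is_ideal I) -> Phi I0 ->
  exists M, [/\ Phi M, forall a, I0 a -> M a
    & forall J, Phi J -> (forall a, M a -> J a) -> forall a, J a -> M a].
Proof.
move=> noeth Phii Phi0; apply: exists_maximal_above => // F Fne FPhi tot.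
have iU := chain_union_ideal Fne (fun X FX => Phii _ (FPhi X FX)) tot.
have [s Us] := noeth _ iU.
have [X FX sX] : exists2 X, F X & forall x, x \in s -> X x.
  have sU x : x \in s -> exists2 X, F X & X x by move=> xs; apply/Us; apply: ideal_span_mem.
  elim: {Us}s sU => [|x s IH] sU; first by case: Fne => X FX; exists X.
  have [y ys|X FX sX] := IH; first by apply: sU; rewrite inE ys orbT.
  have [|Y FY Yx] := sU x; first by rewrite inE eqxx.
  case: (tot X Y FX FY) => XY.
    by exists Y => // y; rewrite inE => /orP [/eqP ->|/sX /XY].
  by exists X => // y; rewrite inE => /orP [/eqP ->|/sX //]; apply: XY.
suff -> : (fun a => exists2 X, F X & X a) = X by apply: FPhi.
apply/boolp.predeqP => a; split=> [/Us|Xa]; last by exists X.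
by apply: ideal_span_min => //; apply: Phii; apply: FPhi.
Qed.

Lemma exists_maximal_ideal I : is_ideal I -> ~ I 1 ->
  exists M, maximal_ideal M /\ forall a, I a -> M a.
Proof.
move=> iI nI1.
have [|F Fne FPhi tot|M [[iM nM1] IM maxM]] :=
    @exists_maximal_above A (fun J => is_ideal J /\ ~ J 1) I; first by [].
  split; first by apply: chain_union_ideal tot => // X /FPhi [].
  by case=> X /FPhi [].
by exists M; split=> //; split=> // J iJ nJ1 MJ a; apply: maxM.
Qed.

Lemma maximal_inv (M : A -> Prop) a : maximal_ideal M -> ~ M a -> exists c, M (c * a - 1).
Proof.
move=> [iM nM1 maxM] nMa; apply: boolp.contrapT => noc.
apply: nMa; apply: (maxM (add_gen M a)).
- exact: add_gen_ideal.
- by move=> [c Mc]; apply: noc; exists c; apply: ideal_subC.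
- by move=> b; apply: add_gen_sub.
- exact: add_gen_mem.
Qed.

Lemma maximal_prime (M : A -> Prop) : maximal_ideal M -> prime_ideal M.
Proof.
move=> mM; have [iM nM1 _] := mM; split=> // a b Mab.
have [Ma|/(maximal_inv mM) [c Mc]] := boolp.EM (M a); [by left|right].
rewrite -(subrK (c * a * b) b); apply: ideal_add => //.
  by rewrite -[X in X - _]mul1r -mulrBl; apply: ideal_mulr => //; apply: ideal_subC.
by rewrite -mulrA; apply: ideal_mull.
Qed.

Lemma maximal_of_inv (M : A -> Prop) : is_ideal M -> ~ M 1 ->
  (forall a, ~ M a -> exists c, M (c * a - 1)) -> maximal_ideal M.
Proof.
move=> iM nM1 inv; split=> // I iI nI1 MI a Ia; apply: boolp.contrapT => /inv [c Mc].
apply: nI1; apply: (@ideal_eqr _ 1 (c * a)) => //; last exact: ideal_mull.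
by apply: ideal_subC => //; apply: MI.
Qed.

Lemma local_unit (M : A -> Prop) a : local_ring M -> ~ M a -> exists c, c * a = 1.
Proof.
move=> [mM uM] nMa; apply: boolp.contrapT => noc; apply: nMa.
have iI0 : @is_ideal A (fun x => x = 0).
  by split=> [//|x y -> ->|c x ->]; rewrite ?addr0 ?mulr0.
have [|[c]|N [mN aN]] := @exists_maximal_ideal (add_gen (fun x => x = 0) a).
- exact: add_gen_ideal.
- by move/eqP; rewrite subr_eq0 => /eqP e; apply: noc; exists c.
by apply/(uM _ mN); apply: aN; apply: add_gen_mem.
Qed.

Lemma zero_ideal : @is_ideal A (fun x => x = 0).
Proof. by split=> [//|x y -> ->|c x ->]; rewrite ?addr0 ?mulr0. Qed.

Lemma local_of_inv (M : A -> Prop) : maximal_ideal M ->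
  (forall N, maximal_ideal N -> forall a, M a -> N a) -> local_ring M.
Proof.
move=> mM MN; split=> // N mN a; split=> [|]; last exact: MN.
have [iN nN1 _] := mN; have [_ _] := mM; apply=> // b; exact: MN.
Qed.

(** A chain of primes with [e] steps up, as a predicate on its lowest prime:
    chains are extended at the bottom throughout. *)
Fixpoint up (e : nat) (P : A -> Prop) : Prop :=
  if e is e'.+1 then
    prime_ideal P /\
    exists Q, [/\ forall a, P a -> Q a, exists2 a, Q a & ~ P a & up e' Q]
  else prime_ideal P.

Lemma up_prime e P : up e P -> prime_ideal P.
Proof. by case: e => [|e] // []. Qed.

Lemma up_chain e P : up e P ->
  exists Ps : 'I_e.+1 -> A -> Prop, prime_chain Ps.
Proof.
move=> upP.
suff [F [F0 [pF sF]]] : exists F : nat -> A -> Prop, F 0%N = P /\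
    (forall i, (i <= e)%N -> prime_ideal (F i)) /\
    (forall i, (i < e)%N ->
      (forall a, F i a -> F i.+1 a) /\ exists2 a, F i.+1 a & ~ F i a).
  exists (fun i => F i); split=> [i|i j ij]; first by apply: pF; rewrite -ltnS.
  have mono k l : (k <= l)%N -> (l <= e)%N -> forall a, F k a -> F l a.
    move=> kl le a Fa; rewrite -(subnKC kl) in le *.
    elim: (l - k)%N le => [|d IH] le; first by rewrite addn0.
    rewrite addnS in le *; apply: (proj1 (sF _ le)).
    by apply: IH; apply: ltnW.
  have je : (j <= e)%N by rewrite -ltnS.
  split; first by apply: mono => //; apply: ltnW.
  have [|_ [a Fa nFa]] := sF i; first exact: leq_trans ij je.
  by exists a => //; apply: mono Fa.
elim: e P upP => [|e IH] P.
  by move=> /= pP; exists (fun=> P).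
move=> /= [pP [Q [PQ sPQ /IH [F [F0 [pF sF]]]]]].
exists (fun i => if i is j.+1 then F j else P); split=> //; split.
  by case=> // i /pF.
by case=> [|i] ie; [rewrite F0|apply: sF].
Qed.

End IdealTheory.

(** * Associated primes and depth *)

Section AssociatedPrimes.
Variable A : comNzRingType.
Hypothesis noethA : noetherian A.
Implicit Types (I J P Q : A -> Prop) (s : seq A) (Ps : seq (A -> Prop)).

(** Proper ideals of this form that are maximal among them are the maximal
    associated primes of [A / I]. *)
Definition colon I z : A -> Prop := fun a => I (a * z).

Lemma colon_ideal I z : is_ideal I -> is_ideal (colon I z).
Proof.
move=> iI; split; rewrite /colon.
- by rewrite mul0r; apply: ideal_zero.
- by move=> a b Ia Ib; rewrite mulrDl; apply: ideal_add.
- by move=> c a Ia; rewrite -mulrA; apply: ideal_mull.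
Qed.

Definition max_colon I z :=
  ~ I z /\ forall z', ~ I z' -> (forall a, I (a * z) -> I (a * z')) ->
    forall a, I (a * z') -> I (a * z).

Lemma max_colon_prime I z : is_ideal I -> max_colon I z -> prime_ideal (colon I z).
Proof.
move=> iI [nIz maxz]; split; first exact: colon_ideal.
  by rewrite /colon mul1r.
move=> a b Iabz; have [Ibz|nIbz] := boolp.EM (I (b * z)); [by right|left].
apply: (maxz (b * z)) => //; last by rewrite mulrA.
by move=> c Icz; rewrite mulrCA; apply: ideal_mull.
Qed.

Lemma exists_max_colon I z : is_ideal I -> ~ I z ->
  exists z', max_colon I z' /\ forall a, I (a * z) -> I (a * z').
Proof.
move=> iI nIz.
pose Phi J := exists z', ~ I z' /\ J = colon I z'.
have [|||M [[z' [nIz' ->]] zM maxM]] := @noetherian_maximal A Phi (colon I z).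
- exact: noethA.
- by move=> _ [z' [_ ->]]; apply: colon_ideal.
- by exists z.
exists z'; split=> //; split=> // w nIw sub; apply: (maxM (colon I w)) => //.
by exists w.
Qed.

Definition list_inter Ps : A -> Prop := fun a => forall P, List.In P Ps -> P a.

Lemma list_inter_prime Ps P : prime_ideal P -> (forall Q, List.In Q Ps -> is_ideal Q) ->
  (forall a, list_inter Ps a -> P a) ->
  exists Q, List.In Q Ps /\ forall a, Q a -> P a.
Proof.
move=> pP; elim: Ps => [|Q Ps IH] iPs sub.
  by case: (prime_not1 pP); apply: sub.
have [QP|nQP] := boolp.EM (forall a, Q a -> P a); first by exists Q; split; [left|].
have [a [Qa nPa]] : exists a, Q a /\ ~ P a.
  apply: boolp.contrapT => no; apply: nQP => a Qa; apply: boolp.contrapT => nPa.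
  by apply: no; exists a.
have [||Q' [Q'Ps Q'P]] := IH; last by exists Q'; split; [right|].
  by move=> Q' h; apply: iPs; right.
move=> b Psb; suff /(prime_mul pP) [/nPa|] : P (a * b) by [].
apply: sub => Q' [<-|h]; first by apply: ideal_mulr => //; apply: iPs; left.
by apply: ideal_mull; [apply: iPs; right|apply: Psb].
Qed.

(** The zero divisors modulo [I] are covered by finitely many associated
    primes: a finite family [zs] of elements with maximal annihilators
    generates all of them modulo [I], and the annihilator of a combination
    contains the intersection of the annihilators. *)
Lemma finitely_many_max_colon I : is_ideal I ->
  exists zs : seq A, (forall z, z \in zs -> max_colon I z) /\
    forall z, max_colon I z ->
      exists2 w, w \in zs & forall a, I (a * z) -> I (a * w).
Proof.
move=> iI.
pose Phi J := exists zs : seq A, (forall z, z \in zs -> max_colon I z) /\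
   J = ideal_span zs.
have [|||M [[zs [mzs ->]] _ maxM]] := @noetherian_maximal A Phi (ideal_span [::]).
- exact: noethA.
- by move=> _ [zs [_ ->]]; apply: ideal_spanP.
- by exists [::].
exists zs; split=> // z mz.
have zzs : ideal_span zs z.
  apply: (maxM (ideal_span (z :: zs))); last 1 first.
  - by apply: ideal_span_mem; rewrite inE eqxx.
  - exists (z :: zs); split=> // w; rewrite inE => /orP [/eqP -> //|]; exact: mzs.
  - move=> a; apply: ideal_span_min; first exact: ideal_spanP.
    by move=> x xs; apply: ideal_span_mem; rewrite inE xs orbT.
have [|||Q [Qin Qsub]] := @list_inter_prime (List.map (colon I) zs) (colon I z).
- exact: max_colon_prime.
- by move=> Q /List.in_map_iff [w [<- _]]; apply: colon_ideal.
- move=> a ha; have [c ->] := zzs; rewrite /colon mulr_sumr.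
  apply: ideal_sum => // i _; rewrite mulrCA; apply: ideal_mull => //.
  apply: (ha (colon I zs`_i)); apply: List.in_map.
  elim: (zs) (i : nat) (ltn_ord i) => //= x l IH [|j] jl; [by left|right].
  exact: IH.
move: Qin => /List.in_map_iff [w [eQ wzs]].
have {}wzs : w \in zs.
  elim: (zs) wzs => //= x l IH [->|/IH h]; first by rewrite inE eqxx.
  by rewrite inE h orbT.
exists w => //; case: (mzs _ wzs) => _ maxw.
by case: mz => nIz _; apply: maxw => // a; rewrite -eQ in Qsub; apply: Qsub.
Qed.

(** If [x] avoids all the primes but the first, [P], then [x + b c] avoids
    them all, for some [c] in [J] outside [P] and [b] in the others outside [P]. *)
Lemma prime_avoidance J Ps : is_ideal J ->
  (forall P, List.In P Ps -> prime_ideal P) ->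
  (forall P, List.In P Ps -> exists2 a, J a & ~ P a) ->
  exists2 a, J a & forall P, List.In P Ps -> ~ P a.
Proof.
move=> iJ; elim: {Ps}(size Ps) {-2}Ps (leqnn (size Ps)) => [|k IH] [|P Ps] // sk pPs JPs.
- by exists 0 => //; apply: ideal_zero.
- by exists 0 => //; apply: ideal_zero.
have [[Q [Qin QP]]|noQ] := boolp.EM (exists Q, List.In Q Ps /\ forall a, Q a -> P a).
  (* a prime contained in another one need not be avoided separately *)
  have [Ps1 [Ps2 ePs]] := List.in_split _ _ Qin.
  have inE' P' : List.In P' (P :: Ps1 ++ Ps2) -> List.In P' (P :: Ps).
    rewrite ePs => -[->|]; first by left.
    by move=> /List.in_app_iff [h|h]; right; apply/List.in_app_iff; [left|right; right].
  have [|P' h|P' h|a Ja nPa] := IH (P :: Ps1 ++ Ps2).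
  - by rewrite -ltnS; apply: leq_trans sk; rewrite ePs /= !size_cat /= addnS.
  - by apply: pPs; apply: inE'.
  - by apply: JPs; apply: inE'.
  exists a => // P' [<-|]; first by apply: nPa; left.
  rewrite ePs => /List.in_app_iff [h|[<-|h]].
  - by apply: nPa; right; apply/List.in_app_iff; left.
  - by move=> /QP; apply: nPa; left.
  - by apply: nPa; right; apply/List.in_app_iff; right.
have [|P' h|P' h|x Jx nPx] := IH Ps; first by rewrite -ltnS.
- by apply: pPs; right.
- by apply: JPs; right.
have pP : prime_ideal P by apply: pPs; left.
have [Px|nPx'] := boolp.EM (P x); last first.
  by exists x => // P' [<-|h] //; apply: nPx.
have [b [Psb nPb]] : exists b, list_inter Ps b /\ ~ P b.
  apply: boolp.contrapT => no; apply: noQ; apply: list_inter_prime => //.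
    by move=> Q h; apply: prime_is_ideal; apply: pPs; right.
  move=> a Psa; apply: boolp.contrapT => nPa; apply: no; by exists a.
have [|c Jc nPc] := JPs P; first by left.
exists (x + b * c); first by apply: ideal_add => //; apply: ideal_mull.
move=> P' [<-|h] Pxbc.
  have : P (b * c).
    by rewrite -(addKr x (b * c)); apply: ideal_add => //;
       [apply: prime_is_ideal|apply: ideal_opp => //; apply: prime_is_ideal].
  by move=> /(prime_mul pP) [].
have pP' : prime_ideal P' by apply: pPs; right.
apply: (nPx _ h); rewrite -(addrK (b * c) x); apply: ideal_sub => //.
  exact: prime_is_ideal.
by apply: ideal_mulr; [apply: prime_is_ideal|apply: Psb].
Qed.

Definition nzd I y := forall b, I (y * b) -> I b.

(** Prime avoidance, applied to the associated primes of all the ideals at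
    once: an ideal inside one of these primes would annihilate an element. *)
Lemma exists_common_nzd J (Is : seq (A -> Prop)) : is_ideal J ->
  (forall I, List.In I Is -> is_ideal I) ->
  (forall I z, List.In I Is -> (forall a, J a -> I (a * z)) -> I z) ->
  exists2 w, J w & forall I, List.In I Is -> nzd I w.
Proof.
move=> iJ iIs nosoc.
have [Ps [pPs JPs cov]] : exists Ps : seq (A -> Prop),
   [/\ forall P, List.In P Ps -> prime_ideal P,
       forall P, List.In P Ps -> exists2 a, J a & ~ P a
     & forall I a b, List.In I Is -> I (a * b) -> ~ I b ->
         exists2 P, List.In P Ps & P a].
  elim: Is iIs nosoc => [|I Is IH] iIs nosoc.
    by exists [::]; split.
  have [||Ps [pPs JPs cov]] := IH.
  - by move=> I' h; apply: iIs; right.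
  - by move=> I' z h; apply: nosoc; right.
  have iI : is_ideal I by apply: iIs; left.
  have [zs [mzs covz]] := finitely_many_max_colon iI.
  have inzs P : List.In P (List.map (colon I) zs) -> exists2 z, z \in zs & P = colon I z.
    move=> /List.in_map_iff [z [<- zzs]]; exists z => //.
    elim: (zs) zzs => //= x l IHl [->|/IHl h]; first by rewrite inE eqxx.
    by rewrite inE h orbT.
  exists (List.map (colon I) zs ++ Ps); split.
  - move=> P /List.in_app_iff [/inzs [z /mzs mz ->]|/pPs //].
    exact: max_colon_prime.
  - move=> P /List.in_app_iff [/inzs [z /mzs [nIz _] ->]|/JPs //].
    apply: boolp.contrapT => no; apply: nIz; apply: nosoc; first by left.
    move=> a Ja; apply: boolp.contrapT => nIaz; apply: no; by exists a.
  - move=> I' a b [<-|h] Iab nIb; last first.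
      have [P PPs Pa] := cov I' a b h Iab nIb.
      by exists P => //; apply/List.in_app_iff; right.
    have [z' [mz' sub]] := exists_max_colon iI nIb.
    have [w wzs subw] := covz _ mz'.
    exists (colon I w); last by apply: subw; apply: sub.
    apply/List.in_app_iff; left; apply: List.in_map.
    elim: (zs) wzs => //= x l IHl; rewrite inE => /orP [/eqP ->|/IHl]; by [left|right].
have [w Jw nPw] := prime_avoidance iJ pPs JPs.
exists w => // I Iin b Iwb; apply: boolp.contrapT => nIb.
by have [P PPs Pw] := cov I w b Iin Iwb nIb; case: (nPw P PPs).
Qed.

End AssociatedPrimes.

Section Depth.
Variable A : comNzRingType.
Hypothesis noethA : noetherian A.
Variable M : A -> Prop.
Hypothesis locM : local_ring M.
Implicit Types (I J P Q : A -> Prop) (s : seq A).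

Let ideal_max : is_ideal M. Proof. by case: locM => -[]. Qed.

Fixpoint regular_on I s : Prop :=
  if s is y :: s' then [/\ M y, nzd I y & regular_on (add_gen I y) s'] else True.

Lemma regular_on_cat I s t : regular_on I (s ++ t) ->
  regular_on (foldl (@add_gen A) I s) t.
Proof. by elim: s I => //= y s IH I [_ _ /IH]. Qed.

(** Each element of a regular sequence lengthens a chain of primes: if the
    prime [P] annihilates [z] modulo [I], then some [n] annihilated by [P] lies
    outside [I + (x)] (otherwise division by [x] could be repeated for ever),
    and an associated prime of [I + (x)] contains both [P] and [x]. *)
Lemma regular_chain I z s : is_ideal I -> ~ I z -> prime_ideal (colon I z) ->
  regular_on I s -> up (size s) (colon I z).
Proof.
elim: s I z => [|x s IH] I z iI nIz pP; first by [].
move=> [Mx nzx regs] /=; split=> //.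
pose N n := forall a, I (a * z) -> I (a * n).
have [n [Nn nIxn]] : exists n, N n /\ ~ add_gen I x n.
  apply: boolp.contrapT => no.
  have Nx n : N n -> add_gen I x n.
    by move=> Nn; apply: boolp.contrapT => nI; apply: no; exists n.
  pose Phi J := exists n, [/\ N n, ~ I n & J = add_gen I n].
  have [|||_ [[n [Nn nIn ->]] _ maxn]] := @noetherian_maximal A Phi (add_gen I z).
  - exact: noethA.
  - by move=> _ [n [_ _ ->]]; apply: add_gen_ideal.
  - by exists z; split.
  have [n' In'] := Nx _ Nn.
  have Nn' : N n'.
    move=> a Iaz; apply: nzx.
    have -> : x * (a * n') = a * n - a * (n - n' * x).
      by rewrite mulrBr opprB addrCA subrr addr0 mulrCA; congr (_ * _); apply: mulrC.
    by apply: ideal_sub => //; [apply: Nn|apply: ideal_mull].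
  have nIn' : ~ I n'.
    by move=> I'; apply: nIn; apply: (ideal_eqr iI In'); apply: ideal_mulr.
  have [c Ic] : add_gen I n n'.
    apply: (maxn (add_gen I n')); [by exists n'| |exact: add_gen_mem].
    apply: add_gen_min; first exact: add_gen_ideal.
      by move=> a; apply: add_gen_sub.
    by exists x; rewrite mulrC.
  have [u u1] : exists u, u * (1 - c * x) = 1.
    apply: (local_unit locM) => M1; case: locM => -[_ nM1 _] _; apply: nM1.
    by rewrite -(subrK (c * x) 1); apply: ideal_add => //; apply: ideal_mull.
  apply: nIn; rewrite -[n]mul1r -u1 -mulrA; apply: ideal_mull => //.
  have -> : (1 - c * x) * n = (n - n' * x) + x * (n' - c * n).
    by ring.
  by apply: ideal_add => //; apply: ideal_mull.
have iIx := add_gen_ideal x iI.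
have [n' [mn' subn]] := exists_max_colon noethA iIx nIxn.
exists (colon (add_gen I x) n'); split.
- by move=> a Iaz; apply: subn; apply: add_gen_sub; apply: Nn.
- exists x; last by move=> /nzx.
  by rewrite /colon mulrC; apply: ideal_mull => //; apply: add_gen_mem.
- by case: (mn') => nI _; apply: IH => //; apply: max_colon_prime.
Qed.

Lemma nzd_swap I x y : is_ideal I -> nzd I x -> nzd I y -> nzd (add_gen I x) y ->
  nzd (add_gen I y) x.
Proof.
move=> iI nx ny nyx b [c Ic].
have [d Id] : add_gen I x c.
  apply: nyx; exists b; have := ideal_subC iI Ic.
  by rewrite [y * c]mulrC [b * x]mulrC.
exists d; apply: nx.
have -> : x * (b - d * y) = (x * b - c * y) + y * (c - d * x).
  by ring.
by apply: ideal_add => //; apply: ideal_mull.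
Qed.

(** A socle element [z] modulo [I + (y)] gives one modulo [I + (x)]: divide
    [x z], which is a multiple of [y] modulo [I], by [y]. *)
Lemma socle_transfer I x y : is_ideal I -> nzd I x -> nzd I y -> M y ->
  (forall z, (forall a, M a -> add_gen I x (a * z)) -> add_gen I x z) ->
  forall z, M x -> (forall a, M a -> add_gen I y (a * z)) -> add_gen I y z.
Proof.
move=> iI nx ny My nosoc z Mx soc.
have [z' Iz'] := soc x Mx.
have [w Iw] : add_gen I x z'.
  apply: nosoc => a Ma; have [t It] := soc a Ma.
  exists t; apply: ny.
  have -> : y * (a * z' - t * x) = x * (a * z - t * y) - a * (x * z - z' * y).
    by ring.
  by apply: ideal_sub => //; apply: ideal_mull.
exists w; apply: nx.
have -> : x * (z - w * y) = (x * z - z' * y) + y * (z' - w * x).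
  by ring.
by apply: ideal_add => //; apply: ideal_mull.
Qed.

(** Maximal regular sequences have the same length, one entry at a time: an
    element [w] that is regular modulo [I], [I + (x)] and [I + (y)] connects the
    given sequence, which starts with [x], to one that starts with [y]. *)
Lemma regular_exchange I x s y : is_ideal I -> regular_on I (x :: s) ->
  M y -> nzd I y -> exists2 t, size t = size s & regular_on (add_gen I y) t.
Proof.
elim: {s}(size s) {-2}s (erefl (size s)) I x y => [|k IH] [|x2 s] // es I x y iI reg My ny.
  by exists [::].
have [Mx nx [Mx2 nx2 regs]] := reg.
have nosocx z : (forall a, M a -> add_gen I x (a * z)) -> add_gen I x z.
  by move=> soc; apply: nx2; apply: soc.
have [w Mw nw] : exists2 w, M w & forall J,
    List.In J [:: I; add_gen I x; add_gen I y] -> nzd J w.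
  apply: exists_common_nzd => //.
    by move=> J [<-|[<-|[<-|//]]] //; apply: add_gen_ideal.
  move=> J z [<-|[<-|[<-|//]]] soc; [|exact: nosocx|].
    by apply: nx; apply: soc.
  exact: (socle_transfer iI nx ny My nosocx Mx soc).
have nwI : nzd I w by apply: nw; left.
have nwx : nzd (add_gen I x) w by apply: nw; right; left.
have nwy : nzd (add_gen I y) w by apply: nw; right; right; left.
case: es => es.
have [||||t et regt] := IH s es (add_gen I x) x2 w => //.
  exact: add_gen_ideal.
have [|||||t' et' regt'] := IH t _ (add_gen I w) x y.
- by rewrite et.
- exact: add_gen_ideal.
- split=> //; first exact: nzd_swap.
  by rewrite add_genC.
- by [].
- exact: nzd_swap.
exists (w :: t'); first by rewrite /= et' et.
by split=> //; rewrite add_genC.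
Qed.

(** If an entry of [ys] were a zero divisor, then an associated prime that
    contains it would start a chain that [regular_chain] makes too long;
    otherwise [regular_exchange] replaces [s] by a sequence that is one shorter
    and starts where the entry has been divided out. *)
Lemma regular_of_dimension I s ys : is_ideal I -> (forall a, I a -> M a) ->
  regular_on I s -> (forall y, y \in ys -> M y) ->
  (forall i, (i < size ys)%N -> forall P, prime_ideal P -> (forall a, I a -> P a) ->
     (forall y, y \in take i.+1 ys -> P y) ->
     forall e, up e P -> (e + i.+1 <= size s)%N) ->
  regular_on I ys.
Proof.
elim: ys I s => // y ys IH I s iI IM regs Mys dim.
have My : M y by apply: Mys; rewrite inE eqxx.
have ny : nzd I y.
  move=> b Iyb; apply: boolp.contrapT => nIb.
  have [z [mz sub]] := exists_max_colon noethA iI nIb.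
  have pz := max_colon_prime iI mz.
  have := dim 0%N isT (colon I z) pz _ _ (size s) _.
  rewrite /= take0 addn1 ltnn => h; apply: notF; apply: h.
  - by move=> a Ia; apply: ideal_mulr.
  - by move=> x; rewrite inE => /eqP ->; apply: sub.
  - by case: (mz) => nIz _; apply: regular_chain.
case: s regs dim => [|x s] regs dim.
  have := dim 0%N isT M _ IM _ 0%N _; rewrite /= take0 => h.
  suff : (0 + 1 <= 0)%N by [].
  apply: h; try (apply: maximal_prime; by case: locM).
  by move=> z; rewrite inE => /eqP ->.
have [t et regt] := regular_exchange iI regs My ny.
split=> //; apply: (IH _ t) => //.
- exact: add_gen_ideal.
- exact: add_gen_min.
- by move=> z zys; apply: Mys; rewrite inE zys orbT.
move=> i ii P pP IP ysP e upe.
have := dim i.+1 ii P pP _ _ e upe; rewrite /= et addnS ltnS; apply.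
  by move=> a Ia; apply: IP; apply: add_gen_sub.
move=> z; rewrite inE => /orP [/eqP ->|]; last exact: ysP.
by apply: IP; apply: add_gen_mem.
Qed.

End Depth.

(** * Integral extensions and families of endomorphisms *)

Section Extensions.
Variables (A Z : comNzRingType) (iota : {rmorphism A -> Z}).

Definition comap (P : Z -> Prop) : A -> Prop := fun a => P (iota a).

Lemma comap_ideal I : is_ideal I -> is_ideal (comap I).
Proof.
move=> iI; split; rewrite /comap.
- by rewrite rmorph0; apply: ideal_zero.
- by move=> a b; rewrite rmorphD; apply: ideal_add.
- by move=> c a; rewrite rmorphM; apply: ideal_mull.
Qed.

Lemma comap_prime P : prime_ideal P -> prime_ideal (comap P).
Proof.
move=> pP; split; first by apply: comap_ideal; apply: prime_is_ideal.
  by rewrite /comap rmorph1; apply: prime_not1.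
by move=> a b; rewrite /comap rmorphM; apply: prime_mul.
Qed.

(** The constant term of a shortest integral equation modulo [P] of an
    element of [Q] outside [P] lies in [Q] but not in [P]. *)
Lemma incomparability (P Q : Z -> Prop) y (p : {poly A}) :
  prime_ideal P -> prime_ideal Q -> (forall a, P a -> Q a) ->
  Q y -> ~ P y -> p \is monic -> P (map_poly iota p).[y] ->
  exists2 a, comap Q a & ~ comap P a.
Proof.
move=> pP pQ PQ Qy nPy; elim/poly_ind: p => [|p c IH].
  by rewrite monicE lead_coef0 eq_sym oner_eq0.
move=> monp; rewrite rmorphD rmorphM /= map_polyX map_polyC hornerMXaddC.
set z := _.[y] => Pzc.
have Qc : comap Q c.
  rewrite /comap -(addKr (z * y) (iota c)); apply: ideal_add.
  - exact: prime_is_ideal.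
  - apply: ideal_opp; first exact: prime_is_ideal.
    by apply: ideal_mull => //; apply: prime_is_ideal.
  - exact: PQ.
have [Pc|nPc] := boolp.EM (comap P c); last by exists c.
have : P (z * y).
  by rewrite -(addrK (iota c) (z * y)); apply: ideal_sub => //; apply: prime_is_ideal.
case/(prime_mul pP) => // Pz; apply: IH Pz.
have [p0|pn0] := eqVneq p 0.
  move: monp; rewrite p0 mul0r add0r monicE lead_coefC => /eqP c1.
  by case: (prime_not1 (comap_prime pP)); rewrite -c1.
move: monp; rewrite !monicE lead_coefDl ?lead_coefMX //.
by rewrite size_polyC size_mulX //; case: (c != 0); rewrite // ltnS lt0n size_poly_eq0.
Qed.

Lemma up_comap e P :
  (forall P Q, prime_ideal P -> prime_ideal Q -> (forall a, P a -> Q a) ->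
     (exists2 y, Q y & ~ P y) -> exists2 a, comap Q a & ~ comap P a) ->
  up e P -> up e (comap P).
Proof.
move=> strict; elim: e P => [|e IH] P /=; first exact: comap_prime.
move=> [pP [Q [PQ sPQ upQ]]]; split; first exact: comap_prime.
exists (comap Q); split; [by move=> a; apply: PQ| |exact: IH].
by apply: strict => //; apply: up_prime upQ.
Qed.

Hypothesis intZ : integralRange iota.

Lemma up_comap_integral e P : up e P -> up e (comap P).
Proof.
apply: up_comap => {}P Q pP pQ PQ [y Qy nPy].
have [p monp /rootP py] := intZ y.
apply: (incomparability pP pQ PQ Qy nPy monp); rewrite py.
by apply: ideal_zero; apply: prime_is_ideal.
Qed.

(** An integral equation of [z], multiplied by a power of [a]. *)
Lemma integral_relation (Q : Z -> Prop) s a z : is_ideal Q ->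
  Q (iota s - z * iota a) -> exists N w, comap Q (s ^+ N + a * w).
Proof.
move=> iQ Qs; have [p monp /rootP pz] := intZ z.
pose N := (size p).-1.
have sp : size p = N.+1 by rewrite prednK // size_poly_gt0 monic_neq0.
pose h := \sum_(i < N.+1) p`_i * s ^+ i * a ^+ (N - i).
have Qh : Q (iota h).
  have : Q (\sum_(i < N.+1) iota p`_i * (iota s ^+ i - (z * iota a) ^+ i)
             * iota a ^+ (N - i)).
    apply: ideal_sum => // i _; apply: ideal_mulr => //; apply: ideal_mull => //.
    by rewrite subrXX; apply: ideal_mulr.
  congr (Q _).
  transitivity (iota h - iota a ^+ N * (map_poly iota p).[z]); last first.
    by rewrite pz mulr0 subr0.
  rewrite (@horner_coef_wide _ N.+1) ?size_map_poly_id0 ?sp //; last first.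
    by rewrite (monicP monp) rmorph1 oner_neq0.
  rewrite rmorph_sum mulr_sumr -sumrB; apply: eq_bigr => i _.
  rewrite coef_map /= !rmorphM !rmorphXn exprMn.
  have -> : iota a ^+ N = iota a ^+ i * iota a ^+ (N - i).
    by rewrite -exprD subnKC // -ltnS.
  by ring.
exists N, (\sum_(i < N) p`_i * s ^+ i * a ^+ (N - i).-1).
suff <- : h = s ^+ N + a * \sum_(i < N) p`_i * s ^+ i * a ^+ (N - i).-1 by [].
rewrite /h big_ord_recr /= subnn mulr1.
have -> : p`_N = 1 by have := monicP monp; rewrite lead_coefE.
rewrite mul1r addrC mulr_sumr; congr (_ + _); apply: eq_bigr => i _.
by rewrite mulrCA -exprS prednK // subn_gt0.
Qed.

(** An integral equation of the inverse of [a] modulo [N] exhibits an inverse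
    of [a] already modulo the contraction. *)
Lemma comap_maximal N : maximal_ideal N -> maximal_ideal (comap N).
Proof.
move=> mN; have [iN nN1 _] := mN; apply: maximal_of_inv.
- exact: comap_ideal.
- by rewrite /comap rmorph1.
move=> a nNa; have [e Ne] := maximal_inv mN nNa.
have [|k [w]] := @integral_relation N 1 a e iN.
  by rewrite rmorph1; apply: ideal_subC.
rewrite expr1n => h; exists (- w).
have -> : - w * a - 1 = - (1 + a * w) by ring.
by apply: ideal_opp => //; apply: comap_ideal.
Qed.

(** An ideal [Q] that is maximal among those meeting [A] inside [q] lies over
    [q]: if [a] in [q] were outside [Q], then some [s] outside [q] would be a
    multiple [z * a] modulo [Q], and an integral equation of [z], multiplied by
    a power of [a], would put a power of [s] into [q]. *)
Lemma lying_over (q : A -> Prop) : prime_ideal q ->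
  (forall a, iota a = 0 -> q a) ->
  exists Q : Z -> Prop, prime_ideal Q /\ comap Q = q.
Proof.
move=> pq kerq; have iq := prime_is_ideal pq.
pose Phi (J : Z -> Prop) := is_ideal J /\ forall a, J (iota a) -> q a.
have [||Q [[iQ Qq] _ maxQ]] := @exists_maximal_above Z Phi (fun x => x = 0).
- by split; [exact: zero_ideal|].
- move=> F Fne FPhi tot; split.
    by apply: chain_union_ideal tot => // X /FPhi [].
  by move=> a [X /FPhi [_ Xq] /Xq].
have meet y : ~ Q y -> exists2 s, ~ q s & add_gen Q y (iota s).
  move=> nQy; apply: boolp.contrapT => no; apply: nQy.
  apply: (maxQ (add_gen Q y)); last exact: add_gen_mem.
    split; first exact: add_gen_ideal.
    by move=> a h; apply: boolp.contrapT => nqa; apply: no; exists a.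
  by move=> a; apply: add_gen_sub.
have pQ : prime_ideal Q.
  split=> // [|x y Qxy].
    by move=> Q1; apply: (prime_not1 pq); apply: Qq; rewrite rmorph1.
  apply: boolp.contrapT => no.
  have [s nqs [c Qs]] : exists2 s, ~ q s & add_gen Q x (iota s).
    by apply: meet => Qx; apply: no; left.
  have [t nqt [d Qt]] : exists2 s, ~ q s & add_gen Q y (iota s).
    by apply: meet => Qy; apply: no; right.
  suff /Qq /(prime_mul pq) [] : Q (iota (s * t)) by [].
  rewrite rmorphM.
  have -> : iota s * iota t = (iota s - c * x) * iota t
      + (c * x) * (iota t - d * y) + (c * d) * (x * y) by ring.
  apply: ideal_add => //; last exact: ideal_mull.
  by apply: ideal_add => //; [apply: ideal_mulr|apply: ideal_mull].
exists Q; split=> //; apply/boolp.predeqP => a; split; first exact: Qq.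
move=> qa; apply: boolp.contrapT => /meet [s nqs [z Qs]].
have [N [w Qh]] := integral_relation iQ Qs.
apply: nqs; apply: (@prime_exp _ _ _ N) => //.
rewrite -(addrK (a * w) (s ^+ N)); apply: ideal_sub => //; first exact: Qq.
exact: ideal_mulr.
Qed.

Definition lin_span (s : seq Z) : Z -> Prop :=
  fun x => exists c : nat -> A, x = \sum_(i < size s) iota (c i) * s`_i.

Lemma lin_span0 s : lin_span s 0.
Proof. by exists (fun=> 0); rewrite big1 // => i _; rewrite rmorph0 mul0r. Qed.
Lemma lin_spanD s x y : lin_span s x -> lin_span s y -> lin_span s (x + y).
Proof.
move=> [c ->] [d ->]; exists (fun i => c i + d i).
by rewrite -big_split /=; apply: eq_bigr => i _; rewrite rmorphD mulrDl.
Qed.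
Lemma lin_spanZ s a x : lin_span s x -> lin_span s (iota a * x).
Proof.
move=> [c ->]; exists (fun i => a * c i).
by rewrite mulr_sumr; apply: eq_bigr => i _; rewrite rmorphM mulrA.
Qed.
Lemma lin_spanB s x y : lin_span s x -> lin_span s y -> lin_span s (x - y).
Proof.
move=> sx sy; apply: lin_spanD => //.
by rewrite -mulN1r -(rmorph1 iota) -rmorphN; apply: lin_spanZ.
Qed.
Lemma lin_span_cons x s y :
  lin_span (x :: s) y <-> exists c, lin_span s (y - iota c * x).
Proof.
split=> [[c ->]|[c [d ed]]].
  exists (c 0%N), (fun i => c i.+1); rewrite /= big_ord_recl /= addrC addKr.
  exact: eq_bigr.
exists (fun i => if i is j.+1 then d j else c).
by rewrite /= big_ord_recl /= -(subrK (iota c * x) y) ed addrC.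
Qed.
Lemma lin_span_sub s t : (forall x, x \in s -> lin_span t x) ->
  forall x, lin_span s x -> lin_span t x.
Proof.
move=> st x [c ->]; apply: big_ind => [||i _]; [exact: lin_span0|exact: lin_spanD|].
by apply: lin_spanZ; apply: st; apply: mem_nth.
Qed.
Lemma lin_span_mem s x : x \in s -> lin_span s x.
Proof.
elim: s => // y s IH; rewrite inE => /orP [/eqP ->|/IH sx]; apply/lin_span_cons.
  by exists 1; rewrite rmorph1 mul1r subrr; apply: lin_span0.
by exists 0; rewrite rmorph0 mul0r subr0.
Qed.

(** The coefficients at the first generator [e] of the elements of [N] form an
    ideal; modulo lifts of its generators, [N] lies in the span of the other
    generators. *)
Lemma finite_submodule (es : seq Z) (N : Z -> Prop) : noetherian A ->
  N 0 -> (forall x y, N x -> N y -> N (x + y)) ->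
  (forall a x, N x -> N (iota a * x)) -> (forall x, N x -> lin_span es x) ->
  exists s, (forall x, x \in s -> N x) /\ (forall x, N x -> lin_span s x).
Proof.
move=> noeth; elim: es N => [|e es IH] N N0 ND NZ Nes.
  by exists [::].
pose I a := exists2 x, N x & lin_span es (x - iota a * e).
have iI : is_ideal I.
  split.
  - by exists 0 => //; rewrite rmorph0 mul0r subr0; apply: lin_span0.
  - move=> a b [x Nx sx] [y Ny sy]; exists (x + y); first exact: ND.
    by rewrite rmorphD mulrDl opprD addrACA; apply: lin_spanD.
  - move=> c a [x Nx sx]; exists (iota c * x); first exact: NZ.
    by rewrite rmorphM -mulrA -mulrBr; apply: lin_spanZ.
have [gs Igs] := noeth _ iI.
have [xs [Nxs lift]] : exists xs, (forall x, x \in xs -> N x) /\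
    forall a, ideal_span gs a -> exists2 y, lin_span xs y & lin_span es (y - iota a * e).
  have {Igs} : forall a, a \in gs -> I a by move=> a /ideal_span_mem /Igs.
  elim: gs => [|g gs IHg] Ig.
    exists [::]; split=> // a /ideal_span_nil ->; exists 0; first exact: lin_span0.
    by rewrite rmorph0 mul0r subr0; apply: lin_span0.
  have [|xs [Nxs lift]] := IHg; first by move=> a ag; apply: Ig; rewrite inE ag orbT.
  have [|x Nx sx] := Ig g; first by rewrite inE eqxx.
  exists (x :: xs); split; first by move=> y; rewrite inE => /orP [/eqP ->|/Nxs].
  move=> a /ideal_span_cons [c /lift [y xsy esy]].
  exists (y + iota c * x).
    by apply/lin_span_cons; exists c; rewrite addrK.
  have -> : y + iota c * x - iota a * e =
     (y - iota (a - c * g) * e) + iota c * (x - iota g * e).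
    by rewrite rmorphB rmorphM; ring.
  by apply: lin_spanD => //; apply: lin_spanZ.
have NB x y : N x -> N y -> N (x - y).
  by move=> Nx Ny; rewrite -mulN1r -(rmorph1 iota) -rmorphN; apply: ND => //; apply: NZ.
have Nspan x : lin_span xs x -> N x.
  by move=> [c ->]; apply: big_ind => // i _; apply: NZ; apply: Nxs; apply: mem_nth.
have [||||s [Ns span]] := IH (fun x => N x /\ lin_span es x).
- by split=> //; apply: lin_span0.
- by move=> x y [Nx sx] [Ny sy]; split; [apply: ND|apply: lin_spanD].
- by move=> a x [Nx sx]; split; [apply: NZ|apply: lin_spanZ].
- by move=> x [].
exists (xs ++ s); split.
  by move=> x; rewrite mem_cat => /orP [/Nxs|/Ns []].
move=> x Nx; have [a sa] : exists a, lin_span es (x - iota a * e).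
  by apply/lin_span_cons; apply: Nes.
have [y xsy esy] := lift a (proj1 (Igs a) (ex_intro2 _ _ x Nx sa)).
rewrite -(subrK y x); apply: lin_spanD.
  apply: (@lin_span_sub s).
    by move=> z zs; apply: lin_span_mem; rewrite mem_cat zs orbT.
  apply: span; split; first by apply: NB => //; apply: Nspan.
  have -> : x - y = (x - iota a * e) - (y - iota a * e) by ring.
  exact: lin_spanB.
by apply: (@lin_span_sub xs) => // z zs; apply: lin_span_mem; rewrite mem_cat zs.
Qed.

Lemma finite_noetherian (es : seq Z) : noetherian A ->
  (forall x, lin_span es x) -> noetherian Z.
Proof.
move=> noeth fin I iI.
have [||||s [Is span]] := @finite_submodule es I noeth => //.
- exact: ideal_zero.
- by move=> x y; apply: ideal_add.
- by move=> a x; apply: ideal_mull.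
exists s => x; split=> [/span [c ->]|]; first by exists (fun i => iota (c i)).
exact: ideal_span_min.
Qed.

End Extensions.

Section PolyPrimes.
Variable A : comNzRingType.
Implicit Type P : A -> Prop.

Definition poly_ideal P : {poly A} -> Prop := fun p => forall i, P p`_i.

Lemma poly_ideal_ideal P : is_ideal P -> is_ideal (poly_ideal P).
Proof.
move=> iP; split.
- by move=> i; rewrite coef0; apply: ideal_zero.
- by move=> p q Pp Pq i; rewrite coefD; apply: ideal_add.
- by move=> c p Pp i; rewrite coefM; apply: ideal_sum => // j _; apply: ideal_mull.
Qed.

(** Gauss's lemma: compare the first coefficients outside [P]. *)
Lemma poly_ideal_prime P : prime_ideal P -> prime_ideal (poly_ideal P).
Proof.
move=> pP; have iP := prime_is_ideal pP; split; first exact: poly_ideal_ideal.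
  by move/(_ 0%N); rewrite coefC eqxx; apply: prime_not1.
have first_out p : ~ poly_ideal P p ->
    exists i, ~ P p`_i /\ forall j, (j < i)%N -> P p`_j.
  move=> nP; have [i nPi] : exists i, ~ P p`_i.
    by apply: boolp.contrapT => no; apply: nP => i; apply: boolp.contrapT => nPi; apply: no; exists i.
  have exi : exists i, ~~ boolp.asbool (P p`_i) by exists i; apply/negP => /boolp.asboolP.
  exists (ex_minn exi); case: ex_minnP => m /negP nPm minm; split.
    by move=> Pm; apply: nPm; apply/boolp.asboolP.
  move=> j jm; apply: boolp.contrapT => nPj.
  suff : (m <= j)%N by rewrite leqNgt jm.
  by apply: minm; apply/negP => /boolp.asboolP.
move=> p q Ppq; apply: boolp.contrapT => no.
have [i [nPi ltiP]] : exists i, ~ P p`_i /\ forall j, (j < i)%N -> P p`_j.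
  by apply: first_out => h; apply: no; left.
have [j [nPj ltjP]] : exists i, ~ P q`_i /\ forall j, (j < i)%N -> P q`_j.
  by apply: first_out => h; apply: no; right.
have ii : (i < (i + j).+1)%N by rewrite ltnS leq_addr.
have := Ppq (i + j)%N; rewrite coefM (bigD1 (Ordinal ii)) //= addKn => Psum.
suff /(prime_mul pP) [] : P (p`_i * q`_j) by [].
rewrite -(addrK (\sum_(k < (i + j).+1 | k != Ordinal ii) p`_k * q`_(i + j - k)) (p`_i * q`_j)).
apply: ideal_sub => //; apply: ideal_sum => // k.
rewrite -val_eqE /= neq_ltn => /orP [ki|ik].
  by apply: ideal_mulr => //; apply: ltiP.
apply: ideal_mull => //; apply: ltjP.
by rewrite ltn_subLR ?ltn_add2r // -ltnS.
Qed.

(** The largest ideal inside [P] that a one-parameter family [theta] of ring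
    endomorphisms preserves. *)
Definition shrink (theta : A -> {poly A}) P : A -> Prop :=
  fun a => poly_ideal P (theta a).

Lemma shrink_prime (theta : {rmorphism A -> {poly A}}) P :
  prime_ideal P -> prime_ideal (shrink theta P).
Proof. by move=> pP; apply: (comap_prime theta); apply: poly_ideal_prime. Qed.

End PolyPrimes.

(** * Adjoining a root of a monic polynomial *)

Section RegularSeq.
Variables (A : comNzRingType) (M : A -> Prop).

Lemma regular_on_of_seq s : (forall a, a \in s -> M a) -> regular_seq s ->
  regular_on M (fun x => x = 0) s.
Proof.
move=> Ms [_ reg].
have -> : (fun x : A => x = 0) = ideal_span [::].
  by apply/boolp.predeqP => x; split => /ideal_span_nil.
have {}reg i : (i < size s)%N -> forall b,
   ideal_span ([::] ++ take i s) (s`_i * b) -> ideal_span ([::] ++ take i s) b.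
  by move=> /reg.
elim: s [::] Ms reg => //= y s IH t Ms reg; split.
- by apply: Ms; rewrite inE eqxx.
- by move=> b; have := reg 0%N isT b; rewrite take0 cats0.
- rewrite -ideal_span_rcons; apply: IH => [a sa|i si b].
    by apply: Ms; rewrite inE sa orbT.
  by have := reg i.+1 si b; rewrite /= -cat_rcons.
Qed.

End RegularSeq.

Section MonicQuotient.
Variables (L : comNzRingType) (h : {poly L}).
Hypotheses (monh : h \is monic) (sh : (1 < size h)%N).
Local Notation E := {poly %/ h}.

Lemma mk_monicE : mk_monic h = h :> {poly L}.
Proof. by rewrite /mk_monic sh monh. Qed.

Lemma in_qpoly_val (e : E) : in_qpoly h (e : {poly L}) = e.
Proof. by apply: val_inj; apply: in_qpoly_small; rewrite size_mk_monic. Qed.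

Lemma in_qpoly_ker p : in_qpoly h p = 0 -> exists q, p = q * h.
Proof.
move=> p0; exists (Pdiv.Ring.rdivp p h).
have /(_ p) := Pdiv.RingMonic.rdivp_eq monh.
have -> : Pdiv.Ring.rmodp p h = 0.
  by have := congr1 val p0; rewrite /= mk_monicE.
by rewrite addr0.
Qed.

Lemma in_qpoly_h : in_qpoly h h = 0.
Proof.
apply: val_inj => /=; rewrite mk_monicE.
by rewrite Pdiv.RingMonic.rmodpp.
Qed.

Lemma in_qpolyC c : in_qpoly h c%:P = qpolyC h c.
Proof.
apply: val_inj; apply: in_qpoly_small.
by rewrite mk_monicE (leq_ltn_trans (size_polyC_leq1 c)).
Qed.

Lemma in_qpolyE p : in_qpoly h p = \sum_(i < size p) qpolyC h p`_i * qpolyX h ^+ i.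
Proof.
rewrite -{1}[p]coefK poly_def rmorph_sum /=; apply: eq_bigr => i _.
by rewrite -mul_polyC rmorphM rmorphXn /= in_qpolyC.
Qed.

Lemma qpoly_sum (e : E) :
  e = \sum_(i < (size h).-1) qpolyC h (e : {poly L})`_i * qpolyX h ^+ i.
Proof.
rewrite -{1}[e]in_qpoly_val in_qpolyE.
have se : (size (e : {poly L}) <= (size h).-1)%N.
  by rewrite -ltnS prednK ?(ltnW sh) // -{2}mk_monicE size_mk_monic.
rewrite (big_ord_widen _ (fun i => qpolyC h (e : {poly L})`_i * qpolyX h ^+ i) se).
rewrite big_mkcond /=; apply: eq_bigr => i _; case: ltnP => // /(nth_default 0) ->.
by rewrite qpolyC0 mul0r.
Qed.

Lemma qpolyC_mulE c (e : E) i : ((qpolyC h c * e : E) : {poly L})`_i = c * (e : {poly L})`_i.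
Proof.
have -> : qpolyC h c * e = c *: e.
  by rewrite -{1}[e]in_qpoly_val -in_qpolyC -rmorphM /= mul_polyC in_qpolyZ in_qpoly_val.
by rewrite poly_of_qpolyZ coefZ.
Qed.

Lemma qpoly_integral : integralRange (qpolyC h).
Proof.
move=> e; rewrite (qpoly_sum e).
have iX : integralOver (qpolyC h) (qpolyX h).
  exists h => //; apply/rootP.
  rewrite -in_qpoly_h in_qpolyE.
  rewrite (@horner_coef_wide _ (size h)) ?size_poly //; apply: eq_bigr => i _.
  by rewrite coef_map.
apply: big_ind => [||i _]; [exact: integral0|exact: integral_add|].
apply: integral_mul; first exact: integral_id.
elim: (i : nat) => [|k IH]; first by rewrite expr0; apply: integral1.
by rewrite exprS; apply: integral_mul.
Qed.

Lemma qpoly_noetherian : noetherian L -> noetherian E.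
Proof.
move=> noeth; apply: (@finite_noetherian _ _ (qpolyC h)
  [seq qpolyX h ^+ i | i <- iota 0 (size h).-1]) => // e.
exists (fun i => (e : {poly L})`_i).
rewrite {1}(qpoly_sum e) size_map size_iota; apply: eq_bigr => i _.
by rewrite (nth_map 0%N) ?size_iota // nth_iota.
Qed.

(** This ideal is [I E], since [E] is free over [L] on the powers of [X]. *)
Definition extend (I : L -> Prop) : E -> Prop := fun e => poly_ideal I (e : {poly L}).

Lemma extend_in_qpoly I p : is_ideal I -> poly_ideal I p -> extend I (in_qpoly h p).
Proof.
move=> iI Ip j; rewrite in_qpolyE.
rewrite poly_of_qpoly_sum coef_sum; apply: ideal_sum => // i _.
by rewrite qpolyC_mulE; apply: ideal_mulr.
Qed.

Lemma extend_ideal I : is_ideal I -> is_ideal (extend I).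
Proof.
move=> iI; split.
- by move=> i; rewrite coef0; apply: ideal_zero.
- by move=> a b Ia Ib i; rewrite poly_of_qpolyD coefD; apply: ideal_add.
- move=> c a Ia; rewrite -[c]in_qpoly_val -[a]in_qpoly_val -rmorphM.
  apply: extend_in_qpoly => //.
  exact: (ideal_mull _ (poly_ideal_ideal iI) Ia).
Qed.

Lemma extend_add_gen I y : is_ideal I ->
  extend (add_gen I y) = add_gen (extend I) (qpolyC h y).
Proof.
move=> iI; apply/boolp.predeqP => e; split.
  move=> Ie; have [c Ic] := boolp.choice Ie.
  exists (in_qpoly h (\poly_(i < size (e : {poly L})) c i)).
  rewrite -[e]in_qpoly_val -in_qpolyC -rmorphM -rmorphB; apply: extend_in_qpoly => // i.
  rewrite coefB coefMC coef_poly in_qpoly_val; case: ifP => [_|/negbT]; first exact: Ic.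
  by rewrite -leqNgt => /(nth_default 0) ->; rewrite mul0r subr0; apply: ideal_zero.
move=> [c Ic] i; exists (c : {poly L})`_i.
have := Ic i; rewrite mulrC -mulrN.
by rewrite poly_of_qpolyD coefD qpolyC_mulE coefN mulrN mulrC.
Qed.

Lemma extend_zero : extend (fun x => x = 0) = (fun e => e = 0).
Proof.
apply/boolp.predeqP => e; split=> [e0|-> i]; last by rewrite coef0.
by apply: val_inj; apply/polyP => i; rewrite coef0; apply: e0.
Qed.

Lemma extend_regular (M I : L -> Prop) s : is_ideal M -> is_ideal I -> regular_on M I s ->
  regular_on (extend M) (extend I) [seq qpolyC h y | y <- s].
Proof.
move=> iM; elim: s I => //= y s IH I iI [My ny reg]; split.
- by rewrite -in_qpolyC; apply: extend_in_qpoly => // i; rewrite coefC; case: eqP => _ //;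
    apply: ideal_zero.
- by move=> e Ie i; apply: ny; rewrite -qpolyC_mulE; apply: Ie.
- by rewrite -extend_add_gen //; apply: IH => //; apply: add_gen_ideal.
Qed.

(** The hypothesis [inv] says that [h] remains irreducible over the residue
    field, so that [M] generates a maximal ideal; there is no other, because the
    maximal ideals of an integral extension lie over [M]. *)
Lemma extend_local (M : L -> Prop) : local_ring M ->
  (forall p, extend M (in_qpoly h p) \/
     exists q, extend M (in_qpoly h (p * q - 1))) ->
  local_ring (extend M).
Proof.
move=> [mM uM] inv; have [iM nM1 _] := mM.
apply: local_of_inv.
  apply: maximal_of_inv; first exact: extend_ideal.
    by move/(_ 0%N); rewrite -[1]/(qpolyC h 1) qpolyCE coefC.
  move=> a nMa; have [h1|[q Mq]] := inv (a : {poly L}).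
    by case: nMa; rewrite -[a]in_qpoly_val.
  by exists (in_qpoly h q); move: Mq; rewrite rmorphB rmorphM rmorph1 /= in_qpoly_val mulrC.
move=> N mN e Me; have [iN _ _] := mN.
rewrite (qpoly_sum e); apply: ideal_sum => // i _; apply: ideal_mulr => //.
by apply/(uM _ (comap_maximal qpoly_integral mN)); apply: Me.
Qed.

End MonicQuotient.

(** * Localization *)

Section Localization.
Variables (B L : comNzRingType) (M : B -> Prop) (phi : {rmorphism B -> L}).
Hypotheses (primeM : prime_ideal M) (locL : is_localization M phi).

Lemma loc_comap_sub p a : prime_ideal p -> comap phi p a -> M a.
Proof.
move=> pp pa; apply: boolp.contrapT => nMa; case: locL => inv _ _.
have [y ay] := inv a nMa; apply: (prime_not1 pp); rewrite -ay.
by apply: ideal_mulr => //; apply: prime_is_ideal.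
Qed.

Lemma loc_maximal ML b : local_ring ML -> ML (phi b) <-> M b.
Proof.
move=> lML; have [mML _] := lML; split.
  exact: loc_comap_sub (maximal_prime mML).
move=> Mb; apply: boolp.contrapT => /(local_unit lML) [c cb].
case: locL => _ frac ker; have [a [s [nMs cs]]] := frac c.
have e : phi (a * b) = phi s by rewrite rmorphM -cs mulrAC cb mul1r.
have [t nMt ets] := ker _ _ e.
have : M (t * s).
  by rewrite -ets mulrA; apply: ideal_mull => //; apply: prime_is_ideal.
by case/(prime_mul primeM).
Qed.

(** The prime of [L] that corresponds to [q] consists of the fractions with
    numerator in [q]. *)
Lemma loc_lift_prime (p : L -> Prop) (q : B -> Prop) :
  prime_ideal p -> prime_ideal q -> (forall a, q a -> comap phi p a) ->
  (exists2 a, comap phi p a & ~ q a) ->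
  exists p', [/\ prime_ideal p', comap phi p' = q, forall y, p' y -> p y
    & exists2 y, p y & ~ p' y].
Proof.
move=> pp pq qp [a0 pa0 nqa0].
have [iq ip] := (prime_is_ideal pq, prime_is_ideal pp).
have qM a : q a -> M a by move=> /qp /(loc_comap_sub pp).
case: locL => inv frac ker.
pose p' y := exists a s, [/\ ~ M s, q a & y * phi s = phi a].
have p'E b : p' (phi b) <-> q b.
  split=> [[a [s [nMs qa e]]]|qb]; last first.
    by exists b, 1; split; rewrite ?rmorph1 ?mulr1 //; apply: prime_not1.
  have [t nMt ets] : exists2 t, ~ M t & t * (b * s) = t * a.
    by apply: ker; rewrite rmorphM.
  have : q (t * (b * s)) by rewrite ets; apply: ideal_mull.
  by case/(prime_mul pq) => [/qM //|/(prime_mul pq) [//|/qM]].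
have ip' : is_ideal p'.
  split.
  - by exists 0, 1; split; rewrite ?rmorph0 ?mul0r //;
      [apply: prime_not1|apply: ideal_zero].
  - move=> x y [a [s [nMs qa ea]]] [b [t [nMt qb eb]]].
    exists (a * t + b * s), (s * t); split.
    + by case/(prime_mul primeM).
    + by apply: ideal_add => //; apply: ideal_mulr.
    + by rewrite rmorphD !rmorphM -ea -eb; ring.
  - move=> c x [a [s [nMs qa ea]]]; have [b [t [nMt eb]]] := frac c.
    exists (b * a), (t * s); split.
    + by case/(prime_mul primeM).
    + exact: ideal_mull.
    + by rewrite !rmorphM -ea -eb; ring.
exists p'; split.
- split=> //; first by rewrite -(rmorph1 phi) p'E; apply: prime_not1.
  move=> x y p'xy.
  have [a [s [nMs ea]]] := frac x; have [b [t [nMt eb]]] := frac y.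
  have : p' (phi (a * b)).
    rewrite rmorphM -ea -eb mulrACA; exact: ideal_mulr.
  by case/p'E/(prime_mul pq) => [qa|qb]; [left; exists a, s|right; exists b, t].
- by apply/boolp.predeqP => b; apply: p'E.
- move=> y [a [s [nMs qa e]]].
  have : p (y * phi s) by rewrite e; apply: qp.
  by case/(prime_mul pp) => // /(loc_comap_sub pp).
- by exists (phi a0) => // /p'E.
Qed.

End Localization.

(** Strict inclusions survive contraction from a ring that is integral over
    [B[X]] to [B[X]], and from there to [B] as the lower prime contains a monic
    polynomial [h], modulo which [B[X]] is integral over [B].  In this way steps
    down in [Z] become steps down in the localization [L]. *)
Section PrependPrime.
Variables (B L Z : comNzRingType) (M : B -> Prop) (phi : {rmorphism B -> L}).
Hypotheses (primeM : prime_ideal M) (locL : is_localization M phi).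
Variable iota : {rmorphism {poly B} -> Z}.
Hypothesis intZ : integralRange iota.
Variable h : {poly B}.
Hypotheses (monh : h \is monic) (sh : (1 < size h)%N).

Lemma prepend_prime (Q' Q : Z -> Prop) (p : L -> Prop) e :
  prime_ideal Q' -> prime_ideal Q -> (forall y, Q' y -> Q y) ->
  (exists2 y, Q y & ~ Q' y) -> Q' (iota h) ->
  up e p -> comap phi p = comap (iota \o polyC) Q ->
  exists p', up e.+1 p' /\ comap phi p' = comap (iota \o polyC) Q'.
Proof.
move=> pQ' pQ sub [y Qy nQ'y] Q'h upp ep.
have pp := up_prime upp.
have [a Qa nQ'a] : exists2 a, comap iota Q a & ~ comap iota Q' a.
  have [f monf /rootP fy] := intZ y.
  apply: (incomparability pQ' pQ sub Qy nQ'y monf); rewrite fy.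
  by apply: ideal_zero; apply: prime_is_ideal.
have [f monf /rootP fa] := qpoly_integral monh sh (in_qpoly h a).
have [g eg] : exists g, (map_poly polyC f).[a] = g * h.
  apply: (in_qpoly_ker monh sh); rewrite -horner_map /= -[RHS]fa -map_poly_comp.
  by congr (_.[_]); apply: eq_map_poly => c /=; rewrite in_qpolyC.
have [c Qc nQ'c] : exists2 c, comap polyC (comap iota Q) c & ~ comap polyC (comap iota Q') c.
  have Q'fa : comap iota Q' (map_poly polyC f).[a].
    rewrite eg; apply: ideal_mull => //; apply: comap_ideal.
    exact: prime_is_ideal.
  apply: (incomparability (comap_prime iota pQ') (comap_prime iota pQ) _ Qa nQ'a monf Q'fa).
  by move=> z; apply: sub.
have [|||p' [pp' ep' p'p sp']] :=
    @loc_lift_prime B L M phi primeM locL p (comap (iota \o polyC) Q') pp.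
- exact: comap_prime.
- by rewrite ep => z; apply: sub.
- by rewrite ep; exists c.
exists p'; split=> //=; split=> //; exists p; split=> //.
Qed.

End PrependPrime.

(** * Linear and algebraic dependence *)

(** Fraction-free elimination of one coordinate at a time. *)
Lemma linear_dependence (C : idomainType) (I J : eqType) (F : I -> J -> C)
  (js : seq J) (is_ : seq I) : uniq is_ -> (size js < size is_)%N ->
  exists v : I -> C, (exists2 i, i \in is_ & v i != 0) /\
    forall j, j \in js -> \sum_(i <- is_) v i * F i j = 0.
Proof.
elim: js is_ F => [|j js IH] is_ F ui si.
  case: is_ ui si => // i is_ _ _; exists (fun=> 1); split=> //.
  by exists i; rewrite ?inE ?eqxx ?oner_neq0.
have [/hasP [i0 i0is Fi0]|/hasPn F0] := boolP (has (fun i => F i j != 0) is_); last first.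
  have [|v [nz v0]] := IH is_ F ui; first exact: ltn_trans (ltnSn _) si.
  exists v; split=> // j'; rewrite inE => /orP [/eqP ->|/v0 //].
  rewrite big_seq big1 // => i ii; have := F0 i ii; rewrite negbK => /eqP ->.
  by rewrite mulr0.
pose F' i j' := F i0 j * F i j' - F i j * F i0 j'.
have [||v [[i1 i1is nz] v0]] := IH (rem i0 is_) F'.
- exact: rem_uniq.
- by rewrite size_rem //; case: (size is_) si.
pose w i := if i == i0 then - \sum_(i <- rem i0 is_) v i * F i j else v i * F i0 j.
have sumw j' : \sum_(i <- is_) w i * F i j' = \sum_(i <- rem i0 is_) v i * F' i j'.
  rewrite (perm_big _ (perm_to_rem i0is)) big_cons /= {1}/w eqxx mulNr mulr_suml.
  rewrite addrC -sumrB !big_seq; apply: eq_bigr => i.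
  rewrite mem_rem_uniq // inE => /andP [ni _].
  by rewrite /w (negbTE ni) /F'; ring.
exists w; split.
  have : i1 != i0 /\ i1 \in is_ by move: i1is; rewrite mem_rem_uniq // inE => /andP.
  move=> [ni ii]; exists i1 => //.
  by rewrite /w (negbTE ni) mulf_neq0.
move=> j'; rewrite inE sumw => /orP [/eqP ->|/v0 //].
by rewrite big1 // => i _; rewrite /F' [F i0 j * _]mulrC subrr mulr0.
Qed.

Section AlgebraicDependence.
Variables (C : idomainType) (n : nat).
Implicit Types (c : {mpoly C[n]}) (f : 'I_n -> {mpoly C[n]}).

Let monom f k (b : {ffun 'I_n -> 'I_k}) := \prod_j f j ^+ b j.

Lemma msizeM_pred c d : (msize (c * d) <= (msize c + msize d).-1)%N.
Proof.
have [->|c0] := eqVneq c 0; first by rewrite mul0r msize0.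
have [->|d0] := eqVneq d 0; first by rewrite mulr0 msize0.
by rewrite msizeM.
Qed.

Lemma msizeX_leq d c k : (msize c <= d.+1)%N -> (msize (c ^+ k) <= (d * k).+1)%N.
Proof.
move=> sc; elim: k => [|k IH]; first by rewrite expr0 msize1.
rewrite exprS; apply: leq_trans (msizeM_pred _ _) _.
by rewrite mulnS -addSn; lia.
Qed.

Lemma msize_prod_leq d k (r : seq 'I_n) (F : 'I_n -> {mpoly C[n]}) :
  (forall i, (msize (F i) <= (d * k).+1)%N) ->
  (msize (\prod_(i <- r) F i) <= (d * k * size r).+1)%N.
Proof.
move=> sF; elim: r => [|i r IH]; first by rewrite big_nil msize1.
rewrite big_cons; apply: leq_trans (msizeM_pred _ _) _.
rewrite /= mulnS; move: (sF i) IH.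
by set x := msize _; set y := msize _; set z := (d * k * _)%N; lia.
Qed.

(** The [k ^ n.+1] products [c ^+ i * f ^+ b] with exponents below [k] have
    degrees that grow linearly in [k], so for large [k] they lie in a space of
    dimension below [k ^ n.+1] and satisfy a linear relation.  In it, the least
    power of [c] that occurs can be cancelled. *)
Lemma algebraic_dependence c f : c != 0 ->
  exists k (a : {ffun 'I_n -> 'I_k} -> C) (g : nat -> {ffun 'I_n -> 'I_k} -> C),
    (exists b, a b != 0) /\
    \sum_b a b *: monom f b = c * \sum_(i < k) c ^+ i * \sum_b g i b *: monom f b.
Proof.
move=> c0.
pose d := maxn (msize c) (\max_i msize (f i)).
have dc : (msize c <= d.+1)%N by rewrite ltnW // ltnS leq_maxl.
have df i : (msize (f i) <= d.+1)%N.
  by apply: leqW; rewrite leq_max; apply/orP; right; apply: (leq_bigmax i).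
pose M := (d * n.+1).+1; pose k := (M ^ n).+1; pose N := (d * k * n.+1).+1.
have sT (i : 'I_k) (b : {ffun 'I_n -> 'I_k}) : (msize (c ^+ i * monom f b) <= N)%N.
  apply: leq_trans (msizeM_pred _ _) _.
  have h1 : (msize (c ^+ i) <= (d * k).+1)%N.
    apply: leq_trans (msizeX_leq i dc) _; rewrite ltnS leq_mul2l ltnW ?orbT //.
  have h2 : (msize (monom f b) <= (d * k * n).+1)%N.
    rewrite -[X in (_ * X).+1](size_enum_ord n) /monom -big_enum.
    apply: msize_prod_leq => j; apply: leq_trans (msizeX_leq _ (df j)) _.
    by rewrite ltnS leq_mul2l ltnW ?orbT.
  by rewrite /N mulnS; move: h1 h2; lia.
pose T := ('I_k * {ffun 'I_n -> 'I_k})%type.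
pose J := {ffun 'I_n -> 'I_N}.
pose F (t : T) (m : J) := (c ^+ t.1 * monom f t.2)@_[multinom (m i : nat) | i < n].
have cardJT : (size (enum {: J}) < size (enum {: T}))%N.
  rewrite -!cardE card_prod !card_ffun !card_ord.
  have kM : (N <= k * M)%N.
    rewrite /M mulnS mulnA [(k * d)%N]mulnC /N.
    by set x := (d * k * _)%N; rewrite /k; lia.
  have le_exp e : (N ^ e <= (k * M) ^ e)%N by case: e => // e; rewrite leq_exp2r.
  apply: leq_ltn_trans (le_exp n) _.
  by rewrite expnMn mulnC ltn_mul2r expn_gt0 /= /k ltnSn.
have [v [[[i1 b1] _ nz] v0]] := linear_dependence F (enum_uniq {: T}) cardJT.
have rel : \sum_(t : T) v t *: (c ^+ t.1 * monom f t.2) = 0.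
  apply/mpolyP => m; rewrite mcoeff0 raddf_sum /=.
  have [mN|Nm] := ltnP (mdeg m) N; last first.
    rewrite big1 // => -[i b] _; rewrite mcoeffZ memN_msupp_eq0 ?mulr0 //.
    by apply: msize_mdeg_ge; apply: leq_trans (sT i b) Nm.
  have mi i : (m i < N)%N.
    by apply: leq_ltn_trans mN; rewrite mdegE (bigD1 i) //= leq_addr.
  have := v0 [ffun i => Ordinal (mi i)]; rewrite mem_enum => /(_ isT).
  rewrite big_enum /= => e0; rewrite -[RHS]e0; apply: eq_bigr => t _.
  rewrite mcoeffZ /F; congr (_ * mcoeff _ _).
  by apply/mnmP => i; rewrite mnmE ffunE.
pose w (i : nat) b := if insub i is Some i' then v (i', b) else 0.
have wE (i : 'I_k) b : w i b = v (i, b) by rewrite /w valK.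
have exw : exists i, [exists b, w i b != 0].
  by exists i1; apply/existsP; exists b1; rewrite wE.
pose G i := \sum_b w i b *: monom f b.
have relG : \sum_(0 <= i < k) c ^+ i * G i = 0.
  rewrite big_mkord -[RHS]rel.
  transitivity (\sum_(i < k) \sum_b v (i, b) *: (c ^+ i * monom f b)).
    apply: eq_bigr => i _; rewrite mulr_sumr; apply: eq_bigr => b _.
    by rewrite wE scalerAr.
  by rewrite pair_bigA; apply: eq_bigr => -[i b].
case: (ex_minnP exw) => i0 /existsP [b0 wb0] mini.
have i0k : (i0 < k)%N.
  by move: wb0; rewrite /w; case: insubP => [[]|] //; rewrite eqxx.
exists k, (w i0), (fun i b => - w (i0.+1 + i)%N b); split; first by exists b0.
have Gsmall i : (i < i0)%N -> G i = 0.
  move=> ii; rewrite /G big1 // => b _.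
  have /eqP -> : w i b == 0; last by rewrite scale0r.
  apply/negPn/negP => nzw; suff : (i0 <= i)%N by rewrite leqNgt ii.
  by apply: mini; apply/existsP; exists b.
have Glarge i : (k <= i)%N -> G i = 0.
  move=> ki; rewrite /G big1 // => b _.
  by rewrite /w insubF ?scale0r // ltnNge ki.
apply: (mulfI (expf_neq0 i0 c0)).
have -> : \sum_(i < k) c ^+ i * \sum_b - w (i0.+1 + i)%N b *: monom f b
    = - \sum_(i < k) c ^+ i * G (i0.+1 + i)%N.
  rewrite -sumrN; apply: eq_bigr => i _; rewrite -mulrN -sumrN; congr (_ * _).
  by apply: eq_bigr => b _; rewrite scaleNr.
rewrite !mulrN; apply/eqP; rewrite -addr_eq0; apply/eqP.
rewrite -[RHS]relG (big_cat_nat (n := i0)) ?(ltnW i0k) //=.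
have -> : \sum_(0 <= i < i0) c ^+ i * G i = 0.
  by rewrite big_nat big1 // => i /Gsmall ->; rewrite mulr0.
rewrite add0r.
rewrite big_ltn //; congr (_ + _).
have -> : \sum_(i0.+1 <= i < k) c ^+ i * G i = \sum_(i0.+1 <= i < k + i0.+1) c ^+ i * G i.
  rewrite [RHS](big_cat_nat (n := k)) ?leq_addr //= -[LHS]addr0; congr (_ + _).
  by rewrite big_nat big1 // => i /andP [ki _]; rewrite Glarge ?mulr0.
rewrite -{2}[i0.+1]add0n big_addn addnK big_mkord mulrA -exprSr mulr_sumr.
by apply: eq_bigr => i _; rewrite mulrA -exprD addnC.
Qed.

End AlgebraicDependence.

(** * Grading and products of linear forms *)

Lemma mpoly_rmorph_ext (C : comNzRingType) n (Z : comNzRingType)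
    (u v : {rmorphism {mpoly C[n]} -> Z}) :
  (forall c, u c%:MP = v c%:MP) -> (forall i, u 'X_i = v 'X_i) -> u =1 v.
Proof.
move=> uvC uvX p; rewrite [p]mpolyE !rmorph_sum; apply: eq_bigr => m _.
rewrite -mul_mpolyC !rmorphM uvC; congr (_ * _).
rewrite mpolyXE_id !rmorph_prod; apply: eq_bigr => i _.
by rewrite !rmorphXn uvX.
Qed.

Section Grading.
Variables (C : comNzRingType) (n : nat).
Local Notation S := {mpoly C[n]}.
Implicit Types f g : S.

(** The grading morphism [x_i |-> x_i T]; the coefficient of [T ^ d] is the
    homogeneous component of degree [d]. *)
Definition grading : S -> {poly S} :=
  mmap ((@polyC S) \o (@mpolyC n C)) (fun i => ('X_i)%:P * 'X).
HB.instance Definition _ := GRing.RMorphism.copy grading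
  (mmap ((@polyC S) \o (@mpolyC n C)) (fun i => ('X_i)%:P * 'X)).

Definition component d f : S := (grading f)`_d.
Definition homogeneous_of d f := grading f = f%:P * 'X^d.

Lemma gradingC c : grading c%:MP = c%:MP%:P. Proof. by rewrite /grading mmapC. Qed.
Lemma gradingX i : grading 'X_i = ('X_i)%:P * 'X.
Proof. by rewrite /grading mmapX mmap1U. Qed.

Lemma homogC c : homogeneous_of 0 c%:MP.
Proof. by rewrite /homogeneous_of gradingC expr0 mulr1. Qed.
Lemma homogX i : homogeneous_of 1 'X_i.
Proof. by rewrite /homogeneous_of gradingX expr1. Qed.
Lemma homog0 d : homogeneous_of d 0.
Proof. by rewrite /homogeneous_of rmorph0 mul0r. Qed.
Lemma homogD d f g : homogeneous_of d f -> homogeneous_of d g -> homogeneous_of d (f + g).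
Proof. by rewrite /homogeneous_of rmorphD /= => -> ->; rewrite polyCD mulrDl. Qed.
Lemma homogM d e f g : homogeneous_of d f -> homogeneous_of e g -> homogeneous_of (d + e) (f * g).
Proof. by rewrite /homogeneous_of rmorphM /= => -> ->; rewrite polyCM exprD mulrACA. Qed.
Lemma homogZ d c f : homogeneous_of d f -> homogeneous_of d (c *: f).
Proof. by move=> hf; rewrite -mul_mpolyC; apply: (homogM (homogC c) hf). Qed.
Lemma homog_exp d f k : homogeneous_of d f -> homogeneous_of (k * d) (f ^+ k).
Proof.
move=> hf; elim: k => [|k IH]; first by rewrite expr0 -mpolyC1; apply: homogC.
by rewrite exprS mulSn; apply: homogM.
Qed.
Lemma homog_sum (I : Type) (r : seq I) (P : pred I) (F : I -> S) d :
  (forall i, P i -> homogeneous_of d (F i)) -> homogeneous_of d (\sum_(i <- r | P i) F i).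
Proof.
move=> hF; apply: (big_ind (homogeneous_of d)); first exact: homog0.
  by move=> f g; apply: homogD.
exact: hF.
Qed.
Lemma homog_prod (I : Type) (r : seq I) (F : I -> S) (d : I -> nat) :
  (forall i, homogeneous_of (d i) (F i)) -> homogeneous_of (\sum_(i <- r) d i) (\prod_(i <- r) F i).
Proof.
move=> hF; apply: (big_ind2 homogeneous_of).
- by rewrite -mpolyC1; apply: homogC.
- by move=> d1 f d2 g; apply: homogM.
- by move=> i _; apply: hF.
Qed.

Lemma component_is_additive d : {morph component d : f g / f + g}.
Proof. by move=> f g; rewrite /component rmorphD coefD. Qed.
Lemma component_sum d (I : Type) (r : seq I) (P : pred I) (F : I -> S) :
  component d (\sum_(i <- r | P i) F i) = \sum_(i <- r | P i) component d (F i).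
Proof. by rewrite /component rmorph_sum coef_sum. Qed.

Lemma component_homog d f : homogeneous_of d f -> component d f = f.
Proof. by rewrite /homogeneous_of /component => ->; rewrite coefMXn ltnn subnn coefC. Qed.
Lemma component_mulr d e f g : homogeneous_of d f ->
  component e (f * g) = if (e < d)%N then 0 else f * component (e - d) g.
Proof.
rewrite /homogeneous_of /component rmorphM /= => ->; rewrite -mulrA mulrCA coefXnM.
by case: ifP => // _; rewrite coefCM.
Qed.

Lemma homog_mnm m : homogeneous_of (mdeg m) 'X_[m].
Proof.
rewrite mpolyXE_id mdegE; apply: homog_prod => i.
by rewrite -[X in homogeneous_of X]muln1; apply: homog_exp; apply: homogX.
Qed.

Lemma componentE d f : component d f = \sum_(m <- msupp f | mdeg m == d) f@_m *: 'X_[m].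
Proof.
rewrite {1}[f]mpolyE component_sum [RHS]big_mkcond; apply: eq_bigr => m _ /=.
have := homogZ f@_m (homog_mnm m); rewrite /homogeneous_of /component => ->.
by rewrite coefMXn coefC; case: ltngtP => [|h|->]; rewrite ?subnn // subn_eq0 leqNgt h.
Qed.

Lemma homog_component d f : homogeneous_of d (component d f).
Proof.
rewrite componentE; apply: homog_sum => m /eqP <-; apply: homogZ; exact: homog_mnm.
Qed.

Lemma sum_component f : f = \sum_(d < size (grading f)) component d f.
Proof.
suff e : f = (grading f).[1].
  by rewrite {1}e horner_coef; apply: eq_bigr => d _; rewrite expr1n mulr1.
apply/esym; apply: (mpoly_rmorph_ext (u := horner_eval 1 \o grading) (v := idfun)) => [c|i] /=.
  by rewrite /horner_eval gradingC hornerC.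
by rewrite /horner_eval gradingX hornerMX hornerC mulr1.
Qed.

Lemma msupp_homog d f m : homogeneous_of d f -> m \in msupp f -> mdeg m = d.
Proof.
move=> /component_homog; rewrite componentE => e; apply: contraTeq => nm.
rewrite -e -mcoeff_eq0 raddf_sum /= big1 // => m' /eqP em'.
rewrite mcoeffZ mcoeffX; case: eqP => [e'|]; last by rewrite mulr0.
by rewrite -e' em' eqxx in nm.
Qed.

Lemma msize_homog d f : homogeneous_of d f -> (msize f <= d.+1)%N.
Proof.
move=> hf; rewrite msizeE big_seq; apply/bigmax_leqP_seq => m mf _.
by rewrite (msupp_homog hf mf).
Qed.

End Grading.

Section LinearForms.
Variables (C : comNzRingType) (n : nat).
Local Notation S := {mpoly C[n]}.

Definition linform (v : 'rV[C]_n) : S := \sum_j v 0 j *: 'X_j.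

Lemma linform_homog v : homogeneous_of 1 (linform v).
Proof. by apply: homog_sum => j _; apply: homogZ; apply: homogX. Qed.

(** The subset [P] of cofactors is either everything, for the ideal generated
    by the values of [g], or the ring of invariants. *)
Definition combination (g : 'I_n -> S) (P : S -> Prop) : S -> Prop :=
  fun x => exists z : 'I_n -> S, (forall i, P (z i)) /\ x = \sum_i g i * z i.

Lemma combination_ideal g : is_ideal (combination g (fun=> True)).
Proof.
split.
- by exists (fun=> 0); split=> //; rewrite big1 // => i _; rewrite mulr0.
- move=> a b [y [_ ->]] [z [_ ->]]; exists (fun i => y i + z i); split=> //.
  by rewrite -big_split /=; apply: eq_bigr => i _; rewrite mulrDr.
- move=> c a [z [_ ->]]; exists (fun i => c * z i); split=> //.
  by rewrite mulr_sumr; apply: eq_bigr => i _; rewrite mulrCA.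
Qed.

Lemma combination_mem g i : combination g (fun=> True) (g i).
Proof.
exists (fun j => (i == j)%:R); split=> //; rewrite (bigD1 i) //= eqxx mulr1.
by rewrite big1 ?addr0 // => j ji; rewrite eq_sym (negbTE ji) mulr0.
Qed.

Definition rows (w : 'I_n -> 'rV[C]_n) : 'M[C]_n := \matrix_(i, j) w i 0 j.

(** Cramer's rule. *)
Lemma det_linform (w : 'I_n -> 'rV[C]_n) j :
  \det (rows w) *: 'X_j = \sum_i (\adj (rows w)) j i *: linform (w i).
Proof.
have adjE k : \sum_i (\adj (rows w)) j i * w i 0 k = \det (rows w) * (j == k)%:R.
  have := congr1 (fun N : 'M_n => N j k) (mul_adj_mx (rows w)).
  rewrite !mxE mulr_natr => <-; apply: eq_bigr => i _.
  by rewrite [X in _ = _ * X]mxE.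
transitivity (\sum_k \sum_i ((\adj (rows w)) j i * w i 0 k) *: 'X_k : S).
  rewrite (bigD1 j) //= -scaler_suml adjE eqxx mulr1 big1 ?addr0 // => k kj.
  by rewrite -scaler_suml adjE eq_sym (negbTE kj) mulr0 scale0r.
rewrite exchange_big; apply: eq_bigr => i _; rewrite scaler_sumr.
by apply: eq_bigr => k _; rewrite scalerA.
Qed.

End LinearForms.

Section Products.
Variables (C : idomainType) (n : nat).
Local Notation S := {mpoly C[n]}.

Definition lprod (r : seq 'rV[C]_n) : S := \prod_(v <- r) linform v.

Definition upd (T : Type) (F : 'I_n -> T) i x : 'I_n -> T := fun j => if j == i then x else F j.

(** A variable splits off the monomial and is, up to the denominator
    [\det (rows w)], a combination of the heads of the lists; multiplied by
    such a head, the product of a shortened list becomes the product of the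
    whole list.  The bound [sum (length - 1) < deg] is the sharp one, since the
    products form a complete intersection. *)
Lemma lprod_generate (Ls : 'I_n -> seq 'rV[C]_n) :
  (forall w, (forall i, w i \in Ls i) -> \det (rows w) != 0) ->
  exists2 d, d != 0 & forall m : 'X_{1..n}, (\sum_i size (Ls i) < mdeg m + n)%N ->
    combination (fun i => lprod (Ls i)) (fun=> True) (d *: 'X_[m]).
Proof.
have nilcase (Ls' : 'I_n -> seq 'rV[C]_n) i : Ls' i = [::] -> exists2 d : C, d != 0 &
    forall m : 'X_{1..n}, (\sum_i size (Ls' i) < mdeg m + n)%N ->
    combination (fun i => lprod (Ls' i)) (fun=> True) (d *: 'X_[m]).
  move=> Li; exists 1; rewrite ?oner_neq0 // => m _.
  have := combination_mem (fun i => lprod (Ls' i)) i.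
  rewrite /= Li /lprod big_nil scale1r -[X in _ -> _ X]mulr1.
  exact: ideal_mull (combination_ideal _).
elim: {Ls}(\sum_i size (Ls i))%N {-2}Ls (leqnn (\sum_i size (Ls i))) => [|k IH] Ls sLs detL;
  (have [[i /nilcase //]|noi] := boolp.EM (exists i, Ls i = [::])).
- have n0 (i : 'I_n) : False.
    apply: noi; exists i; apply/nilP; rewrite /nilp -leqn0; apply: leq_trans sLs.
    by rewrite (bigD1 i) //= leq_addr.
  exists 1; rewrite ?oner_neq0 // => m; rewrite big1 => [|i]; last by case: (n0 i).
  rewrite mdegE big1 => [|i]; last by case: (n0 i).
  by rewrite add0n => npos; case: (n0 (Ordinal npos)).
have Lcons i : Ls i = head 0 (Ls i) :: behead (Ls i).
  by case: (Ls i) (fun h => noi (ex_intro _ i h)) => // /(_ erefl).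
pose w i := head 0 (Ls i).
pose Ls' i := upd Ls i (behead (Ls i)).
have sz i : (\sum_j size (Ls j) = (\sum_j size (Ls' i j)).+1)%N.
  rewrite (bigD1 i) //= [in RHS](bigD1 i) //= /Ls' /upd eqxx {1}Lcons /= addSn.
  by congr (_ + _).+1; apply: eq_bigr => j ji; rewrite (negbTE ji).
have /boolp.choice [d dP] : forall i, exists d, d != 0 /\
    forall m : 'X_{1..n}, (\sum_j size (Ls' i j) < mdeg m + n)%N ->
    combination (fun j => lprod (Ls' i j)) (fun=> True) (d *: 'X_[m]).
  move=> i; have [||d d0 dP] := IH (Ls' i); last by exists d.
    by rewrite -ltnS -sz.
  move=> v vL; apply: detL => j; have := vL j; rewrite /Ls' /upd.
  by case: eqP => // -> vi; rewrite Lcons inE vi orbT.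
exists (\det (rows w) * \prod_i d i).
  rewrite mulf_neq0 //; last by apply/prodf_neq0 => i _; case: (dP i).
  by apply: detL => i; rewrite Lcons inE eqxx.
move=> m sm.
have : (0 < mdeg m)%N.
  rewrite -(ltn_add2r n) add0n; apply: leq_ltn_trans sm.
  rewrite -{1}(card_ord n) -sum1_card; apply: leq_sum => i _.
  by rewrite Lcons.
rewrite lt0n mdeg_eq0 => m0.
have [j mj] : exists j, (m j != 0)%N.
  apply/existsP; apply: contraNT m0; rewrite negb_exists => /forallP h.
  by apply/eqP/mnmP => j; rewrite mnm0E; have := h j; rewrite negbK => /eqP.
have em : m = (U_(j) + (m - U_(j)))%MM by rewrite addmC submK // lep1mP.
set m' := (m - U_(j))%MM in em.
have -> : (\det (rows w) * \prod_i d i) *: 'X_[m] =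
    (\prod_i d i) *: ((\det (rows w) *: 'X_j) * 'X_[m']) :> S.
  by rewrite {1}em mpolyXD -scalerAl scalerA mulrC.
rewrite det_linform.
rewrite mulr_suml scaler_sumr.
apply: ideal_sum; first exact: combination_ideal.
move=> i _; have [_ /(_ m')] := dP i.
have -> : (\prod_i0 d i0) *: (((\adj (rows w)) j i *: linform (w i)) * 'X_[m']) =
  ((\prod_(i0 | i0 != i) d i0 * (\adj (rows w)) j i)%:MP) *
     (linform (w i) * (d i *: 'X_[m'])) :> S.
  rewrite (bigD1 i) //= -!mul_mpolyC !mpolyCM; ring.
case=> [|z [_ ->]].
  by have := sm; rewrite (sz i) {1}em mdegD mdeg1 !addSn add0n ltnS.
apply: ideal_mull; first exact: combination_ideal.
rewrite mulr_sumr; apply: ideal_sum; first exact: combination_ideal.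
move=> l _; rewrite mulrA; apply: ideal_mulr; first exact: combination_ideal.
have [->|li] := eqVneq l i.
  have -> : linform (w i) * lprod (Ls' i i) = lprod (Ls i).
    by rewrite /Ls' /upd eqxx [in RHS]Lcons /lprod big_cons.
  exact: combination_mem.
have -> : lprod (Ls' i l) = lprod (Ls l) by rewrite /Ls' /upd (negbTE li).
by apply: ideal_mull; [exact: combination_ideal|exact: combination_mem].
Qed.

Lemma lprod_generate_homog (Ls : 'I_n -> seq 'rV[C]_n) :
  (forall w, (forall i, w i \in Ls i) -> \det (rows w) != 0) ->
  exists2 d, d != 0 & forall e f, homogeneous_of e f -> (\sum_i size (Ls i) < e + n)%N ->
    combination (fun i => lprod (Ls i)) (fun=> True) (d *: f).
Proof.
move=> /lprod_generate [d d0 dP]; exists d => // e f hf se.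
rewrite [f]mpolyE scaler_sumr big_seq; apply: ideal_sum; first exact: combination_ideal.
move=> m mf; rewrite scalerA mulrC -scalerA -mul_mpolyC.
apply: ideal_mull; first exact: combination_ideal.
by apply: dP; rewrite (msupp_homog hf mf).
Qed.

End Products.

(** * Group action and transfer *)

Section Action.
Variables (C : idomainType) (n : nat).
Local Notation S := {mpoly C[n]}.
Implicit Types (s t : 'M[C]_n) (f g : S).

HB.instance Definition _ s := GRing.RMorphism.copy (@mpoly_act C n s)
  (comp_mpoly [tuple \sum_(j < n) invmx s i j *: 'X_j | i < n]).

Lemma actC s c : mpoly_act s c%:MP = c%:MP.
Proof. by rewrite /mpoly_act comp_mpolyC. Qed.
Lemma actZ s c f : mpoly_act s (c *: f) = c *: mpoly_act s f.
Proof. by rewrite -!mul_mpolyC rmorphM /= actC. Qed.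
Lemma actX s i : mpoly_act s 'X_i = \sum_j invmx s i j *: 'X_j.
Proof. by rewrite /mpoly_act comp_mpolyXU -tnth_nth tnth_mktuple. Qed.

Lemma act_linform s v : mpoly_act s (linform v) = linform (v *m invmx s).
Proof.
rewrite /linform rmorph_sum /=.
under eq_bigr => j _ do rewrite actZ actX scaler_sumr.
rewrite exchange_big; apply: eq_bigr => k _; rewrite mxE scaler_suml.
by apply: eq_bigr => j _; rewrite scalerA.
Qed.

Lemma actM s t f : s \in unitmx -> t \in unitmx ->
  mpoly_act s (mpoly_act t f) = mpoly_act (s *m t) f.
Proof.
move=> us ut; move: f; apply: (mpoly_rmorph_ext (u := mpoly_act s \o mpoly_act t)
  (v := mpoly_act (s *m t))) => [c|i] /=; first by rewrite !actC.
rewrite actX rmorph_sum /=; under eq_bigr => j _ do rewrite actZ actX scaler_sumr.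
rewrite exchange_big actX; apply: eq_bigr => k _ /=.
have -> : invmx (s *m t) = invmx t *m invmx s.
  have ust : s *m t \in unitmx by rewrite unitmx_mul us.
  apply: (can_inj (mulKmx ust)); rewrite mulmxV // mulmxA -[s *m t *m invmx t]mulmxA.
  by rewrite mulmxV // mulmx1 mulmxV.
rewrite mxE scaler_suml; apply: eq_bigr => j _.
by rewrite scalerA.
Qed.

Lemma act1 f : mpoly_act 1%:M f = f.
Proof.
apply: (mpoly_rmorph_ext (u := mpoly_act 1%:M) (v := idfun)) => [c|i] /=.
  by rewrite actC.
rewrite actX invmx1 (bigD1 i) //= mxE eqxx scale1r big1 ?addr0 // => j ji.
by rewrite mxE eq_sym (negbTE ji) scale0r.
Qed.

Lemma grading_act s f : grading (mpoly_act s f) = map_poly (mpoly_act s) (grading f).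
Proof.
move: f; apply: (mpoly_rmorph_ext (u := @grading C n \o mpoly_act s)
  (v := map_poly (mpoly_act s) \o @grading C n)) => [c|i] /=.
  by rewrite actC gradingC map_polyC /= actC.
rewrite gradingX rmorphM /= map_polyC map_polyX /= actX.
suff : homogeneous_of 1 (\sum_j invmx s i j *: ('X_j : S)).
  by rewrite /homogeneous_of expr1.
by apply: homog_sum => j _; apply: homogZ; apply: homogX.
Qed.

Lemma act_component s d f : component d (mpoly_act s f) = mpoly_act s (component d f).
Proof. by rewrite /component grading_act coef_map. Qed.

Variable G : {fset 'M[C]_n}.
Hypothesis hG : subgroup_GL G.

Lemma inG_unit s : s \in G -> s \in unitmx. Proof. by case: hG => h _ _ _ /h. Qed.

Lemma invariantsP f : reflect (forall s, s \in G -> mpoly_act s f = f) (f \in invariants G).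
Proof. by apply: (iffP allP) => h s sG; apply/eqP; apply: h. Qed.

Lemma invariantsZ c f : f \in invariants G -> c *: f \in invariants G.
Proof. by move=> /invariantsP h; apply/invariantsP => s sG; rewrite actZ h. Qed.

Lemma invariants_component d f : f \in invariants G -> component d f \in invariants G.
Proof. by move=> /invariantsP h; apply/invariantsP => s sG; rewrite -act_component h. Qed.

Lemma group_perm t : t \in G -> perm_eq [seq t *m s | s <- G] G.
Proof.
move=> tG; have inj : injective (mulmx t : 'M_n -> 'M_n).
  by apply: can_inj; apply: mulKmx; apply: inG_unit.
have us : uniq [seq t *m s | s <- G] by rewrite map_inj_uniq ?fset_uniq.
have sub : {subset [seq t *m s | s <- G] <= (G : seq 'M[C]_n)}.
  by move=> x /mapP [s sG ->]; case: hG => _ _ mG _; apply: mG.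
have [|_ h] := uniq_min_size us sub; first by rewrite size_map.
by apply: uniq_perm => //; rewrite ?fset_uniq.
Qed.

Lemma act_orbit (F : 'M[C]_n -> S) t : t \in G ->
  (forall s, s \in G -> mpoly_act t (F s) = F (t *m s)) ->
  mpoly_act t (\prod_(s <- G) F s) = \prod_(s <- G) F s /\
  mpoly_act t (\sum_(s <- G) F s) = \sum_(s <- G) F s.
Proof.
move=> tG FE; split.
  rewrite rmorph_prod -[RHS](perm_big _ (group_perm tG)) big_map big_seq [RHS]big_seq.
  by apply: eq_bigr => s sG /=; apply: FE.
rewrite rmorph_sum -[RHS](perm_big _ (group_perm tG)) big_map big_seq [RHS]big_seq.
by apply: eq_bigr => s sG /=; apply: FE.
Qed.

Definition transfer f : S := \sum_(s <- G) mpoly_act s f.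
Definition orbit_prod (v : 'rV[C]_n) : S := \prod_(s <- G) mpoly_act s (linform v).

Lemma transfer_inv f : transfer f \in invariants G.
Proof.
apply/invariantsP => t tG; apply: (proj2 (act_orbit tG _)) => s sG.
by rewrite actM ?inG_unit.
Qed.

Lemma orbit_prod_inv v : orbit_prod v \in invariants G.
Proof.
apply/invariantsP => t tG; apply: (proj1 (act_orbit tG _)) => s sG.
by rewrite actM ?inG_unit.
Qed.

Lemma orbit_prodE v : orbit_prod v = lprod [seq v *m invmx s | s <- G].
Proof. by rewrite /lprod big_map; apply: eq_bigr => s _; rewrite act_linform. Qed.

Lemma lprod_homog (r : seq 'rV[C]_n) : homogeneous_of (size r) (lprod r).
Proof. by rewrite -sum1_size; apply: homog_prod => v; apply: linform_homog. Qed.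

Lemma orbit_prod_homog v : homogeneous_of #|` G| (orbit_prod v).
Proof. by rewrite orbit_prodE -(size_map (fun s => v *m invmx s)); apply: lprod_homog. Qed.

Lemma transfer_mul f g : g \in invariants G -> transfer (f * g) = transfer f * g.
Proof.
move=> /invariantsP gi; rewrite /transfer mulr_suml big_seq [RHS]big_seq.
by apply: eq_bigr => s sG; rewrite rmorphM /= gi.
Qed.
Lemma transfer_component d f : component d (transfer f) = transfer (component d f).
Proof. by rewrite component_sum; apply: eq_bigr => s _; rewrite act_component. Qed.

(** The sum over all conjugates of the values of a polynomial [q] that vanishes
    at every conjugate but one is not zero, and it is a combination of
    transfers of powers. *)
Lemma exists_transfer_neq0 v :
  {in G &, injective (fun s => v *m invmx s)} ->
  exists i, transfer (linform v ^+ i) != 0.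
Proof.
move=> injv; pose l s := mpoly_act s (linform v).
have linj : {in G &, injective l}.
  move=> s t sG tG; rewrite /l !act_linform => e; apply: injv => //.
  apply/rowP => j; have := congr1 (mcoeff U_(j)) e.
  have cf w : (linform w)@_U_(j) = w 0 j.
    rewrite raddf_sum (bigD1 j) //= mcoeffZ mcoeffX eqxx mulr1.
    rewrite big1 ?addr0 // => k kj; rewrite mcoeffZ mcoeffX eq_mnm1 (negbTE kj).
    by rewrite mulr0.
  by rewrite !cf.
have G1 : 1%:M \in G by case: hG.
pose q : {poly S} := \prod_(s <- G | s != 1%:M) ('X - (l s)%:P).
have qeval s : q.[l s] = \prod_(t <- G | t != 1%:M) (l s - l t).
  by rewrite /q horner_prod; apply: eq_bigr => t _; rewrite hornerXsubC.
apply: boolp.contrapT => no.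
have : \sum_(s <- G) q.[l s] != 0.
  rewrite (big_rem 1%:M) //= big_seq big1 ?addr0 => [|s].
    rewrite qeval prodf_seq_neq0; apply/allP => t tG; apply/implyP => t1.
    rewrite subr_eq0; apply/negP => /eqP /linj e.
    by rewrite -e ?eqxx in t1.
  rewrite mem_rem_uniq ?fset_uniq // inE => /andP [s1 sG]; rewrite qeval (big_rem s) //= s1.
  by rewrite subrr mul0r.
suff -> : \sum_(s <- G) q.[l s] = \sum_(i < size q) q`_i * transfer (linform v ^+ i).
  rewrite big1 ?eqxx // => i _; apply/eqP; rewrite mulf_eq0; apply/orP; right.
  by apply/negPn/negP => h; apply: no; exists i.
under eq_bigr => s _ do rewrite horner_coef.
rewrite exchange_big; apply: eq_bigr => i _; rewrite mulr_sumr.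
by apply: eq_bigr => s _; rewrite rmorphXn.
Qed.

End Action.

(** * Vanishing above the top degree *)

Lemma addn_sub_trade x y k : (y < x)%N -> (y <= k)%N ->
  (x + (k - y) = (x - y).-1 + k.+1)%N.
Proof. lia. Qed.

Lemma componentZ (C : comNzRingType) n d c (f : {mpoly C[n]}) :
  component d (c *: f) = c *: component d f.
Proof. by rewrite -!mul_mpolyC (component_mulr _ _ (homogC n c)) subn0. Qed.

Section TopDegree.
Variables (C : idomainType) (n : nat) (G : {fset 'M[C]_n}).
Hypothesis hG : subgroup_GL G.
Local Notation S := {mpoly C[n]}.

Definition inv_combination (g : 'I_n -> S) := combination g (fun z => z \in invariants G).

Lemma inv_combination0 g : inv_combination g 0.
Proof.
exists (fun=> 0); split; first by move=> i; apply: rpred0.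
by rewrite big1 // => i _; rewrite mulr0.
Qed.
Lemma inv_combinationD g x y :
  inv_combination g x -> inv_combination g y -> inv_combination g (x + y).
Proof.
move=> [p [pi ->]] [q [qi ->]]; exists (fun i => p i + q i).
split; first by move=> i; apply: rpredD.
by rewrite -big_split /=; apply: eq_bigr => i _; rewrite mulrDr.
Qed.
Lemma inv_combination_sum (I : Type) (r : seq I) (P : pred I) (F : I -> S) g :
  (forall i, P i -> inv_combination g (F i)) ->
  inv_combination g (\sum_(i <- r | P i) F i).
Proof.
move=> hF; apply: (big_ind (inv_combination g)) => //.
  exact: inv_combination0.
by move=> x y; apply: inv_combinationD.
Qed.
Lemma inv_combination_mul g c x : c \in invariants G -> inv_combination g x ->
  inv_combination g (c * x).
Proof.
move=> ci [z [zi ->]]; exists (fun i => c * z i); split; first by move=> i; apply: rpredM.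
by rewrite mulr_sumr; apply: eq_bigr => i _; rewrite mulrCA.
Qed.
Lemma inv_combination_mem g i : inv_combination g (g i).
Proof.
exists (fun j => (i == j)%:R); split; first by move=> j; apply: rpred_nat.
rewrite (bigD1 i) //= eqxx mulr1 big1 ?addr0 // => j ji.
by rewrite eq_sym (negbTE ji) mulr0.
Qed.

Lemma invariantsC c : c%:MP \in invariants G.
Proof. by apply/invariantsP => s _; rewrite actC. Qed.

Variable v : 'I_n -> 'rV[C]_n.
Let f j : S := orbit_prod G (v j).
Let finv j : f j \in invariants G := orbit_prod_inv hG (v j).
Local Notation g := #|` G|.

Lemma invariants_exp k j : f j ^+ k \in invariants G.
Proof. by apply: rpredX. Qed.
Lemma invariants_monomial (e : 'I_n -> nat) : \prod_j f j ^+ e j \in invariants G.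
Proof. by apply: rpred_prod => j _; apply: rpredX. Qed.

Hypothesis detv : forall s : 'I_n -> 'M[C]_n, (forall i, s i \in G) ->
  \det (rows (fun i => v i *m invmx (s i))) != 0.

(** The lists of [lprod_generate] are [k] copies of the conjugates of [v j]. *)
Lemma high_degree k : exists2 d : C, d != 0 & forall e y, homogeneous_of e y ->
  (n * (k * g) < e + n)%N ->
  combination (fun j => f j ^+ k) (fun=> True) (d *: y).
Proof.
pose Ls j := flatten (nseq k [seq v j *m invmx s | s <- G]).
have LsE j : lprod (Ls j) = f j ^+ k.
  rewrite /Ls /f orbit_prodE /lprod; elim: k {Ls} => [|k IH] /=.
    by rewrite big_nil expr0.
  by rewrite big_cat /= IH exprS.
have szL j : size (Ls j) = (k * g)%N.
  by rewrite /Ls size_flatten /shape map_nseq sumn_nseq size_map mulnC.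
have [w wL|d d0 dP] := @lprod_generate_homog C n Ls.
  have /boolp.choice [s sP] : forall i, exists s, s \in G /\ w i = v i *m invmx s.
    move=> i; have /flattenP [l /nseqP [-> _] /mapP [s sG ->]] := wL i.
    by exists s.
  have -> : rows w = rows (fun i => v i *m invmx (s i)).
    by apply/matrixP => i j; rewrite !mxE; case: (sP i) => _ ->; rewrite mxE.
  by apply: detv => i; case: (sP i).
exists d => // e y hy se; have := dP e y hy.
have -> : (\sum_i size (Ls i) = n * (k * g))%N.
  by under eq_bigr => i _ do rewrite szL; rewrite sum_nat_const card_ord.
move=> /(_ se) [z [_ ->]]; exists z; split=> //.
by apply: eq_bigr => i _; rewrite LsE.
Qed.

(** Take a polynomial in the [f_j] that [c] divides, and a term of minimal
    degree in it, with exponents [al].  Multiplication by the [f_j ^+ (k - al j)]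
    turns this term into the monomial [(\prod_j f_j) ^+ k], and each of the
    other terms into a multiple of some [f_j ^+ k.+1]. *)
Lemma socle_multiple c : c \in invariants G -> c != 0 ->
  exists k a w, [/\ a != 0, w \in invariants G &
    inv_combination (fun j => f j ^+ k.+1) (a *: (\prod_j f j) ^+ k - c * w)].
Proof.
move=> ci c0; have [k [a [h [[b0 ab0] rel]]]] := algebraic_dependence f c0.
pose w := \sum_(i < k) c ^+ i * \sum_b h i b *: \prod_j f j ^+ b j.
have wi : w \in invariants G.
  apply: rpred_sum => i _; apply: rpredM; first exact: rpredX.
  by apply: rpred_sum => b _; apply: invariantsZ; apply: invariants_monomial.
pose deg (b : {ffun 'I_n -> 'I_k}) := (\sum_j b j)%N.
case: (@arg_minnP _ b0 (fun b => a b != 0) deg ab0) => al aal minal.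
pose mu := \prod_j f j ^+ (k - al j).
have mui : mu \in invariants G by apply: invariants_monomial.
exists k, (a al), (w * mu); split=> //; first exact: rpredM.
have Fk : (\prod_j f j) ^+ k = (\prod_j f j ^+ al j) * mu.
  rewrite -prodrXl -big_split; apply: eq_bigr => j _ /=.
  by rewrite -exprD subnKC // ltnW.
have -> : a al *: (\prod_j f j) ^+ k - c * (w * mu) =
    \sum_(b | b != al) (- a b) *: ((\prod_j f j ^+ b j) * mu).
  rewrite mulrA -rel (bigD1 al) //= mulrDl Fk scalerAl opprD addrA subrr add0r.
  rewrite mulr_suml -sumrN; apply: eq_bigr => b _.
  by rewrite scaleNr scalerAl.
apply: inv_combination_sum => b bal.
have [-> |ab] := eqVneq (a b) 0.
  by rewrite oppr0 scale0r; apply: inv_combination0.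
have [j bj] : exists j, (al j < b j)%N.
  apply/existsP; apply: contraNT bal; rewrite negb_exists => /forallP le.
  have le' j : (b j <= al j)%N by have := le j; rewrite -leqNgt.
  apply/eqP/ffunP => j; apply: val_inj; apply/eqP; rewrite eqn_leq le' /=.
  have := minal b ab; rewrite /deg (bigD1 j) //= [X in (_ <= X)%N](bigD1 j) //=.
  have : (\sum_(i | i != j) b i <= \sum_(i | i != j) al i)%N by apply: leq_sum.
  by set x := bigop _ _ _; set y := bigop _ _ _; have := le' j; lia.
have -> : - a b *: (\prod_j f j ^+ b j * mu) =
   ((- a b)%:MP * (\prod_(i | i != j) (f i ^+ b i * f i ^+ (k - al i)) *
      f j ^+ (b j - al j).-1)) * f j ^+ k.+1.
  rewrite -mul_mpolyC -!mulrA; congr (_ * _).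
  rewrite /mu -big_split (bigD1 j) //= mulrC; congr (_ * _).
  rewrite -!exprD; congr (_ ^+ _).
  move: bj (ltnW (ltn_ord (al j))).
  move: (nat_of_ord (b j)) (nat_of_ord (al j)) => x y yx yk.
  exact: addn_sub_trade.
apply: inv_combination_mul; last exact: (inv_combination_mem (fun j => f j ^+ k.+1)).
apply: rpredM; first exact: invariantsC.
apply: rpredM; last exact: invariants_exp.
by apply: rpred_prod => i _; apply: rpredM; apply: invariants_exp.
Qed.

Lemma component_inv_combination k T x : inv_combination (fun j => f j ^+ k) x ->
  inv_combination (fun j => f j ^+ k) (component T x).
Proof.
move=> [z [zi ->]]; rewrite component_sum; apply: inv_combination_sum => j _.
have hf : homogeneous_of (k * g) (f j ^+ k) by apply: homog_exp; apply: orbit_prod_homog.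
rewrite (component_mulr _ _ hf); case: ifP => _.
  exact: inv_combination0.
rewrite mulrC; apply: inv_combination_mul; last exact: (inv_combination_mem (fun j => f j ^+ k)).
exact: invariants_component.
Qed.

(** The top local cohomology of the invariants, supported at the [f_j],
    vanishes in degrees above [- n]: the class of [b / \prod_j f_j] is a
    transfer by [socle_multiple], and above degree [- n] the local cohomology
    of the polynomial ring vanishes by [high_degree]. *)
Theorem top_degree (u : 'rV[C]_n) b t : {in G &, injective (fun s => u *m invmx s)} ->
  b \in invariants G -> homogeneous_of t b -> (n * (g - 1) < t)%N ->
  exists k r, r != 0 /\
    inv_combination (fun j => f j ^+ k.+1) (r *: (b * (\prod_j f j) ^+ k)).
Proof.
move=> injU bi hb tn.
have [i tr0] := exists_transfer_neq0 hG injU.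
have [k [a [w [a0 wi hw]]]] := socle_multiple (transfer_inv hG _) tr0.
have [d d0 dP] := high_degree k.+1.
set FK := (\prod_j f j) ^+ k in hw *; set c := transfer G _ in hw.
pose T := (t + k * (n * g))%N.
have hbF : homogeneous_of T (b * FK).
  apply: homogM => //; apply: homog_exp.
  rewrite -[n in (n * _)%N]card_ord -sum_nat_const.
  by apply: homog_prod => j; apply: orbit_prod_homog.
have g0 : (0 < g)%N.
  by rewrite cardfs_gt0; apply/fset0Pn; exists 1%:M; case: hG.
exists k, (d * a); split; first exact: mulf_neq0.
have := component_inv_combination T (inv_combination_mul bi hw).
have -> : b * (a *: FK - c * w) =
   a *: (b * FK) + (-1) *: transfer G (linform u ^+ i * (w * b)).
  rewrite transfer_mul; last exact: rpredM.
  by rewrite mulrBr -scalerAr scaleN1r; congr (_ - _); rewrite -/c; ring.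
rewrite component_is_additive !componentZ (component_homog hbF) transfer_component.
rewrite -!mul_mpolyC.
set y := component T _ => hab.
have [z [_ ez]] := dP T y (homog_component _ _) ltac:(rewrite /T; nia).
have -> : (d * a) %:MP * (b * FK) = d%:MP * (a%:MP * (b * FK) + (-1)%:MP * transfer G y)
    + d%:MP * transfer G y.
  by rewrite mpolyCM mpolyCN mpolyC1; ring.
have comb0 := inv_combination_mul (invariantsC d) hab.
have -> : d%:MP * transfer G y = \sum_j transfer G (z j) * f j ^+ k.+1.
  rewrite mulrC -transfer_mul ?invariantsC // mulrC mul_mpolyC ez.
  rewrite /transfer; under eq_bigr => s _ do rewrite rmorph_sum /=.
  rewrite exchange_big; apply: eq_bigr => j _.
  rewrite -transfer_mul ?invariants_exp //; apply: eq_bigr => s _.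
  by rewrite mulrC.
apply: inv_combinationD => //.
apply: inv_combination_sum => j _; apply: inv_combination_mul.
  exact: transfer_inv.
exact: (inv_combination_mem (fun j => f j ^+ k.+1)).
Qed.

End TopDegree.

(** * Generic linear forms and a generic modulus *)

Section GenericForms.

Lemma det_rows_sum (C : comNzRingType) n m (c : 'I_n -> 'I_m -> C) (a : 'I_n -> 'I_m -> 'I_n -> C) :
  \det (\matrix_(i < n, l < n) \sum_j c i j * a i j l) =
  \sum_(j : {ffun 'I_n -> 'I_m}) (\prod_i c i (j i)) * \det (\matrix_(i, l) a i (j i) l).
Proof.
rewrite /determinant.
under eq_bigr => s _.
  under eq_bigr => i _ do rewrite mxE.
  rewrite bigA_distr_bigA /= mulr_sumr.
  over.
rewrite exchange_big; apply: eq_bigr => j _; rewrite mulr_sumr; apply: eq_bigr => s _.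
rewrite big_split /= mulrCA; congr (_ * (_ * _)).
by apply: eq_bigr => i _; rewrite mxE.
Qed.

Lemma digits_inj n k (a b : nat -> nat) :
  (forall i, (i < k)%N -> (a i < n)%N) -> (forall i, (i < k)%N -> (b i < n)%N) ->
  (\sum_(i < k) a i * n ^ i = \sum_(i < k) b i * n ^ i)%N ->
  forall i, (i < k)%N -> a i = b i.
Proof.
elim: k a b => // k IH a b an bn; rewrite !big_ord_recl /= !muln1.
have split (c : nat -> nat) : (\sum_(i < k) c (bump 0 i) * n ^ bump 0 i =
    (\sum_(i < k) c i.+1 * n ^ i) * n)%N.
  by rewrite big_distrl; apply: eq_bigr => i _; rewrite /bump /= add1n expnSr mulnA.
rewrite !split => e.
have n0 : (0 < n)%N by apply: leq_ltn_trans (an 0%N isT).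
have a0 : a 0%N = b 0%N.
  have := congr1 (modn^~ n) e.
  by rewrite ![(_ 0 + _)%N]addnC !modnMDl !modn_small ?an ?bn.
move: e; rewrite a0 => /addnI /eqP; rewrite eqn_pmul2r // => /eqP e [|i] ik //.
by apply: (IH (fun i => a i.+1) (fun i => b i.+1)) => // j jk; [apply: an|apply: bn].
Qed.

Variables (R : idomainType) (n : nat).

(** Row vectors [(X^(j * n^i))_j]: their exponents read the sequence of the
    chosen coordinates as the digits of a number in base [n], so that no
    cancellation can occur in a multilinear expression of the [n] vectors. *)
Definition generic_row (i : 'I_n) : 'rV[{poly R}]_n := \row_j 'X^(j * n ^ i).

(** The coefficients are the determinants [phi j] of rows of the [t i].  They
    are not all in [m], because the unit rows are combinations of the rows of
    the [t i]. *)
Lemma generic_det (m : R -> Prop) (t : 'I_n -> 'M[R]_n) : is_ideal m -> ~ m 1 ->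
  (forall i, t i \in unitmx) ->
  ~ poly_ideal m (\det (rows (fun i => generic_row i *m map_mx polyC (t i)))).
Proof.
move=> im nm1 ut.
pose phi (j : {ffun 'I_n -> 'I_n}) := \det (\matrix_(i, l) t i (j i) l).
have [j nphi] : exists j, ~ m (phi j).
  apply: boolp.contrapT => no; apply: nm1.
  have -> : 1 = \sum_(j : {ffun 'I_n -> 'I_n}) (\prod_i invmx (t i) i (j i)) * phi j.
    rewrite -(det_rows_sum (fun i k => invmx (t i) i k) (fun i k l => t i k l)) -(det1 R n); congr (\det _); apply/matrixP => i l.
    rewrite !mxE; have := congr1 (fun M : 'M_n => M i l) (mulVmx (ut i)).
    by rewrite !mxE => <-.
  apply: ideal_sum => // j _; apply: ideal_mull => //; apply: boolp.contrapT => h.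
  by apply: no; exists j.
pose ex (j : {ffun 'I_n -> 'I_n}) := (\sum_i j i * n ^ i)%N.
move/(_ (ex j)); suff -> : (\det (rows (fun i => generic_row i *m map_mx polyC (t i))))`_(ex j)
    = phi j by [].
have -> : rows (fun i => generic_row i *m map_mx polyC (t i)) =
    \matrix_(i < n, l < n) \sum_(k < n) 'X^(k * n ^ i) * (t i k l)%:P.
  by apply/matrixP => i l; rewrite !mxE; apply: eq_bigr => k _; rewrite !mxE.
rewrite (det_rows_sum (fun (i k : 'I_n) => 'X^(k * n ^ i)) (fun i k l => (t i k l)%:P)) coef_sum (bigD1 j) //=.
rewrite [X in _ + X]big1 ?addr0.
  have -> : \matrix_(i, l) (t i (j i) l)%:P = map_mx polyC (\matrix_(i, l) t i (j i) l).
    by apply/matrixP => i l; rewrite !mxE.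
  by rewrite det_map_mx /= prodrXr coefXnM ltnn subnn coefC.
move=> j' jj'; have -> : \matrix_(i, l) (t i (j' i) l)%:P = map_mx polyC (\matrix_(i, l) t i (j' i) l).
  by apply/matrixP => i l; rewrite !mxE.
rewrite det_map_mx /= prodrXr coefXnM; case: ltnP => // le; rewrite coefC subn_eq0.
case: leqP => // ge; case/eqP: jj'.
have e : ex j' = ex j by apply/eqP; rewrite eqn_leq le ge.
apply/ffunP => i; apply: val_inj.
pose dig (j : {ffun 'I_n -> 'I_n}) (i : nat) := if insub i is Some i' then (j i' : nat) else 0%N.
have digE (j0 : {ffun 'I_n -> 'I_n}) (i0 : 'I_n) : dig j0 i0 = j0 i0 by rewrite /dig valK.
rewrite /= -!digE; apply: (@digits_inj n n) => //.
- by move=> k kn; rewrite -[k]/(val (Ordinal kn)) digE.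
- by move=> k kn; rewrite -[k]/(val (Ordinal kn)) digE.
by rewrite -[LHS]/(_) (eq_bigr (fun i => j' i * n ^ i)%N) => [|k _]; [rewrite -/(ex j') e; apply: eq_bigr => k _; rewrite digE|rewrite digE].
Qed.

Lemma generic_inj : injective (fun t : 'M[R]_n => (\row_j 'X^j : 'rV_n) *m map_mx polyC t).
Proof.
have cf t (j l : 'I_n) : (((\row_j 'X^j : 'rV[{poly R}]_n) *m map_mx polyC t) 0 l)`_j = t j l.
  rewrite !mxE coef_sum (bigD1 j) //= !mxE coefXnM ltnn subnn coefC big1 ?addr0 //.
  move=> k kj; rewrite !mxE coefXnM coefC; case: ltnP => // jk; rewrite subn_eq0.
  by case: leqP => // kj'; case/eqP: kj; apply/val_inj/eqP; rewrite eqn_leq kj' jk.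
by move=> s t e; apply/matrixP => j l; rewrite -!cf e.
Qed.

End GenericForms.

Section GenericQuotient.
Variables (R : idomainType) (m : R -> Prop).
Hypothesis maxm : maximal_ideal m.
Let pm : prime_ideal m := maximal_prime maxm.
Let im : is_ideal m := prime_is_ideal pm.
Let imX : is_ideal (poly_ideal m) := poly_ideal_ideal im.
Implicit Types p q h D rho : {poly R}.

(** [d] is the degree of [p] over the residue field [R / m]. *)
Definition top_index p d := ~ m p`_d /\ forall i, (d < i)%N -> m p`_i.

Lemma exists_top p : ~ poly_ideal m p -> exists d, top_index p d.
Proof.
move=> np.
have exi : exists i, ~~ boolp.asbool (m p`_i).
  apply: boolp.contrapT => no; apply: np => i; apply/boolp.asboolP.
  by apply/negPn/negP => h; apply: no; exists i.
have ub i : ~~ boolp.asbool (m p`_i) -> (i <= size p)%N.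
  apply: contraR; rewrite -ltnNge => /ltnW si; apply/boolp.asboolP.
  by rewrite nth_default //; apply: ideal_zero.
exists (ex_maxn exi ub); case: ex_maxnP => d /negP nd maxd; split.
  by move=> md; apply: nd; apply/boolp.asboolP.
move=> i di; apply/boolp.asboolP/negPn/negP => h.
by move: (maxd _ h); rewrite leqNgt di.
Qed.

Lemma top_mul p q d e : top_index p d -> top_index q e -> ~ m (p * q)`_(d + e).
Proof.
move=> [npd hp] [nqe hq] mpq.
have di : (d < (d + e).+1)%N by rewrite ltnS leq_addr.
move: mpq; rewrite coefM (bigD1 (Ordinal di)) //= addKn => msum.
suff /(prime_mul pm) [] : m (p`_d * q`_e) by [].
rewrite -(addrK (\sum_(k < (d + e).+1 | k != Ordinal di) p`_k * q`_(d + e - k)) (p`_d * q`_e)).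
apply: ideal_sub => //; apply: ideal_sum => // k.
rewrite -val_eqE /= neq_ltn => /orP [kd|dk].
  by apply: ideal_mull => //; apply: hq; rewrite ltn_subRL ltn_add2r.
by apply: ideal_mulr => //; apply: hp.
Qed.

(** Euclid's argument: over the residue field, [N] is generated by an
    irreducible factor of [1 + X D]. *)
Lemma exists_maximal_avoiding D : ~ poly_ideal m D ->
  exists N : {poly R} -> Prop, [/\ maximal_ideal N, forall p, poly_ideal m p -> N p,
    ~ N D & exists2 p, N p & ~ poly_ideal m p].
Proof.
move=> nD; have [d [nd hd]] := exists_top nD.
have topP : top_index (1 + 'X * D) d.+1.
  split=> [|[|i] //]; first by rewrite coefD coefC coefXM /= add0r.
  by rewrite coefD coefC coefXM /= add0r ltnS; apply: hd.
have [||N [maxN JN]] := @exists_maximal_ideal _ (add_gen (poly_ideal m) (1 + 'X * D)).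
- exact: add_gen_ideal.
- move=> [c hc]; have nc : ~ poly_ideal m c.
    move=> mc; apply: (prime_not1 pm).
    have := ideal_add imX hc (ideal_mulr (1 + 'X * D) imX mc).
    by rewrite subrK => /(_ 0%N); rewrite coefC.
  have [e topc] := exists_top nc.
  apply: (top_mul topc topP); have := hc (e + d.+1)%N.
  rewrite coefB coefC addnS /= sub0r => /(ideal_opp im); by rewrite opprK.
have NP : N (1 + 'X * D) by apply: JN; apply: add_gen_mem.
exists N; split=> //.
- by move=> p mp; apply: JN; apply: add_gen_sub.
- move=> ND; have [iN nN1 _] := maxN; apply: nN1.
  by rewrite -(addrK ('X * D) 1); apply: ideal_sub => //; apply: ideal_mull.
- by exists (1 + 'X * D) => // /(_ d.+1); case: topP.
Qed.

(** Division with remainder by a polynomial of [N] whose degree modulo [m] is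
    minimal, normalized to be monic. *)
Lemma exists_monic_generator (N : {poly R} -> Prop) :
  maximal_ideal N -> (forall p, poly_ideal m p -> N p) ->
  (exists2 p, N p & ~ poly_ideal m p) ->
  exists h, [/\ h \is monic, (1 < size h)%N, N h &
    forall p, N p -> exists q, poly_ideal m (p - q * h)].
Proof.
move=> maxN mN exp; have [iN nN1 _] := maxN.
have exd : exists d, boolp.asbool (exists2 p, N p & top_index p d).
  have [p Np /exists_top [d td]] := exp.
  by exists d; apply/boolp.asboolP; exists p.
case: (ex_minnP exd) => d /boolp.asboolP [p Np [npd hp]] mind.
have [l ml] := maximal_inv maxm npd.
pose r := \poly_(i < d) (l * p`_i).
have sr : (size r <= d)%N by apply: size_poly.
pose h := 'X^d + r.
have sh : size h = d.+1.
  by rewrite size_polyDl size_polyXn // ltnS.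
have monh : h \is monic.
  rewrite monicE lead_coefE sh /= coefD coefXn eqxx nth_default ?addr0 //.
have Nh : N h.
  apply: (@ideal_eqr _ N h (l%:P * p)) => //; last exact: ideal_mull.
  apply: mN => i; rewrite coefB coefD coefXn coefCM coef_poly.
  case: ltngtP => [id|di|->].
  - by rewrite add0r subrr; apply: ideal_zero.
  - by rewrite add0r sub0r; apply: ideal_opp => //; apply: ideal_mull => //; apply: hp.
  - by rewrite addr0; apply: ideal_subC.
exists h; split=> //.
  rewrite sh ltnS lt0n; apply/negP => /eqP d0; apply: nN1.
  have -> : 1 = h; last by [].
  rewrite /h; move: sr; rewrite d0 leqn0 size_poly_eq0 => /eqP ->.
  by rewrite expr0 addr0.
move=> q Nq; exists (Pdiv.Ring.rdivp q h); apply: boolp.contrapT => nq.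
have e := Pdiv.RingMonic.rdivp_eq monh q.
have eq : q - Pdiv.Ring.rdivp q h * h = Pdiv.Ring.rmodp q h by rewrite {1}e addrC addKr.
have [k [nk hk]] := exists_top nq.
have : (d <= k)%N.
  apply: mind; apply/boolp.asboolP; exists (q - Pdiv.Ring.rdivp q h * h); last by split.
  by apply: ideal_sub => //; apply: ideal_mull.
rewrite leqNgt => /negP; apply; rewrite ltnNge; apply/negP => dk; apply: nk.
rewrite eq nth_default; first exact: ideal_zero.
apply: leq_trans dk; rewrite -ltnS -sh.
by apply: Pdiv.Ring.ltn_rmodpN0; apply: monic_neq0.
Qed.

(** The remainders of the powers of [h] modulo [rho] are linearly dependent;
    pseudo-division only introduces powers of the leading coefficient. *)
Lemma vanishes_modulo h rho : rho != 0 ->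
  exists q : {poly R}, q != 0 /\ exists a, (map_poly polyC q).[h] = a * rho.
Proof.
move=> rho0; pose N := (size rho).-1.
have sN : size rho = N.+1 by rewrite prednK // size_poly_gt0.
have [||v [[i0 i0N vi0] v0]] := @linear_dependence R _ _
    (fun i j => (h ^+ i %% rho)`_j) (iota 0 N) (iota 0 N.+1).
- exact: iota_uniq.
- by rewrite !size_iota.
pose l := lead_coef rho; pose e i := scalp (h ^+ i) rho.
have l0 : l != 0 by rewrite lead_coef_eq0.
exists (\poly_(i < N.+1) (v i * l ^+ e i)); split.
  apply/eqP => /polyP /(_ i0); rewrite coef0 coef_poly; move: i0N.
  rewrite mem_iota add0n /= => -> /eqP; apply/negP.
  by rewrite mulf_neq0 // expf_neq0.
exists (\sum_(i < N.+1) v i *: (h ^+ i %/ rho)).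
rewrite mulr_suml (@horner_coef_wide _ N.+1); last first.
  by apply: leq_trans (size_poly _ _) (size_poly _ _).
transitivity (\sum_(i < N.+1) v i *: (h ^+ i %/ rho * rho + h ^+ i %% rho)).
  apply: eq_bigr => i _; rewrite coef_map coef_poly ltn_ord /=.
  rewrite mul_polyC -scalerA; congr (_ *: _); exact: Pdiv.Idomain.divp_eq.
under eq_bigr => i _ do rewrite scalerDr.
rewrite big_split /= [X in _ + X](_ : _ = 0) ?addr0.
  by apply: eq_bigr => i _; rewrite scalerAl.
apply/polyP => j; rewrite coef0 coef_sum; have [jN|Nj] := ltnP j N.
  rewrite -[RHS](v0 j) ?mem_iota //.
  by rewrite -[RHS]/(\sum_(0 <= i < N.+1) _) big_mkord; apply: eq_bigr => i _; rewrite coefZ.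
rewrite big1 // => i _; rewrite coefZ nth_default ?mulr0 //.
apply: leq_trans Nj; have : (size (h ^+ i %% rho)%R < size rho)%N by rewrite ltn_modp.
by rewrite sN ltnS.
Qed.

(** If [m] is not zero, adding to [h] different elements of [m] does not change
    it modulo [m] and yields polynomials that are pairwise prime to each other
    over the fraction field, so one of them is prime to [rho].  If [m] is zero,
    [rho] can be avoided in the same way as [D]. *)
Lemma exists_good_modulus D rho : ~ poly_ideal m D -> rho != 0 ->
  exists h, [/\ h \is monic, (1 < size h)%N,
    forall p, (exists q, poly_ideal m (p - q * h)) \/
              exists q c, poly_ideal m (p * q - 1 - c * h),
    exists q c, poly_ideal m (D * q - 1 - c * h)
    & exists r a c, r != 0 /\ r%:P = a * rho + c * h].
Proof.
move=> nD rho0.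
have key D' : ~ poly_ideal m D' -> exists h, [/\ h \is monic, (1 < size h)%N,
    forall p, (exists q, poly_ideal m (p - q * h)) \/
              exists q c, poly_ideal m (p * q - 1 - c * h)
    & exists q c, poly_ideal m (D' * q - 1 - c * h)].
  move=> /exists_maximal_avoiding [N [maxN mN ND exN]].
  have [h [monh sh Nh gen]] := exists_monic_generator maxN mN exN.
  have inv p : ~ N p -> exists q c, poly_ideal m (p * q - 1 - c * h).
    by move=> /(maximal_inv maxN) [q /gen [c]]; rewrite mulrC; exists q, c.
  exists h; split=> //; last exact: inv.
  by move=> p; have [/gen|/inv] := boolp.EM (N p); [left|right].
have [[mu mmu mu0]|m0] := boolp.EM (exists2 mu, m mu & mu != 0).
  have [h [monh sh inv invD]] := key D nD.
  have [q [q0 [a qa]]] := vanishes_modulo h rho0.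
  have [k qk] : exists k, q.[- mu ^+ k.+1] != 0.
    apply: boolp.contrapT => no.
    pose rs := [seq - mu ^+ k.+1 | k <- iota 0 (size q)].
    have : (size rs < size q)%N.
      apply: max_poly_roots => //.
        apply/allP => x /mapP [k _ ->]; apply/negPn/negP => h0.
        by apply: no; exists k.
      rewrite map_inj_uniq ?iota_uniq // => k l /oppr_inj.
      wlog kl : k l / (k <= l)%N => [W e|e].
        by case/orP: (leq_total k l) => kl; [|symmetry]; apply: W.
      have : mu ^+ k.+1 * (mu ^+ (l - k) - 1) = 0.
        by rewrite mulrBr mulr1 -exprD addSn subnKC // e subrr.
      move/eqP; rewrite mulf_eq0 expf_eq0 (negbTE mu0) andbF /= subr_eq0.
      move/eqP => e1; have [/eqP|lk] := posnP (l - k)%N.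
        by rewrite subn_eq0 => lk; apply/eqP; rewrite eqn_leq kl.
      by case: (prime_not1 pm); rewrite -e1; apply: ideal_exp.
    by rewrite size_map size_iota ltnn.
  pose t := mu ^+ k.+1; have mt : m t by apply: ideal_exp.
  have mtX p : poly_ideal m (p * t%:P).
    by move=> i; rewrite coefMC; apply: ideal_mull.
  have st : (size (t%:P : {poly R}) < size h)%N.
    by apply: leq_ltn_trans (size_polyC_leq1 t) sh.
  have change p c : poly_ideal m (p - c * h) -> poly_ideal m (p - c * (h + t%:P)).
    move=> hp; have -> : p - c * (h + t%:P) = (p - c * h) - c * t%:P by ring.
    exact: (ideal_sub imX hp (mtX c)).
  exists (h + t%:P); split.
  - by rewrite monicE lead_coefDl // (monicP monh).
  - by rewrite size_polyDl.
  - move=> p; case: (inv p) => [[c hc]|[c [c' hc]]]; [left|right].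
      by exists c; apply: change.
    by exists c, c'; apply: change.
  - by have [c [c' hc]] := invD; exists c, c'; apply: change.
  pose P := map_poly polyC q.
  have [c ec] : exists c, P.[h] - P.[- t%:P] = c * (h + t%:P).
    exists (\sum_(i < size P) P`_i * \sum_(j < i) h ^+ (i.-1 - j) * (- t%:P) ^+ j).
    rewrite !horner_coef -sumrB mulr_suml; apply: eq_bigr => i _.
    by rewrite -mulrBr subrXX opprK -mulrA [X in _ = _ * X]mulrC.
  exists q.[- t], a, (- c); split=> //.
  rewrite -qa mulNr -ec -/P.
  have -> : P.[- t%:P] = q.[- t]%:P by rewrite -polyCN /P horner_map.
  by ring.
have nDr : ~ poly_ideal m (D * rho).
  move=> /(prime_mul (poly_ideal_prime pm)) [//|mrho]; case/eqP: rho0.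
  apply/polyP => i; rewrite coef0; apply/eqP/negPn/negP => nz.
  by apply: m0; exists rho`_i.
have [h [monh sh inv [q [c hc]]]] := key _ nDr.
exists h; split=> //; first by exists (rho * q), c; rewrite mulrA.
exists 1, (D * q), (- c); split; first exact: oner_neq0.
have : D * rho * q - 1 - c * h = 0.
  apply/polyP => i; rewrite coef0; apply/eqP/negPn/negP => nz.
  by apply: m0; exists (D * rho * q - 1 - c * h)`_i.
move=> e; rewrite -[LHS]addr0 -e; ring.
Qed.

End GenericQuotient.

(** * Invariants with coefficients in a polynomial ring *)

Lemma poly_rmorph_ext (A Z : comNzRingType) (u v : {rmorphism {poly A} -> Z}) :
  (forall c, u c%:P = v c%:P) -> u 'X = v 'X -> u =1 v.
Proof.
move=> uvC uvX p; rewrite -[p]coefK poly_def !rmorph_sum; apply: eq_bigr => i _.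
by rewrite -mul_polyC !rmorphM !rmorphXn uvC uvX.
Qed.

Section Bridge.
Variables (R : idomainType) (n : nat) (G : {fset 'M[R]_n}).
Hypothesis hG : subgroup_GL G.
Local Notation S := {mpoly R[n]}.
Local Notation C := {poly R}.
Local Notation CX := {mpoly C[n]}.
Local Notation B := (invariant_ring G).

(** The two ways [S[X]] and [R[X][x_1, .., x_n]] of reading the same
    polynomials: the group and the grading live on the second one, the chains
    of primes over [B[X]] start from the first one. *)
Definition collect : {poly S} -> CX :=
  horner_eval ('X%:MP : CX) \o map_poly (map_mpoly polyC).
HB.instance Definition _ := GRing.RMorphism.copy collect
  (horner_eval ('X%:MP : CX) \o map_poly (map_mpoly polyC)).
Definition spread : CX -> {poly S} :=
  mmap (map_poly (@mpolyC n R)) (fun i => ('X_i)%:P).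
HB.instance Definition _ := GRing.RMorphism.copy spread
  (mmap (map_poly (@mpolyC n R)) (fun i => ('X_i)%:P)).

Lemma spreadC c : spread c%:MP = map_poly (@mpolyC n R) c.
Proof. by rewrite /spread mmapC. Qed.
Lemma spreadX i : spread 'X_i = ('X_i)%:P.
Proof. by rewrite /spread mmapX mmap1U. Qed.
Lemma collectC f : collect f%:P = map_mpoly polyC f.
Proof. by rewrite /collect /= /horner_eval map_polyC hornerC. Qed.
Lemma collectX : collect 'X = 'X%:MP.
Proof. by rewrite /collect /= /horner_eval map_polyX hornerX. Qed.
Lemma collect_const c : collect (map_poly (@mpolyC n R) c) = c%:MP.
Proof.
apply: (poly_rmorph_ext (u := collect \o map_poly (@mpolyC n R)) (v := @mpolyC n C)) => [a|] /=.
  by rewrite map_polyC /= collectC map_mpolyC.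
by rewrite map_polyX collectX.
Qed.

Lemma spreadK : cancel spread collect.
Proof.
apply: (mpoly_rmorph_ext (u := collect \o spread) (v := idfun)) => [c|i] /=.
  by rewrite spreadC collect_const.
by rewrite spreadX collectC map_mpolyX.
Qed.
Lemma collectK : cancel collect spread.
Proof.
apply: (poly_rmorph_ext (u := spread \o collect) (v := idfun)) => [f|] /=; last first.
  by rewrite collectX spreadC map_polyX.
rewrite collectC; apply: (mpoly_rmorph_ext (u := spread \o map_mpoly polyC) (v := polyC)) => [c|i] /=.
  by rewrite map_mpolyC spreadC map_polyC.
by rewrite map_mpolyX spreadX.
Qed.

Lemma map_invmx_polyC (s : 'M[R]_n) : s \in unitmx ->
  invmx (map_mx polyC s) = map_mx polyC (invmx s).
Proof.
move=> us; have e : map_mx polyC s *m map_mx polyC (invmx s) = 1%:M.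
  by rewrite -map_mxM mulmxV // map_mx1.
have [us' _] := mulmx1_unit e.
by apply: (can_inj (mulKmx us')); rewrite mulmxV // e.
Qed.

Lemma map_unitmx_polyC (s : 'M[R]_n) : s \in unitmx -> map_mx polyC s \in unitmx.
Proof.
move=> us; have e : map_mx polyC s *m map_mx polyC (invmx s) = 1%:M.
  by rewrite -map_mxM mulmxV // map_mx1.
by have [us' _] := mulmx1_unit e.
Qed.

Lemma spread_act s z : s \in unitmx ->
  spread (mpoly_act (map_mx polyC s) z) = map_poly (mpoly_act s) (spread z).
Proof.
move=> us; move: z; apply: (mpoly_rmorph_ext (u := spread \o mpoly_act (map_mx polyC s))
  (v := map_poly (mpoly_act s) \o spread)) => [c|i] /=.
  rewrite actC spreadC -map_poly_comp; apply: eq_map_poly => a /=; by rewrite actC.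
rewrite actX spreadX map_polyC /= actX !rmorph_sum; apply: eq_bigr => j _ /=.
rewrite map_invmx_polyC // mxE -!mul_mpolyC !rmorphM /= spreadX spreadC.
by rewrite map_polyC.
Qed.

Definition groupX : {fset 'M[C]_n} := [fset map_mx polyC s | s in G]%fset.

Lemma groupXP s : reflect (exists2 t, t \in G & s = map_mx polyC t) (s \in groupX).
Proof.
apply: (iffP idP) => [/imfsetP [t /= tG ->]|[t tG ->]]; first by exists t.
by apply/imfsetP; exists t.
Qed.

Lemma groupX_card : #|` groupX| = #|` G|.
Proof.
rewrite card_imfset // => s t /matrixP e; apply/matrixP => i j; apply: polyC_inj.
by have := e i j; rewrite !mxE.
Qed.

Lemma groupX_subgroup : subgroup_GL groupX.
Proof.
case: hG => uG oneG mulG invG; split.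
- by move=> _ /groupXP [t tG ->]; apply: map_unitmx_polyC; apply: uG.
- by apply/groupXP; exists 1%:M => //; rewrite map_mx1.
- move=> _ _ /groupXP [s sG ->] /groupXP [t tG ->]; apply/groupXP.
  by exists (s *m t); [apply: mulG|rewrite map_mxM].
- move=> _ /groupXP [s sG ->]; apply/groupXP; exists (invmx s); first exact: invG.
  by rewrite map_invmx_polyC // uG.
Qed.

Definition to_invX : {rmorphism {poly B} -> CX} := collect \o map_poly (val : B -> S).
Definition of_invX (z : CX) : {poly B} := map_poly (insubd (0 : B)) (spread z).

Lemma map_val_inj : injective (map_poly (val : B -> S)).
Proof.
move=> p q e; apply/polyP => i; apply: val_inj.
by have := congr1 (fun r : {poly S} => r`_i) e; rewrite !coef_map.
Qed.

Lemma to_invX_inj : injective to_invX.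
Proof. by move=> p q /(can_inj collectK) /map_val_inj. Qed.

Lemma spread_inv z i : z \in invariants groupX -> (spread z)`_i \in invariants G.
Proof.
move=> /invariantsP zi; apply/invariantsP => s sG.
rewrite -[in RHS](zi (map_mx polyC s)); last by apply/groupXP; exists s.
by rewrite spread_act ?coef_map //; case: hG => uG _ _ _; apply: uG.
Qed.

Lemma of_invXK z : z \in invariants groupX -> to_invX (of_invX z) = z.
Proof.
move=> zi; rewrite -[RHS]spreadK; congr (collect _).
apply/polyP => i; rewrite !coef_map /= /of_invX coef_map_id0 ?insubdK //; last first.
  by apply: val_inj; rewrite insubdK ?rpred0.
exact: spread_inv.
Qed.

Lemma to_invX_val p i : (spread (to_invX p))`_i = val p`_i.
Proof.
rewrite -[to_invX p]/(collect (map_poly (val : B -> S) p)) collectK.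
exact: (coef_map (val : {rmorphism B -> S})).
Qed.

(** The product of the [X - s y] over the group is an integral equation. *)
Lemma to_invX_integral : integralRange to_invX.
Proof.
move=> y; have hGX := groupX_subgroup.
pose Q : {poly CX} := \prod_(s <- groupX) ('X - (mpoly_act s y)%:P).
have Qi i : Q`_i \in invariants groupX.
  apply/invariantsP => t tG; rewrite -coef_map.
  suff -> : map_poly (mpoly_act t) Q = Q by [].
  rewrite /Q rmorph_prod -[RHS](perm_big _ (group_perm hGX tG)) big_map big_seq [RHS]big_seq.
  apply: eq_bigr => s sG /=; rewrite rmorphB /= map_polyX map_polyC /=.
  by rewrite actM ?(inG_unit hGX).
have of0 : of_invX 0 = 0.
  by apply: to_invX_inj; apply: etrans (of_invXK (rpred0 _)) _; rewrite rmorph0.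
pose P := map_poly of_invX Q.
have PQ : map_poly to_invX P = Q.
  by apply/polyP => i; rewrite coef_map /P coef_map_id0 //; apply: of_invXK.
have monQ : Q \is monic by apply: monic_prod => s _; apply: monicXsubC.
exists P; last first.
  rewrite PQ /Q; apply/rootP; rewrite horner_prod; apply/eqP; rewrite prodf_seq_eq0.
  apply/hasP; exists 1%:M; first by case: hGX.
  by rewrite /= hornerXsubC act1 subrr.
apply/eqP; apply: to_invX_inj.
rewrite rmorph1 -(lead_coef_map_inj to_invX_inj (rmorph0 _)) PQ.
exact/monicP.
Qed.

Lemma spread_homog d z i : homogeneous_of d z -> homogeneous_of d (spread z)`_i.
Proof.
move=> hz; rewrite [z]mpolyE rmorph_sum coef_sum big_seq; apply: homog_sum => m mz.
rewrite -(msupp_homog hz mz) -mul_mpolyC rmorphM /= spreadC.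
have -> : spread 'X_[m] = ('X_[m])%:P.
  rewrite [in RHS]mpolyXE_id (rmorph_prod (@polyC S)) /spread mmapX.
  by apply: eq_bigr => k _; rewrite (rmorphXn (@polyC S)).
rewrite coefMC coef_map /= mul_mpolyC; apply: homogZ; exact: homog_mnm.
Qed.

Lemma const_invariant (r : R) : r%:MP \in invariants G.
Proof. by apply/invariantsP => s _; rewrite actC. Qed.
Definition const_inv (r : R) : B := InvariantRing (const_invariant r).
Lemma const_inv_zmod : zmod_morphism const_inv.
Proof. by move=> r s; apply: val_inj; rewrite /= mpolyCB. Qed.
Lemma const_inv_monoid : monoid_morphism const_inv.
Proof. by split=> [|r s]; apply: val_inj; rewrite /= ?mpolyCM. Qed.
HB.instance Definition _ := GRing.isZmodMorphism.Build R B const_inv const_inv_zmod.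
HB.instance Definition _ := GRing.isMonoidMorphism.Build R B const_inv const_inv_monoid.

Lemma to_invX_const (p : {poly R}) : to_invX (map_poly const_inv p) = p%:MP.
Proof.
rewrite -[RHS]collect_const; congr (collect _); apply/polyP => i.
by rewrite (coef_map (val : {rmorphism B -> S})) !coef_map.
Qed.
Lemma to_invX_C (b : B) : to_invX b%:P = map_mpoly polyC (val b).
Proof.
rewrite -collectC -[to_invX _]/(collect (map_poly (val : {rmorphism B -> S}) b%:P)).
by rewrite map_polyC.
Qed.
End Bridge.

(** * Dimension of the extended local ring *)

Lemma add_gens_span (A : comNzRingType) (s : seq A) :
  foldl (@add_gen A) (fun x => x = 0) s = ideal_span s.
Proof.
elim/last_ind: s => [|s y IH] /=.
  by apply/boolp.predeqP => x; split => /ideal_span_nil.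
by rewrite foldl_rcons IH ideal_span_rcons.
Qed.

Lemma loc_clear_span (B L : comNzRingType) (M : B -> Prop) (phi : {rmorphism B -> L}) cs b :
  prime_ideal M -> is_localization M phi -> ideal_span [seq phi c | c <- cs] (phi b) ->
  exists2 s, ~ M s & ideal_span cs (s * b).
Proof.
move=> pM [inv frac ker].
pose J y := exists a s, [/\ ~ M s, ideal_span cs a & y * phi s = phi a].
have iJ : is_ideal J.
  split.
  - exists 0, 1; split; rewrite ?rmorph0 ?mul0r //; first exact: prime_not1.
    exact: ideal_zero (ideal_spanP cs).
  - move=> x y [a [s [nMs sa ea]]] [a' [s' [nMs' sa' ea']]].
    exists (a * s' + a' * s), (s * s'); split.
    + by case/(prime_mul pM).
    + by apply: ideal_add (ideal_spanP cs) _ _; apply: ideal_mulr => //; apply: ideal_spanP.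
    + by rewrite rmorphD !rmorphM -ea -ea'; ring.
  - move=> c x [a [s [nMs sa ea]]]; have [a' [t [nMt et]]] := frac c.
    exists (a' * a), (t * s); split.
    + by case/(prime_mul pM).
    + exact: ideal_mull (ideal_spanP cs) sa.
    + by rewrite !rmorphM -ea -et; ring.
move=> hb; have [a [s [nMs sa e]]] : J (phi b).
  apply: ideal_span_min hb => // _ /mapP [c cc ->]; exists c, 1; split.
  - exact: prime_not1.
  - exact: ideal_span_mem.
  - by rewrite rmorph1 mulr1.
have [t nMt et] : exists2 t, ~ M t & t * (b * s) = t * a by apply: ker; rewrite rmorphM.
exists (t * s); first by case/(prime_mul pM).
by rewrite -mulrA [s * b]mulrC et; apply: ideal_mull (ideal_spanP cs) sa.
Qed.

Section Translation.
Variables (C : comNzRingType) (n : nat).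
Local Notation CX := {mpoly C[n]}.

(** The translation [x |-> x + T v], with [T] the new variable. *)
Definition translate (v : 'cV[C]_n) : CX -> {poly CX} :=
  mmap ((@polyC CX) \o (@mpolyC n C)) (fun i => ('X_i)%:P + (v i 0)%:MP%:P * 'X).
HB.instance Definition _ v := GRing.RMorphism.copy (translate v)
  (mmap ((@polyC CX) \o (@mpolyC n C)) (fun i => ('X_i)%:P + (v i 0)%:MP%:P * 'X)).

Lemma translateC v c : translate v c%:MP = c%:MP%:P.
Proof. by rewrite /translate mmapC. Qed.
Lemma translate_linform v w :
  translate v (linform w) = (linform w)%:P + ((w *m v) 0 0)%:MP%:P * 'X.
Proof.
rewrite /linform rmorph_sum /= mxE !rmorph_sum /= mulr_suml -big_split.
apply: eq_bigr => j _; rewrite -mul_mpolyC rmorphM /= translateC.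
rewrite {1}/translate mmapX mmap1U /= mulrDr -polyCM; congr (_ + _).
by rewrite mulrA -polyCM -mpolyCM.
Qed.
Lemma translate0 v z : (translate v z)`_0 = z.
Proof.
rewrite -horner_coef0; move: z.
apply: (mpoly_rmorph_ext (u := horner_eval 0 \o translate v) (v := idfun)) => [c|i] /=.
  by rewrite /horner_eval translateC hornerC.
rewrite /horner_eval /translate mmapX mmap1U.
by rewrite hornerD hornerM hornerX mulr0 addr0 hornerC.
Qed.

End Translation.

Section Dimension.
Variables (R : idomainType) (n : nat).
Local Notation C := {poly R}.
Local Notation CX := {mpoly C[n]}.

Variables (B : comNzRingType) (const : {rmorphism R -> B}).
Hypothesis const_inj : forall r, const r = 0 -> r = 0.
Hypothesis domB : forall a b : B, a * b = 0 -> a = 0 \/ b = 0.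
Variable iota : {rmorphism {poly B} -> CX}.
Hypothesis intX : integralRange iota.
Hypothesis iota_inj : forall a, iota a = 0 -> a = 0.
Hypothesis iota_const : forall p, iota (map_poly const p) = p%:MP.

Variables (M : B -> Prop) (L : comNzRingType) (phi : {rmorphism B -> L}).
Hypotheses (primeM : prime_ideal M) (locL : is_localization M phi).
Let psi : {rmorphism R -> L} := phi \o const.

Variables (E : comNzRingType) (pi : {rmorphism {poly L} -> E}) (toC : {rmorphism L -> E}).
Hypothesis piC : forall c, pi c%:P = toC c.
Hypothesis intE : integralRange toC.
Variable h : C.
Hypotheses (monh : h \is monic) (sh : (1 < size h)%N).
Hypothesis pih : pi (map_poly psi h) = 0.

Variable forms : 'I_n -> seq 'rV[C]_n.
Hypothesis forms_ne : forall j, exists w, w \in forms j.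
Hypothesis det_notin : forall w, (forall i, w i \in forms i) ->
  forall P : E -> Prop, prime_ideal P -> ~ P (pi (map_poly psi (\det (rows w)))).
Variable fB : 'I_n -> {poly B}.
Hypothesis fB_forms : forall j, iota (fB j) = lprod (forms j).

Definition image_form (j : 'I_n) : E := pi (map_poly phi (fB j)).
Local Notation F := image_form.

(** Each linear form of a basis that a prime contains can be traded for one
    more step down: translation along the dual vector fixes the other forms. *)
Lemma descend (w : 'I_n -> 'rV[C]_n) js (Q : CX -> Prop) (p : L -> Prop) e :
  uniq js -> prime_ideal Q -> Q (h%:MP) -> ~ Q ((\det (rows w))%:MP) ->
  (forall j, j \in js -> Q (linform (w j))) ->
  up e p -> comap phi p = comap (iota \o polyC) Q ->
  exists p' Q', [/\ up (e + size js) p', comap phi p' = comap (iota \o polyC) Q',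
     prime_ideal Q' & forall c, Q c%:MP -> Q' c%:MP].
Proof.
elim: js Q p e => [|j js IH] Q p e /=.
  by move=> _ pQ _ _ _ upp ep; exists p, Q; rewrite addn0.
move=> /andP [jjs ujs] pQ Qh nQdet Qforms upp ep.
pose v : 'cV[C]_n := col j (\adj (rows w)).
have wv i : (w i *m v) 0 0 = \det (rows w) *+ (i == j).
  have := congr1 (fun N : 'M_n => N i j) (mul_mx_adj (rows w)).
  rewrite /= [X in _ = X -> _]mxE => <-; rewrite !mxE; apply: eq_bigr => k _.
  by rewrite /v !mxE.
have iQ := prime_is_ideal pQ.
pose Q1 := shrink (translate v) Q.
have pQ1 : prime_ideal Q1 by apply: shrink_prime.
have Q1Q z : Q1 z -> Q z by move=> /(_ 0%N); rewrite translate0.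
have Q1C c : Q c%:MP -> Q1 c%:MP.
  by move=> Qc i; rewrite translateC coefC; case: eqP => // _; apply: ideal_zero.
have [p1 [up1 ep1]] : exists p1, up e.+1 p1 /\
    comap phi p1 = comap (iota \o polyC) Q1.
  apply: (@prepend_prime B L _ M phi primeM locL iota intX (map_poly const h) _ _ Q1 Q p e) => //.
  - exact: monic_map.
  - by rewrite size_map_poly_id0 // (monicP monh) rmorph1 oner_neq0.
  - exists (linform (w j)); first by apply: Qforms; rewrite inE eqxx.
    move=> /(_ 1%N); rewrite translate_linform wv eqxx mulr1n coefD coefC coefMX coefC /=.
    by rewrite add0r.
  - by rewrite iota_const; apply: Q1C.
have [||p' [Q' [up' ep' pQ' Q1Q']]] := IH Q1 p1 e.+1 ujs pQ1 (Q1C _ Qh) _ _ up1 ep1.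
- by move=> /Q1Q.
- move=> k kjs i; rewrite translate_linform wv.
  have -> : (k == j) = false by apply: contraNF jjs => /eqP <-.
  rewrite mulr0n mpolyC0 mul0r addr0 coefC; case: eqP => _; last exact: ideal_zero.
  by apply: Qforms; rewrite inE kjs orbT.
exists p', Q'; split=> //; first by rewrite addnS -addSn.
by move=> c Qc; apply: Q1Q'; apply: Q1C.
Qed.

Variable d : nat.
Hypothesis dimL : forall e (P : 'I_e.+1 -> L -> Prop), prime_chain P -> (e <= d)%N.

(** The chain contracts to [L], since [E] is integral over [L].  The trace of
    [P] on [B[X]] lifts to a prime [Q] of [CX], which contains a factor of each
    of the given products of linear forms, so that [descend] prolongs the chain
    downwards.  A constant in [P] is still there at the end, and then the zero
    ideal lies below. *)
Lemma dimension_bound js (P : E -> Prop) e : uniq js -> prime_ideal P ->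
  (forall j, j \in js -> P (F j)) -> up e P ->
  (e + size js <= d)%N /\
  forall r, r != 0 -> P (toC (psi r)) -> (e + size js < d)%N.
Proof.
move=> ujs pP PF upP.
pose p := comap toC P.
have upp : up e p by apply: up_comap_integral upP.
have iP := prime_is_ideal pP.
have [Q [pQ eQ]] : exists Q : CX -> Prop, prime_ideal Q /\
    comap iota Q = comap (pi \o map_poly phi) P.
  apply: (lying_over intX); first exact: comap_prime.
  move=> a /iota_inj ->; by rewrite /comap rmorph0; apply: ideal_zero.
have eQ' a : Q (iota a) <-> P (pi (map_poly phi a)).
  by rewrite -[Q _]/(comap iota Q a) eQ.
have QC c : Q c%:MP <-> P (pi (map_poly psi c)).
  by rewrite -iota_const eQ' -map_poly_comp.
have Qh : Q h%:MP.
  by apply/QC; rewrite pih; apply: ideal_zero.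
have ep : comap phi p = comap (iota \o polyC) Q.
  by apply/boolp.predeqP => b; rewrite /comap /= eQ' map_polyC piC.
have wexists j : exists w, w \in forms j /\ (j \in js -> Q (linform w)).
  have [jjs|njs] := boolP (j \in js); last first.
    by have [w wj] := forms_ne j; exists w.
  have : Q (lprod (forms j)) by rewrite -fB_forms; apply/eQ'; apply: PF.
  by move=> /(prime_prod pQ) [w wj Qw]; exists w.
have [w wP] := boolp.choice wexists.
have nQdet : ~ Q (\det (rows w))%:MP.
  by move=> /QC; apply: det_notin => // i; case: (wP i).
have [|p' [Q' [up' ep' pQ' QQ']]] := @descend w js Q p e ujs pQ Qh nQdet _ upp ep.
  by move=> j jjs; case: (wP j) => _; apply.
split; first by have [Ps chain] := up_chain up'; apply: dimL chain.
move=> r r0 Pr.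
have p'r : comap phi p' (const r).
  rewrite ep' /comap /=.
  have -> : (const r)%:P = map_poly const r%:P by rewrite map_polyC.
  by rewrite iota_const; apply: QQ'; apply/QC; rewrite map_polyC piC.
have pz : prime_ideal (fun b : B => b = 0).
  split; [exact: zero_ideal|by move/eqP; rewrite oner_eq0|exact: domB].
have pp' := up_prime up'.
have [||p'' [pp'' _ sub strict]] := loc_lift_prime primeM locL pp' pz.
- by move=> a ->; rewrite /comap rmorph0; apply: ideal_zero; apply: prime_is_ideal.
- by exists (const r) => // /const_inj /eqP; rewrite (negbTE r0).
have up'' : up (e + size js).+1 p'' by split=> //; exists p'.
by have [Ps chain] := up_chain up''; apply: dimL chain.
Qed.

Variable ME : E -> Prop.
Hypotheses (noethE : noetherian E) (locE : local_ring ME).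
Variable sE : seq E.
Hypotheses (regE : regular_on ME (fun x => x = 0) sE) (size_sE : size sE = d).

Let powers (e : 'I_n -> nat) js := [seq F j ^+ e j | j <- js].

(** Units need no argument: [E] is local, and a sequence with entries outside
    [ME] spans everything. *)
Lemma regular_forms (e : 'I_n -> nat) js y : uniq js -> (forall j, (0 < e j)%N) ->
  (forall P k, prime_ideal P -> (forall j, j \in js -> P (F j)) -> P y -> up k P ->
     (k + (size js).+1 <= d)%N) ->
  nzd (ideal_span (powers e js)) y.
Proof.
move=> ujs e0 bound; have [mME _] := locE.
have inME z : (exists c, c * z = 1) \/ ME z.
  have [Mz|/(local_unit locE) u] := boolp.EM (ME z); [by right|by left].
have [[c cy]|My] := inME y.
  move=> b hb; rewrite -[b]mul1r -cy -mulrA; apply: ideal_mull hb.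
  exact: ideal_spanP.
have spanT z : z \in powers e js -> (exists c, c * z = 1) ->
    nzd (ideal_span (powers e js)) y.
  move=> zin [c cz] b _; rewrite -[b]mul1r -cz mulrAC.
  by apply: ideal_mull; [exact: ideal_spanP|exact: ideal_span_mem].
have [[j jjs hj]|allM] := boolp.EM (exists2 j, j \in js & ~ ME (F j ^+ e j)).
  apply: (spanT (F j ^+ e j)); first exact: map_f.
  by case: (inME (F j ^+ e j)).
have reg : regular_on ME (fun x => x = 0) (rcons (powers e js) y).
  apply: (regular_of_dimension noethE locE (zero_ideal E) _ regE).
  - by move=> a ->; apply: ideal_zero; case: mME.
  - move=> z; rewrite mem_rcons inE => /orP [/eqP -> //|/mapP [j jjs ->]].
    by apply: boolp.contrapT => nM; apply: allM; exists j.
  move=> i; rewrite size_rcons size_map ltnS => ile P pP _ Pys k upk.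
  rewrite size_sE; move: Pys; rewrite -cats1 take_cat size_map.
  have Pj (l : seq 'I_n) : (forall z, z \in powers e l -> P z) -> forall j, j \in l -> P (F j).
    by move=> h0 j jl; apply: (prime_exp pP); apply: h0; apply: map_f.
  case: ltnP => [ilt|ige] Pys.
    have PF z : z \in take i.+1 js -> P (F z).
      by apply: Pj => y'; rewrite /powers map_take; apply: Pys.
    have [+ _] := dimension_bound (take_uniq i.+1 ujs) pP PF upk.
    by rewrite size_takel // ltnW.
  have ei : i = size js \/ i.+1 = size js.
    by case: (ltngtP i (size js)) ile => // [il _|]; [right; apply/eqP; rewrite eqn_leq il|left].
  case: ei => ei.
    rewrite ei; apply: (bound P) => //.
      by apply: Pj => z zin; apply: Pys; rewrite mem_cat zin.
    by apply: Pys; rewrite ei subSnn /= mem_cat inE eqxx orbT.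
  rewrite ei; apply: (proj1 (dimension_bound ujs pP _ upk)).
  by apply: Pj => z zin; apply: Pys; rewrite mem_cat zin.
move: reg; rewrite -cats1 => /regular_on_cat /=; rewrite add_gens_span.
by case.
Qed.

Lemma ideal_span_subset (s t : seq E) a : {subset s <= t} -> ideal_span s a -> ideal_span t a.
Proof.
move=> st; apply: ideal_span_min; first exact: ideal_spanP.
by move=> x xs; apply: ideal_span_mem; apply: st.
Qed.

(** Powers of the [F j] form regular sequences in any order, so the exponents
    in a relation modulo powers can be lowered one after the other. *)
Lemma lower_exponents js (e : 'I_n -> nat) k x : uniq js -> (forall j, (0 < e j)%N) ->
  (forall j, j \in js -> e j = k.+1) ->
  ideal_span (powers e (enum 'I_n)) ((\prod_(j <- js) F j ^+ k) * x) ->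
  exists e', (forall j, (0 < e' j)%N) /\ ideal_span (powers e' (enum 'I_n)) x.
Proof.
elim: js e x => [|i js IH] e x; first by rewrite big_nil mul1r; exists e.
move=> /= /andP [ijs ujs] e0 ek; rewrite big_cons -mulrA.
set y := (\prod_(j <- js) _ * x).
pose rest := rem i (enum 'I_n).
have urest : uniq rest by apply: rem_uniq; apply: enum_uniq.
have irest : i \notin rest by rewrite mem_rem_uniq ?enum_uniq // inE eqxx.
have pe : perm_eq (enum 'I_n) (i :: rest) by apply: perm_to_rem; rewrite mem_enum.
have iJ := ideal_spanP (powers e rest).
move=> /(@ideal_span_subset _ (powers e (i :: rest))) [|].
  by move=> z /mapP [j jj ->]; apply: (map_f (fun j => F j ^+ e j)); rewrite -(perm_mem pe).
move=> c0 /= ecc; have : ideal_span (powers e (i :: rest)) (F i ^+ k * y) by exists c0.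
move=> /ideal_span_cons [c]; rewrite ek ?inE ?eqxx //.
have -> : F i ^+ k * y - c * F i ^+ k.+1 = F i ^+ k * (y - c * F i).
  by rewrite exprSr; ring.
have nz : nzd (ideal_span (powers e rest)) (F i).
  apply: regular_forms => // P l pP PF PFi upl.
  have urc : uniq (i :: rest) by rewrite /= irest.
  apply: (proj1 (@dimension_bound (i :: rest) P l urc pP _ upl)).
  by move=> j; rewrite inE => /orP [/eqP ->|/PF].
have {}nz l z : ideal_span (powers e rest) (F i ^+ l * z) -> ideal_span (powers e rest) z.
  by elim: l => [|l IHl]; rewrite ?expr0 ?mul1r // exprS -mulrA => /nz /IHl.
move=> /nz hy.
pose e1 j := if j == i then 1%N else e j.
apply: (IH e1) => //.
- by move=> j; rewrite /e1; case: eqP.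
- move=> j jjs; rewrite /e1; case: eqP => [ji|_]; first by rewrite -ji jjs in ijs.
  by apply: ek; rewrite inE jjs orbT.
apply: (@ideal_span_subset (powers e1 (i :: rest))).
  by move=> z /mapP [j jj ->]; apply: (map_f (fun j => F j ^+ e1 j)); rewrite mem_enum.
have e1i : e1 i = 1%N by rewrite /e1 eqxx.
have e1rest : powers e1 rest = powers e rest.
  apply/eq_in_map => j jr; rewrite /e1; case: eqP => // ji.
  by rewrite -ji jr in irest.
suff : ideal_span (F i ^+ e1 i :: powers e1 rest) y by [].
by rewrite e1rest e1i expr1; apply/ideal_span_cons; exists c.
Qed.

Lemma remove_factors k r x : r != 0 ->
  ideal_span [seq F j ^+ k.+1 | j <- enum 'I_n] (toC (psi r) * (x * (\prod_j F j) ^+ k)) ->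
  ideal_span [seq F j | j <- enum 'I_n] x.
Proof.
move=> r0 hr.
have [||||e [e0 he]] := @lower_exponents (enum 'I_n) (fun=> k.+1) k (toC (psi r) * x).
- exact: enum_uniq.
- by [].
- by [].
- by rewrite big_enum /= prodrXl mulrC -mulrA.
have hx : ideal_span (powers e (enum 'I_n)) x.
  apply: regular_forms he => // [|P l pP PF Pr upl]; first exact: enum_uniq.
  have [_ h1] := dimension_bound (enum_uniq 'I_n) pP PF upl.
  by rewrite addnS; apply: h1 Pr.
apply: ideal_span_min hx; first exact: ideal_spanP.
move=> _ /mapP [j jj ->]; apply: ideal_exp => //; first exact: ideal_spanP.
by apply: ideal_span_mem; apply: map_f.
Qed.

(** In [E], where [h] vanishes, [rho] divides the nonzero constant [r]. *)
Lemma image_membership k (r : R) (rho a c : C) (b : B) (z : 'I_n -> {poly B}) :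
  r != 0 -> r%:P = a * rho + c * h ->
  map_poly const rho * (b%:P * (\prod_j fB j) ^+ k) = \sum_j fB j ^+ k.+1 * z j ->
  ideal_span [seq F j | j <- enum 'I_n] (toC (phi b)).
Proof.
move=> r0 er rel; apply: (remove_factors (k := k) r0).
pose toE : {rmorphism {poly B} -> E} := pi \o map_poly phi.
have rE : toC (psi r) = pi (map_poly psi a) * toE (map_poly const rho).
  rewrite -piC -map_polyC er rmorphD !rmorphM /= rmorphD !rmorphM /= pih mulr0 addr0.
  by rewrite /toE /= -[map_poly phi (map_poly const rho)]map_poly_comp.
have bE : toE b%:P = toC (phi b) by rewrite /toE /= map_polyC piC.
have FE j : toE (fB j) = F j by [].
rewrite rE -bE -mulrA; apply: ideal_mull; first exact: ideal_spanP.
have -> : (\prod_j F j) ^+ k = toE ((\prod_j fB j) ^+ k).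
  by rewrite rmorphXn rmorph_prod.
rewrite -!rmorphM rel rmorph_sum; apply: ideal_sum; first exact: ideal_spanP.
move=> j _; rewrite rmorphM rmorphXn FE; apply: ideal_mulr; first exact: ideal_spanP.
by apply: ideal_span_mem; apply: (map_f (fun j => F j ^+ k.+1)); rewrite mem_enum.
Qed.

End Dimension.

(** * Membership at a maximal ideal *)

Section ResidueField.
Variables (R : idomainType) (m : R -> Prop) (L : comNzRingType) (psi : {rmorphism R -> L}).
Variable ML : L -> Prop.
Hypothesis locML : local_ring ML.
Hypothesis psi_m : forall r, m r -> ML (psi r).
Hypothesis residue : forall y, exists r, ML (y - psi r).
Let iML : is_ideal ML. Proof. by case: locML => -[]. Qed.

Variable h : {poly R}.
Hypotheses (monh : h \is monic) (sh : (1 < size h)%N).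
Hypothesis invh : forall p, (exists q, poly_ideal m (p - q * h)) \/
              exists q c, poly_ideal m (p * q - 1 - c * h).

Definition modulus : {poly L} := map_poly psi h.
Local Notation E := {poly %/ modulus}.
Local Notation pi := (in_qpoly modulus).

Lemma modulus_monic : modulus \is monic. Proof. exact: monic_map. Qed.
Lemma modulus_size : (1 < size modulus)%N.
Proof. by rewrite size_map_poly_id0 // (monicP monh) rmorph1 oner_neq0. Qed.
Let monhL := modulus_monic.
Let shL := modulus_size.

Let ME : E -> Prop := extend ML.
Lemma extend_psi p : poly_ideal m p -> ME (pi (map_poly psi p)).
Proof.
by move=> mp; apply: extend_in_qpoly => // i; rewrite coef_map; apply: psi_m.
Qed.

Lemma pi_psi_mod a q : pi (map_poly psi (a - q * h)) = pi (map_poly psi a).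
Proof.
have pi0 : pi modulus = 0 by apply: in_qpoly_h.
rewrite (rmorphB (map_poly psi)) (rmorphB pi) (rmorphM (map_poly psi)) (rmorphM pi).
by rewrite [X in _ * X]pi0 mulr0 subr0.
Qed.

Lemma E_local : local_ring ME.
Proof.
have iME : is_ideal ME by apply: extend_ideal.
apply: extend_local => // p.
have [r rP] := boolp.choice (fun i : nat => residue p`_i).
pose pR := \poly_(i < size p) r i.
have dp : ME (pi (p - map_poly psi pR)).
  apply: extend_in_qpoly => // i; rewrite coefB coef_map coef_poly.
  case: ifP => [_|/negbT]; first exact: rP.
  rewrite -leqNgt => /(nth_default 0) ->.
  apply: ideal_sub => //; first exact: ideal_zero.
  exact: (eq_ind_r ML (ideal_zero iML) (rmorph0 psi)).
case: (invh pR) => [[q mq]|[q [c mc]]]; [left|right].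
  have -> : pi p = pi (p - map_poly psi pR) + pi (map_poly psi (pR - q * h)).
    by rewrite pi_psi_mod -rmorphD subrK.
  exact: (ideal_add iME dp (extend_psi mq)).
exists (map_poly psi q).
have -> : pi (p * map_poly psi q - 1) = pi (p - map_poly psi pR) * pi (map_poly psi q)
    + pi (map_poly psi (pR * q - 1 - c * h)).
  rewrite pi_psi_mod -rmorphM -rmorphD; congr (pi _).
  by rewrite (rmorphB (map_poly psi)) (rmorphM (map_poly psi)) rmorph1; ring.
exact: (ideal_add iME (ideal_mulr _ iME dp) (extend_psi mc)).
Qed.

Lemma unit_notin (D : {poly R}) (P : E -> Prop) :
  (exists q c, poly_ideal m (D * q - 1 - c * h)) -> prime_ideal P ->
  ~ P (pi (map_poly psi D)).
Proof.
move=> [q [c mc]] pP PD.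
have iME : is_ideal ME by apply: extend_ideal.
have Psub e : P e -> ME e.
  move=> Pe; apply: boolp.contrapT => /(local_unit E_local) [c' ce].
  apply: (prime_not1 pP); rewrite -ce; apply: ideal_mull => //; exact: prime_is_ideal.
have /prime_not1 := maximal_prime (proj1 E_local); apply.
have -> : (1 : E) = pi (map_poly psi D) * pi (map_poly psi q) -
   pi (map_poly psi (D * q - 1 - c * h)).
  rewrite pi_psi_mod -rmorphM -rmorphB -[LHS](rmorph1 pi); congr (pi _).
  by rewrite (rmorphB (map_poly psi)) (rmorphM (map_poly psi)) rmorph1; ring.
apply: (ideal_sub iME _ (extend_psi mc)).
exact: (Psub _ (ideal_mulr _ (prime_is_ideal pP) PD)).
Qed.

End ResidueField.

Lemma extend_const (L : comNzRingType) (h : {poly L}) I c : extend I (qpolyC h c) -> I c.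
Proof. by move=> /(_ 0%N); rewrite qpolyCE coefC. Qed.

Section ConstantTerm.
Variables (R : idomainType) (n : nat) (G : {fset 'M[R]_n}).
Hypothesis hG : subgroup_GL G.
Variable m : R -> Prop.
Hypothesis maxm : maximal_ideal m.

(** The maximal ideal [m + B_+] of the ring of invariants [B]. *)
Definition graded_max : invariant_ring G -> Prop := fun b => m ((val b)@_0%MM).

Lemma graded_max_comap :
  graded_max = comap (mcoeff 0%MM \o (val : {rmorphism invariant_ring G -> {mpoly R[n]}})) m.
Proof. by []. Qed.

Lemma graded_max_const r : graded_max (const_inv G r) <-> m r.
Proof. by rewrite /graded_max /= mcoeffC eqxx mulr1. Qed.

Lemma graded_max_diff b : graded_max (b - const_inv G ((val b)@_0%MM)).
Proof.
rewrite /graded_max /= mcoeffB mcoeffC eqxx mulr1 subrr.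
by apply: ideal_zero; case: maxm.
Qed.

Lemma graded_max_maximal : maximal_ideal graded_max.
Proof.
have [im nm1 _] := maxm.
have ig : is_ideal graded_max by rewrite graded_max_comap; apply: comap_ideal.
apply: maximal_of_inv => //.
  by rewrite /graded_max /= mcoeff1 eqxx.
move=> b nb; have [c mc] := maximal_inv maxm nb.
exists (const_inv G c).
have -> : const_inv G c * b - 1 = const_inv G c * (b - const_inv G ((val b)@_0%MM))
   + const_inv G (c * (val b)@_0%MM - 1).
  by rewrite rmorphB rmorphM rmorph1; ring.
apply: ideal_add => //; first by apply: ideal_mull => //; apply: graded_max_diff.
by apply/graded_max_const.
Qed.

End ConstantTerm.

Lemma lift_relation (A X : comNzRingType) (iota : {rmorphism A -> X}) : injective iota ->
  forall n (f z : 'I_n -> X) (fA zA : 'I_n -> A) (c b : X) (cA bA : A) k,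
  iota cA = c -> iota bA = b -> (forall j, iota (fA j) = f j) ->
  (forall j, iota (zA j) = z j) ->
  c * (b * (\prod_j f j) ^+ k) = \sum_j f j ^+ k.+1 * z j ->
  cA * (bA * (\prod_j fA j) ^+ k) = \sum_j fA j ^+ k.+1 * zA j.
Proof.
move=> inj n f z fA zA c b cA bA k <- <- fE zE e; apply: inj.
rewrite !rmorphM rmorphXn rmorph_prod rmorph_sum.
under eq_bigr => j _ do rewrite fE.
by rewrite e; apply: eq_bigr => j _; rewrite rmorphM rmorphXn fE zE.
Qed.

Section LocalStep.
Variables (R : idomainType) (n : nat) (G : {fset 'M[R]_n}).
Hypothesis hG : subgroup_GL G.
Variable m : R -> Prop.
Hypothesis maxm : maximal_ideal m.
Local Notation S := {mpoly R[n]}.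
Local Notation C := {poly R}.
Local Notation CX := {mpoly C[n]}.
Local Notation B := (invariant_ring G).
Local Notation MM := (@graded_max R n G m).
Local Notation GX := (groupX G).
Local Notation g := #|` G|.
Let im : is_ideal m. Proof. by case: maxm. Qed.
Let hGX : subgroup_GL GX := groupX_subgroup hG.

(** A denominator outside the graded maximal ideal has a constant term that is
    invertible modulo [m]. *)
Lemma residue_repr (L : comNzRingType) (phi : {rmorphism B -> L}) ML :
  is_localization MM phi -> local_ring ML -> forall y, exists r, ML (y - phi (const_inv G r)).
Proof.
move=> locL locML y.
have primeMM : prime_ideal MM := maximal_prime (graded_max_maximal G maxm).
have iML : is_ideal ML by case: locML => -[].
have [a [s [nMs e]]] : exists a s, ~ MM s /\ y * phi s = phi a by case: locL.
have [c mc] := maximal_inv maxm nMs.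
have MLphi b : MM b -> ML (phi b).
  by move=> Mb; apply/(loc_maximal primeMM locL b locML).
exists (c * (val a)@_0%MM).
have -> : y - phi (const_inv G (c * (val a)@_0%MM)) =
   phi (const_inv G c) * phi (a - const_inv G ((val a)@_0%MM)) -
   y * phi (const_inv G c * (s - const_inv G ((val s)@_0%MM)) +
        const_inv G (c * (val s)@_0%MM - 1)).
  rewrite !(rmorphB, rmorphM, rmorphD, rmorph1) /= -e.
  ring.
apply: ideal_sub => //; apply: ideal_mull => //; apply: MLphi; first exact: graded_max_diff.
have ig := prime_is_ideal primeMM.
apply: ideal_add => //; first by apply: ideal_mull => //; apply: graded_max_diff.
exact/graded_max_const.
Qed.

Definition conjugates (j : 'I_n) : seq 'rV[C]_n :=
  [seq @generic_row R n j *m invmx s | s <- GX].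
Definition alldet : C := \prod_(s : {ffun 'I_n -> G})
  \det (rows (fun i => @generic_row R n i *m map_mx polyC (invmx (val (s i))))).

Lemma conjugates_choice w : (forall i, w i \in conjugates i) ->
  exists s : {ffun 'I_n -> G},
    w = (fun i => @generic_row R n i *m map_mx polyC (invmx (val (s i)))).
Proof.
move=> wP; have uG t : t \in G -> t \in unitmx by case: hG => uG _ _ _; apply: uG.
have /boolp.choice [s sP] : forall i, exists s : G,
    w i = @generic_row R n i *m map_mx polyC (invmx (val s)).
  move=> i; have /mapP [_ /groupXP [t tG ->] ->] := wP i.
  by exists [` tG]%fset; rewrite map_invmx_polyC // uG.
by exists [ffun i => s i]; apply: boolp.funext => i; rewrite ffunE.
Qed.

Lemma alldet_notin : ~ poly_ideal m alldet.
Proof.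
move=> /(prime_prod (poly_ideal_prime (maximal_prime maxm))) [s _].
apply: generic_det => //; first by case: maxm.
move=> i; rewrite unitmx_inv; case: hG => uG _ _ _; apply: uG; exact: valP.
Qed.

Lemma map_polyC_homog t (f : S) : homogeneous_of t f ->
  homogeneous_of t (map_mpoly polyC f : CX).
Proof.
move=> hf; rewrite [f]mpolyE rmorph_sum big_seq /=; apply: homog_sum => p pf.
rewrite map_mpolyZ map_mpolyX -(msupp_homog hf pf).
by apply: homogZ; apply: homog_mnm.
Qed.

Lemma to_invX_invariant p : @to_invX R n G p \in invariants GX.
Proof.
apply/invariantsP => _ /groupXP [s sG ->]; apply: (can_inj (@spreadK R n)).
have us : s \in unitmx by case: hG => uG _ _ _; apply: uG.
rewrite spread_act //; apply/polyP => i; rewrite coef_map /= to_invX_val.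
have /invariantsP := valP p`_i; exact.
Qed.

(** [top_degree] and [image_membership] put [b] into the ideal of [L] generated
    by the coefficients of the [fB j], which are invariants of degree [g];
    clear the denominator and compare the components of degree [t]. *)
Lemma local_step (b : B) t : homogeneous_of t (val b) -> (n * (g - 1) < t)%N -> (g <= t)%N ->
  (exists (L : comNzRingType) (phi : {rmorphism B -> L}),
      is_localization MM phi /\ cohen_macaulay_local L) ->
  exists s (cs : seq B) (c : nat -> B), [/\ ~ m s,
     forall x, x \in cs -> homogeneous_of g (val x),
     forall i, homogeneous_of (t - g) (val (c i))
     & s *: val b = \sum_(i < size cs) val (c i) * val cs`_i].
Proof.
move=> hb tn gt [L [phi [locL [noethL [ML [d [locML [_ dimL] [[s0 [reg0 Ms0] sz0] _]]]]]]]].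
have primeMM : prime_ideal MM := maximal_prime (graded_max_maximal G maxm).
have iML : is_ideal ML by case: locML => -[].
have cardGX : #|` GX| = g := groupX_card G.
have uG s : s \in G -> s \in unitmx by case: hG => uG _ _ _; apply: uG.
have detv (s : 'I_n -> 'M[C]_n) : (forall i, s i \in GX) ->
    \det (rows (fun i => @generic_row R n i *m invmx (s i))) != 0.
  move=> sG; have [|s' e] := @conjugates_choice (fun i => @generic_row R n i *m invmx (s i)).
    by move=> i; apply: map_f.
  rewrite e; apply/negP => /eqP h0; case: (maxm) => _ nm1 _.
  apply: (@generic_det R n m (fun i => invmx (val (s' i))) im nm1).
    by move=> i; rewrite unitmx_inv; apply: uG; apply: valP.
  by rewrite h0 => i; rewrite coef0; apply: ideal_zero.
have injU : {in GX &, injective (fun s => (\row_j 'X^j : 'rV[C]_n) *m invmx s)}.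
  move=> _ _ /groupXP [s sG ->] /groupXP [t' tG ->].
  rewrite !map_invmx_polyC ?uG // => /(@generic_inj R n) /(congr1 invmx).
  by rewrite !invmxK => ->.
pose bC := @to_invX R n G b%:P.
have bCi : bC \in invariants GX by apply: to_invX_invariant.
have hbC : homogeneous_of t bC by rewrite /bC to_invX_C; apply: map_polyC_homog.
have [|k [rho [rho0 [z [zi ez]]]]] := top_degree hGX detv injU bCi hbC.
  by rewrite cardGX.
have [h [monh sh invh invD [r [a [c [r0 er]]]]]] :=
  exists_good_modulus maxm alldet_notin rho0.
pose psi : {rmorphism R -> L} := phi \o @const_inv R n G.
have psi_m q : m q -> ML (psi q).
  move=> mq; apply/(loc_maximal primeMM locL _ locML); exact/graded_max_const.
have residue y : exists q, ML (y - psi q) := residue_repr locL locML y.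
pose fB j := of_invX G (orbit_prod GX (@generic_row R n j)).
have fBK j : to_invX G (fB j) = orbit_prod GX (@generic_row R n j).
  by apply: of_invXK => //; apply: orbit_prod_inv.
have rel : map_poly (@const_inv R n G) rho * (b%:P * (\prod_j fB j) ^+ k) =
    \sum_j fB j ^+ k.+1 * of_invX G (z j).
  apply: (@lift_relation _ _ (@to_invX R n G) (@to_invX_inj R n G) n
    (fun j => orbit_prod GX (@generic_row R n j)) z fB (fun j => of_invX G (z j)) rho%:MP bC).
  - exact: to_invX_const.
  - by [].
  - exact: fBK.
  - by move=> j; apply: of_invXK.
  - by rewrite mul_mpolyC.
pose hL := modulus psi h.
have monhL : hL \is monic := modulus_monic psi monh.
have shL : (1 < size hL)%N := modulus_size psi monh sh.
have locE := E_local locML psi_m residue monh sh invh.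
have regE : regular_on (extend (h := hL) ML) (fun x => x = 0) [seq qpolyC hL y | y <- s0].
  rewrite -extend_zero; apply: extend_regular => //; first exact: zero_ideal.
  exact: regular_on_of_seq.
have span : ideal_span [seq in_qpoly hL (map_poly phi (fB j)) | j <- enum 'I_n]
    (qpolyC hL (phi b)).
  apply: (@image_membership R n B (@const_inv R n G) _ _ (@to_invX R n G) _ _ _ MM L phi
    primeMM locL _ (in_qpoly hL) (qpolyC hL) _ _ h monh sh _ conjugates _ _ fB _ d dimL
    (extend ML) _ locE _ regE _ k r rho a c b (fun j => of_invX G (z j)) r0 er rel).
  - by move=> q /(congr1 val) /= /eqP; rewrite mpolyC_eq0 => /eqP.
  - move=> x y /(congr1 val) /= /eqP; rewrite mulf_eq0 => /orP [] /eqP h0; [left|right];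
      exact: val_inj.
  - exact: to_invX_integral.
  - by move=> p p0; apply: (@to_invX_inj R n G); rewrite p0 rmorph0.
  - exact: to_invX_const.
  - exact: in_qpolyC.
  - exact: qpoly_integral.
  - exact: in_qpoly_h.
  - move=> j; exists (@generic_row R n j *m invmx 1%:M); apply: map_f.
    by case: hGX.
  - move=> w /conjugates_choice [s ->] P pP.
    apply: (unit_notin locML psi_m residue monh sh invh) => //.
    have [q [c' hq]] := invD.
    exists (\prod_(s' | s' != s) \det (rows (fun i => @generic_row R n i *m
       map_mx polyC (invmx (val (s' i))))) * q), c'.
    by move: hq; rewrite /alldet (bigD1 s) //= mulrA.
  - by move=> j; have := fBK j; rewrite orbit_prodE.
  - exact: qpoly_noetherian.
  - by rewrite size_map.
pose cs := flatten [seq (fB j : seq B) | j <- enum 'I_n].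
pose J := ideal_span [seq phi x | x <- cs].
have iJ : is_ideal J := ideal_spanP _.
have Jb : J (phi b).
  apply: (@extend_const L hL); apply: ideal_span_min span; first exact: extend_ideal.
  move=> _ /mapP [j _ ->]; apply: extend_in_qpoly => // i; rewrite coef_map /=.
  have [si|si] := ltnP i (size (fB j)); last first.
    by rewrite nth_default // rmorph0; apply: ideal_zero.
  apply: ideal_span_mem; apply: map_f; apply/flattenP.
  by exists (fB j : seq B); [apply: map_f; rewrite mem_enum|apply: mem_nth].
have [s nMs [c' es]] := loc_clear_span primeMM locL Jb.
have hcs x : x \in cs -> homogeneous_of g (val x).
  move=> /flattenP [_ /mapP [j _ ->] /(nthP 0) [i _ <-]].
  rewrite -to_invX_val fBK -cardGX; apply: spread_homog; exact: orbit_prod_homog.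
pose comp_inv (e : nat) (x : B) : B :=
  InvariantRing (invariants_component e (valP x)).
exists ((val s)@_0%MM), cs, (fun i => comp_inv (t - g)%N (c' i)); split=> //.
  by move=> i; apply: homog_component.
pose vm : {rmorphism B -> S} := val.
have := congr1 (fun x : B => component t (vm x)) es.
rewrite rmorphM rmorph_sum mulrC (component_mulr _ _ hb) ltnn subnn.
have -> : component 0 (val s) = ((val s)@_0%MM)%:MP.
  rewrite componentE -[RHS]mulr1 -mpolyX0 mul_mpolyC.
  have [in0|out0] := boolP (0%MM \in msupp (val s)).
    rewrite big_mkcond (bigD1_seq 0%MM) ?msupp_uniq //= mdeg0 eqxx.
    by rewrite big1 ?addr0 // => p pn; rewrite mdeg_eq0 (negbTE pn).
  rewrite (memN_msupp_eq0 out0) scale0r big_seq_cond big1 // => p /andP [pin].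
  by rewrite mdeg_eq0 => /eqP p0; rewrite p0 (negbTE out0) in pin.
rewrite mulrC mul_mpolyC => ->.
rewrite component_sum; apply: eq_bigr => i _.
rewrite rmorphM mulrC (component_mulr _ _ (hcs _ (mem_nth _ (ltn_ord i)))).
by rewrite ltnNge gt /= mulrC.
Qed.

End LocalStep.

(** * Degree bound *)

Section Generation.
Variables (R : idomainType) (n : nat) (G : {fset 'M[R]_n}).
Local Notation S := {mpoly R[n]}.

Definition generated k (f : S) := exists m (g : m.-tuple S) (p : {mpoly R[m]}),
  (forall i, tnth g i \in invariants G /\ (msize (tnth g i) <= k.+1)%N) /\ f = p \mPo g.

Lemma comp_mpoly_assoc a b (p : {mpoly R[a]}) (q : a.-tuple {mpoly R[b]}) (g : b.-tuple S) :
  (p \mPo q) \mPo g = p \mPo [tuple tnth q i \mPo g | i < a].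
Proof.
move: p; apply: (mpoly_rmorph_ext (u := comp_mpoly g \o comp_mpoly q)
  (v := comp_mpoly [tuple tnth q i \mPo g | i < a])) => [c|i] /=.
  by rewrite !comp_mpolyC.
by rewrite !comp_mpolyXU -!tnth_nth tnth_mktuple.
Qed.

(** Addition and multiplication at once: juxtapose the generators. *)
Lemma generated_op2 k (op : forall m, {mpoly R[m]} -> {mpoly R[m]} -> {mpoly R[m]}) f1 f2 :
  (forall m l (p q : {mpoly R[m]}) (g : m.-tuple {mpoly R[l]}),
     op m p q \mPo g = op l (p \mPo g) (q \mPo g)) ->
  generated k f1 -> generated k f2 -> generated k (op n f1 f2).
Proof.
move=> opE [m1 [g1 [p1 [h1 ->]]]] [m2 [g2 [p2 [h2 ->]]]].
pose g : (m1 + m2).-tuple S := [tuple match split i with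
  inl j => tnth g1 j | inr j => tnth g2 j end | i < m1 + m2].
exists (m1 + m2)%N, g, (op _ (p1 \mPo [tuple 'X_(lshift m2 i) | i < m1])
  (p2 \mPo [tuple 'X_(rshift m1 i) | i < m2])); split.
  by move=> i; rewrite tnth_mktuple; case: (split i) => j; [apply: h1|apply: h2].
rewrite opE !comp_mpoly_assoc.
have -> : [tuple tnth [tuple 'X_(lshift m2 i) | i < m1] i \mPo g | i < m1] = g1.
  apply: eq_from_tnth => i; rewrite !tnth_mktuple comp_mpolyXU -tnth_nth tnth_mktuple.
  by rewrite -[lshift m2 i]/(unsplit (inl i)) unsplitK.
suff -> : [tuple tnth [tuple 'X_(rshift m1 i) | i < m2] i \mPo g | i < m2] = g2 by [].
apply: eq_from_tnth => i; rewrite !tnth_mktuple comp_mpolyXU -tnth_nth tnth_mktuple.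
by rewrite -[rshift m1 i]/(unsplit (inr i)) unsplitK.
Qed.

Lemma generatedC k c : generated k c%:MP.
Proof.
exists 0%N, [tuple], c%:MP; split; first by case.
by rewrite comp_mpolyC.
Qed.
Lemma generatedD k f1 f2 : generated k f1 -> generated k f2 -> generated k (f1 + f2).
Proof. by apply: (@generated_op2 k (fun m p q => p + q)) => *; rewrite rmorphD. Qed.
Lemma generatedM k f1 f2 : generated k f1 -> generated k f2 -> generated k (f1 * f2).
Proof. by apply: (@generated_op2 k (fun m p q => p * q)) => *; rewrite rmorphM. Qed.
Lemma generated_sum k (I : Type) (r : seq I) (P : pred I) (F : I -> S) :
  (forall i, P i -> generated k (F i)) -> generated k (\sum_(i <- r | P i) F i).
Proof.
move=> h; apply: (big_ind (generated k)) => //; last exact: generatedD.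
by rewrite -(mpolyC0 n); apply: generatedC.
Qed.
Lemma generated_gen k t f : f \in invariants G -> homogeneous_of t f -> (t <= k)%N ->
  generated k f.
Proof.
move=> fi hf tk; exists 1%N, [tuple f], 'X_ord0; split.
  move=> i; rewrite (ord1 i); split=> //.
  by apply: leq_trans (msize_homog hf) _.
by rewrite comp_mpolyXU.
Qed.

Hypothesis hG : subgroup_GL G.
Hypothesis hCM : cohen_macaulay (invariant_ring G).
Local Notation g := #|` G|.
Let bound := maxn g (n * (g - 1)).

(** The scalars that carry a homogeneous invariant into the subalgebra
    generated in low degrees form an ideal of [R], which [local_step] shows to
    lie in no maximal ideal. *)
Lemma generated_homogeneous t f : f \in invariants G -> homogeneous_of t f ->
  generated bound f.
Proof.
elim/ltn_ind: t f => t IH f fi hf.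
have [tb|bt] := leqP t bound; first exact: generated_gen hf tb.
have gb : (g <= bound)%N by apply: leq_maxl.
have gt : (g < t)%N by apply: leq_ltn_trans bt.
have g0 : (0 < g)%N.
  by rewrite cardfs_gt0; apply/fset0Pn; exists 1%:M; case: hG.
pose I (s : R) := generated bound (s *: f).
have iI : is_ideal I.
  split; rewrite /I.
  - by rewrite scale0r -(mpolyC0 n); apply: generatedC.
  - by move=> a b; rewrite scalerDl; apply: generatedD.
  - by move=> c a ha; rewrite -scalerA -mul_mpolyC; apply: generatedM => //; apply: generatedC.
have [I1|nI1] := boolp.EM (I 1); first by rewrite /I scale1r in I1.
have [m [maxm Im]] := exists_maximal_ideal iI nI1.
have [|||s [cs [c [nms hcs hc e]]]] :=
    @local_step R n G hG m maxm (InvariantRing fi) t hf.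
- by apply: leq_ltn_trans bt; apply: leq_maxr.
- exact: ltnW.
- by case: hCM => _; apply; apply: graded_max_maximal.
case: nms; apply: Im; rewrite /I -[f]/(val (InvariantRing fi)) e.
apply: generated_sum => i _; apply: generatedM.
  apply: (IH (t - g)%N); [by rewrite ltn_subrL g0 (leq_trans _ gt)|exact: valP|exact: hc].
apply: (generated_gen (t := g)) => //; first exact: valP.
by apply: hcs; apply: mem_nth.
Qed.

Lemma generated_invariants : generated_in_degree G bound.
Proof.
move=> f fi; rewrite (sum_component f).
apply: (generated_sum (k := bound)) => d _.
by apply: (generated_homogeneous (t := d)); [apply: invariants_component|apply: homog_component].
Qed.

End Generation.

Theorem theorem4p7 (R : idomainType) (n : nat) (G : {fset 'M[R]_n})
    (hR : noetherian R) (hG : subgroup_GL G)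
    (hCM : cohen_macaulay (invariant_ring G)) :
  exists b : nat,
    is_beta G b /\ (b <= maxn #|` G|%fset (n * (#|` G|%fset - 1)))%N.
Proof.
have gen := generated_invariants hG hCM.
have exb : exists b, boolp.asbool (generated_in_degree G b).
  by exists (maxn #|` G|%fset (n * (#|` G|%fset - 1))); apply/boolp.asboolP.
exists (ex_minn exb); case: ex_minnP => b /boolp.asboolP genb minb.
split; last by apply: minb; apply/boolp.asboolP.
by split=> // j genj; apply: minb; apply/boolp.asboolP.
Qed.
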